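(* For every integer $n\ge 0$, the quaternionic polyanalytic Fock space $\widetilde{\mathcal F}^{n+1}_{Slice}(\mathbb H)$ is the direct sum of the quaternionic true polyanalytic Fock spaces $\mathcal F_T^{j}(\mathbb H)$, $j=0,\dots,n$: $$\widetilde{\mathcal F}^{n+1}_{Slice}(\mathbb H)=\bigoplus_{j=0}^{n}\mathcal F_T^{j}(\mathbb H).$$
   Context: $\mathbb H$ is the skew field of quaternions, $\mathbb S=\{q\in\mathbb H: q^2=-1\}$, and for $I\in\mathbb S$, $\mathbb C_I=\mathbb R+\mathbb R I$ with Lebesgue measure $d\lambda_I$; $f_I$ denotes the restriction of $f$ to $\mathbb C_I$. A function $f:\mathbb H\to\mathbb H$ is a (left) slice function if $f(x+Iy)=\alpha(x,y)+I\beta(x,y)$ for all $x,y\in\mathbb R$, $I\in\mathbb S$, with $\alpha,\beta:\mathbb R^2\to\mathbb H$, $\alpha(x,-y)=\alpha(x,y)$, $\beta(x,-y)=-\beta(x,y)$. It is slice polyanalytic of order $m\geq 1$ if moreover $\alpha,\beta$ are of class $C^m$ and $\frac{1}{2^m}(\partial_x+I\partial_y)^m f_I(x+Iy)=0$ for all $I\in\mathbb S$; it is slice regular if it is slice polyanalytic of order $1$. The slice derivative $\partial_s$ acts on (sufficiently smooth) slice functions on each slice by $\partial_s f(x+Iy)=\frac12(\partial_x-I\partial_y)f_I(x+Iy)$. $\widetilde{\mathcal F}^{n+1}_{Slice}(\mathbb H)$ is the right $\mathbb H$-vector space of slice polyanalytic functions $f:\mathbb H\to\mathbb H$ of order $n+1$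 with $\int_{\mathbb C_I}|f_I(q)|^2e^{-2\pi|q|^2}d\lambda_I(q)<\infty$ for a given $I\in\mathbb S$ (the space does not depend on the choice of $I$). $\mathcal F_T^{j}(\mathbb H)$ is the set of functions $f:\mathbb H\to\mathbb H$ such that (i) $\int_{\mathbb C_I}|f_I(q)|^2e^{-2\pi|q|^2}d\lambda_I(q)<\infty$, and (ii) there exists a slice regular function $H:\mathbb H\to\mathbb H$ such that $$f(q)=(-1)^j\sqrt{\tfrac{1}{(2\pi)^j j!}}\;e^{2\pi|q|^2}\,\partial_s^j\!\left(e^{-2\pi|q|^2}H(q)\right).$$ *)

(* Defs.v *)
From HB Require Import structures.
From mathcomp Require Import all_boot all_order all_algebra.
From mathcomp Require Import ring.
From mathcomp Require Import all_classical all_reals all_analysis.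

Set Implicit Arguments.
Unset Strict Implicit.
Unset Printing Implicit Defensive.

Import Order.TTheory GRing.Theory Num.Theory.
Import numFieldNormedType.Exports.

Local Open Scope classical_set_scope.
Local Open Scope ring_scope.

(* Quaternions a + b i + c j + d k, as row vectors (a, b, c, d). The norm
   `|q| inherited from row vectors is the sup norm: it only serves the topology
   and the derivatives; the Euclidean modulus is qabs below. *)
Definition quat (R : Type) : Type := 'rV[R]_4.

HB.instance Definition _ (R : realType) := NormedModule.on (quat R).

Definition mkquat (R : Type) (a b c d : R) : quat R :=
  \row_(i < 4) nth a [:: a; b; c; d] i.

Section QuatRing.
Variable R : realType.
Implicit Types p q r : quat R.

Definition qre q : R := q ord0 (inord 0).
Definition qi q : R := q ord0 (inord 1).
Definition qj q : R := q ord0 (inord 2).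
Definition qk q : R := q ord0 (inord 3).

Definition qone : quat R := mkquat 1 0 0 0.

Definition qmul p q : quat R := mkquat
  (qre p * qre q - qi p * qi q - qj p * qj q - qk p * qk q)
  (qre p * qi q + qi p * qre q + qj p * qk q - qk p * qj q)
  (qre p * qj q - qi p * qk q + qj p * qre q + qk p * qi q)
  (qre p * qk q + qi p * qj q - qj p * qi q + qk p * qre q).

Lemma qre_mk a b c d : qre (mkquat a b c d) = a.
Proof. by rewrite /qre mxE inordK. Qed.
Lemma qi_mk a b c d : qi (mkquat a b c d) = b.
Proof. by rewrite /qi mxE inordK. Qed.
Lemma qj_mk a b c d : qj (mkquat a b c d) = c.
Proof. by rewrite /qj mxE inordK. Qed.
Lemma qk_mk a b c d : qk (mkquat a b c d) = d.
Proof. by rewrite /qk mxE inordK. Qed.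
Definition q_mk := (qre_mk, qi_mk, qj_mk, qk_mk).

Lemma qreD p q : qre (p + q) = qre p + qre q. Proof. by rewrite /qre mxE. Qed.
Lemma qiD p q : qi (p + q) = qi p + qi q. Proof. by rewrite /qi mxE. Qed.
Lemma qjD p q : qj (p + q) = qj p + qj q. Proof. by rewrite /qj mxE. Qed.
Lemma qkD p q : qk (p + q) = qk p + qk q. Proof. by rewrite /qk mxE. Qed.
Definition q_D := (qreD, qiD, qjD, qkD).

Lemma qreZ a p : qre (a *: p) = a * qre p. Proof. by rewrite /qre mxE. Qed.
Lemma qiZ a p : qi (a *: p) = a * qi p. Proof. by rewrite /qi mxE. Qed.
Lemma qjZ a p : qj (a *: p) = a * qj p. Proof. by rewrite /qj mxE. Qed.
Lemma qkZ a p : qk (a *: p) = a * qk p. Proof. by rewrite /qk mxE. Qed.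
Definition q_Z := (qreZ, qiZ, qjZ, qkZ).

Lemma quatP p q :
  [/\ qre p = qre q, qi p = qi q, qj p = qj q & qk p = qk q] -> p = q.
Proof.
case=> h0 h1 h2 h3; apply/rowP => i; rewrite -[i]inord_val.
by case: i => -[|[|[|[|i]]]].
Qed.

Fact qmulA : associative qmul.
Proof. by move=> p q r; apply: quatP; rewrite /qmul !q_mk; split; ring. Qed.

Fact qmul1q : left_id qone qmul.
Proof. by move=> p; apply: quatP; rewrite /qmul /qone !q_mk; split; ring. Qed.

Fact qmulq1 : right_id qone qmul.
Proof. by move=> p; apply: quatP; rewrite /qmul /qone !q_mk; split; ring. Qed.

Fact qmulDl : left_distributive qmul +%R.
Proof.
by move=> p q r; apply: quatP; rewrite /qmul !(q_D, q_mk); split; ring.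
Qed.

Fact qmulDr : right_distributive qmul +%R.
Proof.
by move=> p q r; apply: quatP; rewrite /qmul !(q_D, q_mk); split; ring.
Qed.

Fact qone_neq0 : qone != 0.
Proof.
by apply/eqP => /(congr1 qre); rewrite q_mk /qre mxE => /eqP; rewrite oner_eq0.
Qed.

HB.instance Definition _ := GRing.Zmodule_isNzRing.Build (quat R)
  qmulA qmul1q qmulq1 qmulDl qmulDr qone_neq0.

Fact qscaleAl (a : R) p q : a *: (p * q) = (a *: p) * q.
Proof.
apply: quatP; rewrite /GRing.mul /= /qmul !(q_Z, q_mk).
by split; ring.
Qed.

HB.instance Definition _ := GRing.Lmodule_isLalgebra.Build R (quat R) qscaleAl.

Fact qscaleAr (a : R) p q : a *: (p * q) = p * (a *: q).
Proof.
apply: quatP; rewrite /GRing.mul /= /qmul !(q_Z, q_mk).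
by split; ring.
Qed.

HB.instance Definition _ := GRing.Lalgebra_isAlgebra.Build R (quat R) qscaleAr.

End QuatRing.

Section SliceFunctions.
Variable R : realType.
Implicit Types (I J q : quat R) (f g H : quat R -> quat R).

Definition qabs q : R :=
  Num.sqrt (qre q ^+ 2 + qi q ^+ 2 + qj q ^+ 2 + qk q ^+ 2).

Definition imag_units : set (quat R) := [set q | q ^+ 2 = -1].

(* The point x + I y of the slice C_I, for p = (x, y). *)
Definition slice_pt I (p : R * R) : quat R := p.1%:A + p.2 *: I.

(* f_I, seen as a function of (x, y). *)
Definition slice_restr f I : R * R -> quat R := fun p => f (slice_pt I p).

Definition pdx (F : R * R -> quat R) : R * R -> quat R :=
  fun p => 'D_((1, 0) : R * R) F p.
Definition pdy (F : R * R -> quat R) : R * R -> quat R :=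
  fun p => 'D_((0, 1) : R * R) F p.

Fixpoint class_C (m : nat) (F : R * R -> quat R) : Prop :=
  continuous F /\
  if m is m'.+1 then
    [/\ forall p, derivable F p ((1, 0) : R * R),
        forall p, derivable F p ((0, 1) : R * R),
        class_C m' (pdx F) & class_C m' (pdy F)]
  else True.

(* d/dx + I d/dy and (d/dx - I d/dy) / 2, with I multiplying on the left. *)
Definition cauchy_riemann I (F : R * R -> quat R) : R * R -> quat R :=
  fun p => pdx F p + I * pdy F p.
Definition slice_d I (F : R * R -> quat R) : R * R -> quat R :=
  fun p => 2^-1 *: (pdx F p - I * pdy F p).

(* The m-th iterate of the slice derivative of f, at the point slice_pt I p. *)
Definition slice_deriv (m : nat) f I : R * R -> quat R :=
  iter m (slice_d I) (slice_restr f I).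

Definition slice_components f (a b : R * R -> quat R) : Prop :=
  [/\ forall I p, imag_units I -> f (slice_pt I p) = a p + I * b p,
      forall x y, a (x, - y) = a (x, y) &
      forall x y, b (x, - y) = - b (x, y)].

Definition slice_polyanalytic (m : nat) f : Prop :=
  (exists a b, [/\ slice_components f a b, class_C m a & class_C m b]) /\
  (forall I p, imag_units I ->
     (2 ^+ m)^-1 *: iter m (cauchy_riemann I) (slice_restr f I) p = 0).

Definition slice_regular H : Prop := slice_polyanalytic 1 H.

Definition gauss (q : quat R) : R := expR (- (2 * pi * qabs q ^+ 2)).

(* The map slice_pt I identifies Lebesgue measure on R^2 with that of C_I. *)
Definition fock_integrable I f : Prop :=
  (\int[(@lebesgue_measure R \x @lebesgue_measure R)%E]_(p in setT)
     (qabs (f (slice_pt I p)) ^+ 2 * gauss (slice_pt I p))%:E < +oo)%E.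

Definition fock_space (m : nat) I : set (quat R -> quat R) :=
  [set f | slice_polyanalytic m f /\ fock_integrable I f].

Definition true_fock_space (j : nat) I : set (quat R -> quat R) :=
  [set f | fock_integrable I f /\
    exists2 H, slice_regular H &
      forall J p, imag_units J ->
        f (slice_pt J p) =
          ((-1) ^+ j * Num.sqrt (1 / ((2 * pi) ^+ j * j`!%:R))
             * expR (2 * pi * qabs (slice_pt J p) ^+ 2))
          *: slice_deriv j (fun q => gauss q *: H q) J p].

Definition right_subspace (V : set (quat R -> quat R)) : Prop :=
  [/\ V 0,
      forall f g, V f -> V g -> V (f + g) &
      forall f (c : quat R), V f -> V (fun q => f q * c)].

Definition is_direct_sum (k : nat) (V : set (quat R -> quat R))
    (W : 'I_k -> set (quat R -> quat R)) : Prop :=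
  [/\ right_subspace V,
      forall j, right_subspace (W j),
      V = [set \sum_(j < k) g j | g in [set g : 'I_k -> quat R -> quat R |
                                         forall j, W j (g j)]] &
      forall g g' : 'I_k -> quat R -> quat R,
        (forall j, W j (g j)) -> (forall j, W j (g' j)) ->
        \sum_(j < k) g j = \sum_(j < k) g' j -> forall j, g j = g' j].

End SliceFunctions.

(* Main.v *)
Require Import Defs.
From HB Require Import structures.
From mathcomp Require Import all_boot all_order all_algebra.
From mathcomp Require Import ring lra.
From mathcomp Require Import complex.
From mathcomp Require Import all_classical all_reals all_analysis.
From mathcomp Require Import measurable_realfun.

(* A slice function f(x + J y) = a + J b amounts to four complex functions a_c + i b_c of (x, y),
   one per real coordinate c of H, on which d/dx + J d/dy acts as d/dx + i d/dy; everything is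
   proved for these. Write D = del - 2 pi conj(z), so that f in F_T^j means f = D^j h with h
   entire. Since dbar D = D dbar - 2 pi, one has dbar^n D^n h = (-2 pi)^n n! h for h entire, so
   the top component of a polyanalytic f of order n + 1 is read off dbar^n f; subtracting it and
   iterating gives existence and uniqueness of f = sum_j D^j h_j. For this h_j must be smooth:
   differentiating circle means of a C^1 solution h of the Cauchy-Riemann equations gives
   h'(a) = 1/(2 pi) int h(a + e^(it)) e^(-it) dt, hence h' is again such a solution.

   Integrability of each component: multiplication by exp (- 2 pi conj(a) (z - a)) turns D into
   its translate centered at a, and the mean of the product over the circle of center a and
   radius r is sum_j p_j(r^2) (D^j h_j)(a) with p_j a real polynomial of degree j. By
   Cauchy-Schwarz, Tonelli and translation invariance this mean is, as a function of a, in the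
   Gaussian L^2 space for every r, and varying r isolates each D^j h_j. *)

Set Implicit Arguments.
Unset Strict Implicit.
Unset Printing Implicit Defensive.

Import Order.TTheory GRing.Theory Num.Theory.
Import numFieldNormedType.Exports.

Local Open Scope classical_set_scope.
Local Open Scope ring_scope.
Local Open Scope complex_scope.

(** * Differentiability of C^1 functions on the plane *)

Section PlaneCalculus.
Variable R : realType.
Implicit Types (u v : R * R -> R) (p : R * R).

(** The obstacle is regularity. A component of a function of order n + 1 is only of class C^(n+1),
    so its image under dbar^n is merely C^1; this is why [ent] asks for C^1 only, and why
    derivatives of such a solution must be shown to be solutions before a power of D can be formed.

    The symmetry F(conj z) = conj F(z), called [csym], has to accompany every component: it says
    that a is even and b odd in y, and without it a + J b could take two values at x + J y = x +
    (-J)(-y). Integrability is assumed on one slice, where it bounds only a + I b; the weight is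
    even in y, so a - I b is bounded as well, which separates a from b.

    Subtracting the top component says nothing about integrability, since no bound on that component
    is known beforehand. The twisted means play the part of orthogonality: on D^j h they act as
    multiplication by a number that depends on the radius alone, and these numbers are polynomials
    of distinct degrees for distinct j. *)

Definition xdir : R * R := (1, 0).
Definition ydir : R * R := (0, 1).

(** The two difference quotients are the same function of the increment, so one-variable calculus
    applies to partial derivatives. *)
Lemma is_derive_exE u p l :
  is_derive p xdir u l <-> is_derive p.1 1 (fun x => u (x, p.2)) l.
Proof.
have E : (fun h : R => h^-1 *: (u (h *: xdir + p) - u p)) =
    (fun h : R => h^-1 *: (u (h *: (1 : R) + p.1, p.2) - u (p.1, p.2))).
  apply/funext => h; case: p => x y; congr (_ *: (u _ - _)).
  by congr (_, _) => /=; rewrite scaler0 add0r.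
by split=> -[d e]; constructor; rewrite /derivable /derive E in d e *.
Qed.

Lemma is_derive_eyE u p l :
  is_derive p ydir u l <-> is_derive p.2 1 (fun y => u (p.1, y)) l.
Proof.
have E : (fun h : R => h^-1 *: (u (h *: ydir + p) - u p)) =
    (fun h : R => h^-1 *: (u (p.1, h *: (1 : R) + p.2) - u (p.1, p.2))).
  apply/funext => h; case: p => x y; congr (_ *: (u _ - _)).
  by congr (_, _) => /=; rewrite scaler0 add0r.
by split=> -[d e]; constructor; rewrite /derivable /derive E in d e *.
Qed.

(** No order between [x0] and [x] is assumed: composing with the opposite reduces [x < x0] to the
    usual mean value theorem. *)
Lemma mvt_ball (f df : R -> R) (x0 r x : R) :
  (forall x : R, is_derive x (1 : R) f (df x)) -> `|x - x0| < r ->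
  exists2 c, `|c - x0| < r & f x - f x0 = df c * (x - x0).
Proof.
move=> fd xr; wlog x00 : f df x0 x fd xr / x0 <= x => [wh|].
  have [|/ltW xx0] := leP x0 x; first exact: wh.
  have fd' (y : R) : is_derive y (1 : R) (f \o -%R) (- df (- y)).
    rewrite -mulrN1; apply: is_derive1_comp.
  have xr' : `|- x - - x0| < r by rewrite -opprD normrN.
  have [|c cr fc] := wh _ _ (- x0) (- x) fd' xr'; first by rewrite lerN2.
  exists (- c); first by rewrite -normrN opprD opprK.
  by move: fc; rewrite /= !opprK => ->; ring.
have cf : {within `[x0, x], continuous f}.
  apply: continuous_subspaceT => y.
  exact/differentiable_continuous/derivable1_diffP.
have [c] := MVT_segment x00 (fun y _ => fd y) cf.
rewrite in_itv /= => /andP[c1 c2] fc; exists c => //.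
rewrite ger0_norm ?subr_ge0//; apply: le_lt_trans xr.
by rewrite ger0_norm ?subr_ge0// lerD2r.
Qed.

(** The increment is split along an L-shaped path, vertical then horizontal, and the mean value
    theorem is applied to each leg. *)
Lemma C1_differentiable u ux uy p :
  (forall q, is_derive q xdir u (ux q)) -> (forall q, is_derive q ydir u (uy q)) ->
  continuous ux -> continuous uy ->
  is_diff p u (fun h => h.1 * ux p + h.2 * uy p).
Proof.
move=> dx dy cx cy.
pose L := (fun h : R * R => h.1 * ux p + h.2 * uy p).
have linL : linear L by move=> a h k; rewrite /L /= /GRing.scale /=; ring.
pose Lm := GRing.isLinear.Build _ _ _ _ _ linL.
pose Ll : {linear (R * R)%type -> R^o} := HB.pack L Lm.
have cL : continuous L.
  move=> h; apply: cvgD; apply: cvgM; try exact: cvg_cst.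
    exact: cvg_fst.
  exact: cvg_snd.
have key : u \o shift p = cst (u p) + Ll +o_ (0 : R * R) id.
  apply/eqaddoP => e e0.
  have e20 : 0 < e / 2 by rewrite divr_gt0.
  have [r r0 Hr] : exists2 r : R, 0 < r & forall q, `|q - p| < r ->
      `|ux q - ux p| <= e / 2 /\ `|uy q - uy p| <= e / 2.
    have /cvgrPdist_le/(_ _ e20) := cx p.
    have /cvgrPdist_le/(_ _ e20) := cy p.
    move=> Hy Hx; have : \forall q \near p, `|ux q - ux p| <= e / 2 /\ `|uy q - uy p| <= e / 2.
      by near=> q; split; rewrite distrC; near: q.
    case/nbhs_ballP => r /= r0 H; exists r => // q qp; apply: H.
    by rewrite -ball_normE /= distrC.
  near=> h.
  have hr : `|h| < r.
    near: h; apply/nbhs_ballP; exists r => //= h.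
    by rewrite -ball_normE /= sub0r normrN.
  have [h1r h2r] : `|h.1| < r /\ `|h.2| < r.
    by move: hr; rewrite prod_normE gt_max => /andP[].
  have xd (x : R) : is_derive x (1 : R) (fun x => u (x, p.2 + h.2)) (ux (x, p.2 + h.2)).
    by have /is_derive_exE := dx (x, p.2 + h.2).
  have yd (y : R) : is_derive y (1 : R) (fun y => u (p.1, y)) (uy (p.1, y)).
    by have /is_derive_eyE := dy (p.1, y).
  have h1r' : `|p.1 + h.1 - p.1| < r by rewrite addrC addKr.
  have h2r' : `|p.2 + h.2 - p.2| < r by rewrite addrC addKr.
  have [c cr Ec] := mvt_ball xd h1r'.
  have [d dr Ed] := mvt_ball yd h2r'.
  (* The norm of the plane is the maximum norm, so the intermediate points of both legs stay in the
     ball around [p]. *)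
  have n1 : `|(c, p.2 + h.2) - p| < r.
    by rewrite prod_normE gt_max /= cr h2r'.
  have n2 : `|(p.1, d) - p| < r.
    by rewrite prod_normE gt_max /= dr subrr normr0 r0.
  have [b1 _] := Hr _ n1; have [_ b2] := Hr _ n2.
  rewrite !fctE /= /L.
  have -> : u (h + p) - (u p + (h.1 * ux p + h.2 * uy p)) =
     h.1 * (ux (c, p.2 + h.2) - ux p) + h.2 * (uy (p.1, d) - uy p).
    move: Ec Ed.
    have -> : (p.1 + h.1, p.2 + h.2) = h + p by rewrite [RHS]addrC.
    rewrite -surjective_pairing.
    have -> : p.1 + h.1 - p.1 = h.1 by ring.
    have -> : p.2 + h.2 - p.2 = h.2 by ring.
    move=> Ec Ed; rewrite (_ : u (h + p) - _ = (u (h + p) - u (p.1, p.2 + h.2)) +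
      (u (p.1, p.2 + h.2) - u p) - (h.1 * ux p + h.2 * uy p)); last by ring.
    by rewrite Ec Ed; ring.
  rewrite (le_trans (ler_normD _ _))// !normrM [e]splitr mulrDl.
  have m1 : `|h.1| <= `|h| by rewrite prod_normE le_max lexx.
  have m2 : `|h.2| <= `|h| by rewrite prod_normE le_max lexx orbT.
  by rewrite lerD// mulrC ler_pM.
have dE : 'd u p = Ll :> (_ -> _) by apply: diff_unique.
have du : differentiable u p by apply/diff_locallyP; rewrite dE; split.
by apply: DiffDef => //; rewrite dE.
Unshelve. all: end_near. Qed.

Lemma C1_chain u ux uy (x y : R -> R) (t x' y' : R) :
  (forall q, is_derive q xdir u (ux q)) -> (forall q, is_derive q ydir u (uy q)) ->
  continuous ux -> continuous uy ->
  is_derive t 1 x x' -> is_derive t 1 y y' ->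
  is_derive t 1 (fun t => u (x t, y t)) (x' * ux (x t, y t) + y' * uy (x t, y t)).
Proof.
move=> dx dy cx cy [xd xE] [yd yE].
have [ud uE] := C1_differentiable (x t, y t) dx dy cx cy.
have xyd : differentiable (fun t => (x t, y t)) t.
  by apply: differentiable_pair; apply/derivable1_diffP.
have cd : differentiable (u \o (fun t => (x t, y t))) t by apply: differentiable_comp.
constructor; first exact/derivable1_diffP.
rewrite (deriveE _ cd) diff_comp//= uE diff_pair ?derivable1_diffP//=.
2,3: exact/derivable1_diffP.
by rewrite -!deriveE ?xE ?yE//; apply/derivable1_diffP.
Qed.

End PlaneCalculus.

(** * Integrals over a period *)

Lemma continuous_pair (T U V : topologicalType) (f : T -> U) (g : T -> V) :
  continuous f -> continuous g -> continuous (fun x => (f x, g x)).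
Proof. by move=> cf cg x; apply: (cvg_pair (cf x) (cg x)). Qed.

Section PeriodIntegral.
Variable R : realType.
Notation mu := (@lebesgue_measure R).
Implicit Types (f g : R -> R) (a : R).

Definition pint (f : R -> R) : R := \int[mu]_(t in `[0, 2 * pi]) f t.

Lemma pi2_gt0 : 0 < 2 * pi :> R.
Proof. by rewrite mulr_gt0 ?pi_gt0. Qed.

Lemma pint_integrable (f : R -> R) : continuous f ->
  mu.-integrable `[0, 2 * pi] (EFin \o f).
Proof.
move=> cf; apply: continuous_compact_integrable; first exact: segment_compact.
exact: continuous_subspaceT.
Qed.

Lemma pintD f g : continuous f -> continuous g ->
  pint (fun t => f t + g t) = pint f + pint g.
Proof. by move=> cf cg; apply: RintegralD => //; apply: pint_integrable. Qed.

Lemma pintB f g : continuous f -> continuous g ->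
  pint (fun t => f t - g t) = pint f - pint g.
Proof. by move=> cf cg; apply: RintegralB => //; apply: pint_integrable. Qed.

Lemma pintZ a f : continuous f -> pint (fun t => a * f t) = a * pint f.
Proof. by move=> cf; apply: RintegralZl => //; apply: pint_integrable. Qed.

Lemma pint_cst a : pint (fun=> a) = 2 * pi * a.
Proof.
rewrite /pint Rintegral_cst//= lebesgue_measure_itv/= lte_fin pi2_gt0.
by rewrite -EFinB subr0 /= mulrC.
Qed.

Lemma le_pint f g : continuous f -> continuous g -> (forall t, f t <= g t) ->
  pint f <= pint g.
Proof.
move=> cf cg fg; apply: le_Rintegral => //; exact: pint_integrable.
Qed.

Lemma pint_periodic (F f : R -> R) : (forall t : R, is_derive t (1 : R) F (f t)) ->
  continuous f -> F (2 * pi) = F 0 -> pint f = 0.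
Proof.
move=> Ff cf Fp.
have cF : continuous F.
  by move=> t; apply/differentiable_continuous/derivable1_diffP.
rewrite /pint /Rintegral (@continuous_FTC2 _ f F) ?pi2_gt0//.
- by rewrite Fp subee.
- exact: continuous_subspaceT.
- split; first by move=> t _; apply: ex_derive.
  + exact/cvg_at_right_filter/cF.
  + exact/cvg_at_left_filter/cF.
- by move=> t _; rewrite derive1E; apply: derive_val.
Qed.

(** Compactness of the period makes the continuity in [s] uniform in [t] (the tube lemma, in the
    form of [near_covering]). *)
Lemma pint_continuous (T : topologicalType) (f : T -> R -> R) :
  continuous (fun q : T * R => f q.1 q.2) -> continuous (fun s => pint (f s)).
Proof.
move=> cf s; apply/cvgrPdist_le => e e0.
have cfs s' : continuous (f s').
  move=> t; apply: (@continuous_comp _ _ _ (fun t : R => (s', t)) (fun q : T * R => f q.1 q.2)).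
    by apply: continuous_pair => {}t; [exact: cvg_cst|exact: cvg_id].
  exact: cf.
have e'0 : 0 < e / (2 * pi) by rewrite divr_gt0// pi2_gt0.
have nc : near_covering `[0 : R, 2 * pi].
  exact/compact_near_coveringP/segment_compact.
have H : \forall s' \near s, forall t, `[0, 2 * pi]%classic t ->
    `|f s t - f s' t| <= e / (2 * pi).
  apply: (nc _ (nbhs s) (fun s' t => `|f s t - f s' t| <= e / (2 * pi))) => t _.
  have e2 : 0 < e / (2 * pi) / 2 by rewrite divr_gt0.
  have /cvgrPdist_le/(_ _ e2) [[A B] /= [Bt As] AB] := cf (s, t).
  have /cvgrPdist_le/(_ _ e2) C := cfs s t.
  exists (B `&` [set x | `|f s t - f s x| <= e / (2 * pi) / 2], A).
    split => //=; first by apply: filterI.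
  move=> [t' s'] /= [[Bt' Ct'] As'].
  have /= H1 := AB (s', t') (conj As' Bt').
  rewrite (_ : _ - _ = (f s t - f s' t') - (f s t - f s t')); last by ring.
  by rewrite (le_trans (ler_normB _ _))// [leRHS]splitr lerD.
near=> s'.
rewrite -pintB// /pint.
apply: (le_trans (le_normr_Rintegral _ _)) => //.
  by apply: pint_integrable => t; apply: cvgB; apply: cfs.
apply: (@le_trans _ _ (pint (fun=> e / (2 * pi)))).
  apply: le_Rintegral => //.
  - apply: pint_integrable => t; apply: (@continuous_comp _ _ _ (fun t => f s t - f s' t) Num.norm).
      by apply: cvgB; apply: cfs.
    exact: norm_continuous.
  - by apply: pint_integrable => t; apply: cvg_cst.
  - by near: s'.
by rewrite pint_cst mulrCA divff ?mulr1// gt_eqF// pi2_gt0.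
Unshelve. all: end_near. Qed.

Lemma pint_derive (f f' : R -> R -> R) :
  (forall s t : R, is_derive s (1 : R) (fun s => f s t) (f' s t)) ->
  (forall s, continuous (f s)) ->
  continuous (fun q : R * R => f' q.1 q.2) ->
  forall s : R, is_derive s (1 : R) (fun s => pint (f s)) (pint (f' s)).
Proof.
move=> ff' cf cf' s.
(* The dominating function is the constant [M], a bound of [f'] on a compact rectangle around the
   period. *)
have [M HM] : exists M : R, forall x t : R, x \in `[s - 1, s + 1] ->
    t \in `[0, 2 * pi] -> `|f' x t| <= M.
  have K : compact (`[s - 1, s + 1]%classic `*` `[0 : R, 2 * pi]%classic) by apply: compact_setX;
    apply: segment_compact.
  have := @compact_bounded R R^o _ (continuous_compact (continuous_subspaceT cf') K).
  case=> M [_ HM]; exists (M + 1) => x t xs t0.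
  by apply: (HM (M + 1)); [rewrite ltrDl|exists (x, t) => //; split].
have M0 : 0 <= M.
  have sI : s \in `[s - 1, s + 1] by rewrite in_itv /=; apply/andP; split; lra.
  have o0 : (0 : R) \in `[0, 2 * pi] by rewrite in_itv /= lexx ltW// pi2_gt0.
  exact: le_trans (HM s 0 sI o0).
have sI : `]s - 1, s + 1[%classic s.
  by rewrite /= in_itv /= ltrBlDr ltrDl ltr01.
have p1E x y : partial1of2 f x y = f' x y.
  by rewrite partial1of2E; apply: derive_val.
have M1 (x y : R) : `]s - 1, s + 1[%classic x -> `[0, 2 * pi]%classic y ->
    `|partial1of2 f x y| <= cst M y.
  by move=> xs y0; rewrite p1E; apply: HM => //; apply: subset_itv_oo_cc.
have if_ (x : R) : `]s - 1, s + 1[%classic x -> mu.-integrable `[0, 2 * pi] (EFin \o f x).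
  by move=> _; exact: pint_integrable.
have df (x y : R) : `]s - 1, s + 1[%classic x -> `[0, 2 * pi]%classic y -> derivable (f^~ y) x 1.
  by move=> _ _; apply: ex_derive.
have iM : mu.-integrable `[0, 2 * pi] (EFin \o (cst M : R -> R)).
  by apply: pint_integrable => t; apply: cvg_cst.
have mI : measurable `[0 : R, 2 * pi] by [].
constructor.
  exact: (@derivable_under_integral R _ _ mu f _ mI _ _ _ sI if_ df (cst M) (fun=> M0) iM M1).
rewrite -derive1E (@differentiation_under_integral R _ _ mu f _ mI _ _ _ sI if_ df (cst M)
  (fun=> M0) iM M1).
by apply: eq_Rintegral => t _; rewrite p1E.
Qed.

(** Cauchy-Schwarz against the constant 1, read off the nonnegative integral of (f - m)^2, where m
    is the mean of f. *)
Lemma sqr_pint_le f : continuous f -> pint f ^+ 2 <= 2 * pi * pint (fun t => f t ^+ 2).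
Proof.
move=> cf; pose m := pint f / (2 * pi).
have cf2 : continuous (fun t => f t ^+ 2).
  by move=> t; under eq_fun do rewrite expr2; apply: cvgM; apply: cf.
have cmf : continuous (fun t => 2 * m * f t).
  by move=> t; apply: cvgM; [exact: cvg_cst|apply: cf].
have p0 := pi2_gt0.
have : pint (fun=> 0) <= pint (fun t => (f t ^+ 2 - 2 * m * f t) + m ^+ 2).
  apply: le_pint.
  - by move=> t; apply: cvg_cst.
  - by move=> t; apply: cvgD; [apply: cvgB; [apply: cf2|apply: cmf]|apply: cvg_cst].
  - by move=> t; rewrite (_ : _ + _ = (f t - m) ^+ 2) ?sqr_ge0//; ring.
rewrite pint_cst mulr0 pintD; last 2 first.
- by move=> t; apply: cvgB; [apply: cf2|apply: cmf].
- by move=> t; apply: cvg_cst.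
rewrite pintB// pintZ// pint_cst.
rewrite -(ler_pM2l p0) mulr0.
have fE : pint f = m * (2 * pi) by rewrite /m mulfVK// gt_eqF.
rewrite fE; set P := 2 * pi; set J := pint _; nra.
Qed.

End PeriodIntegral.

(** * Complex-valued functions on the plane and the operators del and dbar *)

Section ComplexPartials.
Variable R : realType.
Notation C := R[i].
Notation P := (R * R)%type.
Implicit Types (F G : P -> C) (u v : P -> R) (p : P).

Definition iC : C := 0 +i* 1.

Lemma iC2 : iC * iC = -1.
Proof. by apply/eqP; rewrite eq_complex /= ; apply/andP; split; apply/eqP; ring. Qed.

Lemma complexP (z w : C) : complex.Re z = complex.Re w -> complex.Im z = complex.Im w -> z = w.
Proof. by case: z w => a b [c d] /= -> ->. Qed.

Lemma ReD (z w : C) : complex.Re (z + w) = complex.Re z + complex.Re w.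
Proof. by case: z w => ? ? []. Qed.
Lemma ImD (z w : C) : complex.Im (z + w) = complex.Im z + complex.Im w.
Proof. by case: z w => ? ? []. Qed.
Lemma ReM (z w : C) : complex.Re (z * w) =
  complex.Re z * complex.Re w - complex.Im z * complex.Im w.
Proof. by case: z w => ? ? []. Qed.
Lemma ImM (z w : C) : complex.Im (z * w) =
  complex.Re z * complex.Im w + complex.Im z * complex.Re w.
Proof. by case: z w => ? ? []. Qed.
Lemma ReN (z : C) : complex.Re (- z) = - complex.Re z.
Proof. by case: z. Qed.
Lemma ImN (z : C) : complex.Im (- z) = - complex.Im z.
Proof. by case: z. Qed.
Definition ReIm := (ReD, ImD, ReM, ImM, ReN, ImN).

Definition reF F p : R := complex.Re (F p).
Definition imF F p : R := complex.Im (F p).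

(** Continuity is imposed on real and imaginary parts, so that only real-valued calculus is used. *)
Definition ccont (T : topologicalType) (F : T -> C) : Prop :=
  continuous (fun t => complex.Re (F t)) /\ continuous (fun t => complex.Im (F t)).

Lemma ccont_cst (T : topologicalType) (c : C) : ccont (fun _ : T => c).
Proof. by split=> t; apply: cvg_cst. Qed.

Lemma ccontD (T : topologicalType) (F G : T -> C) : ccont F -> ccont G ->
  ccont (fun t => F t + G t).
Proof.
move=> [a b] [c d]; split.
  under eq_fun do rewrite ReD.
  by move=> t; apply: cvgD; [apply: a|apply: c].
under eq_fun do rewrite ImD.
by move=> t; apply: cvgD; [apply: b|apply: d].
Qed.

Lemma ccontM (T : topologicalType) (F G : T -> C) : ccont F -> ccont G ->
  ccont (fun t => F t * G t).
Proof.
move=> [a b] [c d]; split.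
  under eq_fun do rewrite ReM.
  by move=> t; apply: cvgB; apply: cvgM; [apply: a|apply: c|apply: b|apply: d].
under eq_fun do rewrite ImM.
by move=> t; apply: cvgD; apply: cvgM; [apply: a|apply: d|apply: b|apply: c].
Qed.

Lemma ccont_comp (T U : topologicalType) (F : U -> C) (g : T -> U) :
  continuous g -> ccont F -> ccont (fun t => F (g t)).
Proof.
move=> cg [a b]; split=> t.
  by apply: (@continuous_comp _ _ _ g (fun x => complex.Re (F x))); [exact: cg|exact: a].
by apply: (@continuous_comp _ _ _ g (fun x => complex.Im (F x))); [exact: cg|exact: b].
Qed.

(** The derivatives are given as data, so that the rules of calculus compose; [partials_uniq] then
    identifies them with [CX F] and [CY F]. *)
Definition partials F (Fx Fy : P -> C) : Prop := forall p,
  [/\ is_derive p (xdir R) (reF F) (reF Fx p), is_derive p (xdir R) (imF F) (imF Fx p),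
      is_derive p (ydir R) (reF F) (reF Fy p) & is_derive p (ydir R) (imF F) (imF Fy p)].

Definition CX F p : C := 'D_(xdir R) (reF F) p +i* 'D_(xdir R) (imF F) p.
Definition CY F p : C := 'D_(ydir R) (reF F) p +i* 'D_(ydir R) (imF F) p.

Definition cderiv F := partials F (CX F) (CY F).

Lemma partials_uniq F Fx Fy : partials F Fx Fy -> CX F = Fx /\ CY F = Fy.
Proof.
move=> H; split; apply/funext => p; have [a b c d] := H p; apply: complexP => /=;
  exact: derive_val.
Qed.

Lemma partials_cderiv F Fx Fy : partials F Fx Fy -> cderiv F.
Proof. by move=> H; have [a b] := partials_uniq H; rewrite /cderiv a b. Qed.

Lemma partials_cst (c : C) : partials (fun=> c) (fun=> 0) (fun=> 0).
Proof. by move=> p; split; exact: is_derive_cst. Qed.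


Lemma reFD F G : reF (fun p => F p + G p) = fun p => reF F p + reF G p.
Proof. by apply/funext => p; rewrite /reF ReD. Qed.
Lemma imFD F G : imF (fun p => F p + G p) = fun p => imF F p + imF G p.
Proof. by apply/funext => p; rewrite /imF ImD. Qed.
Lemma reFM F G : reF (fun p => F p * G p) = fun p => reF F p * reF G p - imF F p * imF G p.
Proof. by apply/funext => p; rewrite /reF ReM. Qed.
Lemma imFM F G : imF (fun p => F p * G p) = fun p => reF F p * imF G p + imF F p * reF G p.
Proof. by apply/funext => p; rewrite /imF ImM. Qed.

Lemma partialsD F G Fx Fy Gx Gy : partials F Fx Fy -> partials G Gx Gy ->
  partials (fun p => F p + G p) (fun p => Fx p + Gx p) (fun p => Fy p + Gy p).
Proof.
move=> HF HG p; have [a1 a2 a3 a4] := HF p; have [b1 b2 b3 b4] := HG p.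
by rewrite !(reFD, imFD); split; apply: is_deriveD.
Qed.

Lemma partialsM F G Fx Fy Gx Gy : partials F Fx Fy -> partials G Gx Gy ->
  partials (fun p => F p * G p) (fun p => Fx p * G p + F p * Gx p)
    (fun p => Fy p * G p + F p * Gy p).
Proof.
move=> HF HG p; have [a1 a2 a3 a4] := HF p; have [b1 b2 b3 b4] := HG p.
rewrite !(reFD, imFD, reFM, imFM); split.
- apply: is_derive_eq (is_deriveB (is_deriveM a1 b1) (is_deriveM a2 b2)) _.
  by rewrite /GRing.scale /=; ring.
- apply: is_derive_eq (is_deriveD (is_deriveM a1 b2) (is_deriveM a2 b1)) _.
  by rewrite /GRing.scale /=; ring.
- apply: is_derive_eq (is_deriveB (is_deriveM a3 b3) (is_deriveM a4 b4)) _.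
  by rewrite /GRing.scale /=; ring.
- apply: is_derive_eq (is_deriveD (is_deriveM a3 b4) (is_deriveM a4 b3)) _.
  by rewrite /GRing.scale /=; ring.
Qed.

Lemma partialsZ (c : C) F Fx Fy : partials F Fx Fy ->
  partials (fun p => c * F p) (fun p => c * Fx p) (fun p => c * Fy p).
Proof.
move=> H; have := partialsM (partials_cst c) H.
by congr partials; apply/funext => p; rewrite mul0r add0r.
Qed.

Definition conjz p : C := p.1 -i* p.2.
Lemma partials_conjz : partials conjz (fun=> 1) (fun=> - iC).
Proof.
move=> p; split; rewrite /reF /imF /=; (apply/is_derive_exE || apply/is_derive_eyE) => /=.
- exact: is_derive_cst.
- by rewrite oppr0; exact: is_derive_cst.
Qed.

Lemma ccont_conjz : ccont conjz.
Proof.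
split; first by move=> p; apply: cvg_fst.
by move=> p; apply: cvgN; apply: cvg_snd.
Qed.

(** The recursion of [class_C] for real-valued functions; [class_C_coord] matches the two coordinate
    by coordinate. *)
Fixpoint Cr (m : nat) u : Prop :=
  continuous u /\
  if m is m'.+1 then
    [/\ forall p, derivable u p (xdir R), forall p, derivable u p (ydir R),
        Cr m' (fun p => 'D_(xdir R) u p) & Cr m' (fun p => 'D_(ydir R) u p)]
  else True.

Lemma Cr_cont m u : Cr m u -> continuous u.
Proof. by case: m => [|m] []. Qed.

Lemma CrS m u : Cr m.+1 u -> Cr m u.
Proof.
elim: m u => [|m IH] u [cu d]; first exact: conj cu I.
by case: d => a b c d; exact: conj cu (And4 a b (IH _ c) (IH _ d)).
Qed.

Lemma CrD m u v : Cr m u -> Cr m v -> Cr m (fun p => u p + v p).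
Proof.
have cD u' v' : continuous u' -> continuous v' -> continuous (fun p : P => u' p + v' p : R).
  by move=> a b p; apply: cvgD; [apply: a|apply: b].
elim: m u v => [|m IH] u v [cu du] [cv dv]; first exact: conj (cD _ _ cu cv) I.
case: du dv => a b c d [a' b' c' d']; split; first exact: cD.
have Ex : (fun p => 'D_(xdir R) (fun p => u p + v p) p) =
    (fun p => 'D_(xdir R) u p + 'D_(xdir R) v p).
  by apply/funext => p; apply: deriveD.
have Ey : (fun p => 'D_(ydir R) (fun p => u p + v p) p) =
    (fun p => 'D_(ydir R) u p + 'D_(ydir R) v p).
  by apply/funext => p; apply: deriveD.
split; rewrite ?Ex ?Ey; [move=> p; exact: derivableD|move=> p; exact: derivableD
  |exact: IH|exact: IH].
Qed.

Lemma CrZ m (k : R) u : Cr m u -> Cr m (fun p => k * u p).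
Proof.
have cD u' : continuous u' -> continuous (fun p : P => k * u' p : R).
  by move=> a p; apply: cvgM; [exact: cvg_cst|apply: a].
elim: m u => [|m IH] u [cu du]; first exact: conj (cD _ cu) I.
case: du => a b c d; split; first exact: cD.
have Ex : (fun p => 'D_(xdir R) (fun p => k * u p) p) = (fun p => k * 'D_(xdir R) u p).
  by apply/funext => p; apply: (@deriveZ _ _ _ u k).
have Ey : (fun p => 'D_(ydir R) (fun p => k * u p) p) = (fun p => k * 'D_(ydir R) u p).
  by apply/funext => p; apply: (@deriveZ _ _ _ u k).
split; rewrite ?Ex ?Ey; [move=> p; exact: (@derivableZ _ _ _ u k)
  |move=> p; exact: (@derivableZ _ _ _ u k)|exact: IH|exact: IH].
Qed.

Definition cC m F : Prop := Cr m (reF F) /\ Cr m (imF F).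

Lemma cC_cont m F : cC m F -> ccont F.
Proof. by move=> [a b]; split; apply: Cr_cont; eassumption. Qed.

Lemma cCS m F : cC m.+1 F -> cC m F.
Proof. by move=> [a b]; split; apply: CrS. Qed.

Lemma cCD m F G : cC m F -> cC m G -> cC m (fun p => F p + G p).
Proof. by move=> [a b] [c d]; rewrite /cC reFD imFD; split; apply: CrD. Qed.

Lemma cCZ m (c : C) F : cC m F -> cC m (fun p => c * F p).
Proof.
move=> [a b]; rewrite /cC reFM imFM; split; last first.
  by apply: CrD; [exact: (CrZ (complex.Re c) b)|exact: (CrZ (complex.Im c) a)].
rewrite (_ : (fun p => _) = fun p => complex.Re c * reF F p + (- complex.Im c) * imF F p).
  by apply: CrD; [exact: (CrZ (complex.Re c) a)|exact: (CrZ (- complex.Im c) b)].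
by apply/funext => p; rewrite /reF /imF; ring.
Qed.

Lemma cC_cderiv m F : cC m.+1 F -> cderiv F.
Proof.
move=> [[_ [a1 a2 _ _]] [_ [b1 b2 _ _]]] p; split.
- exact: DeriveDef (a1 p) erefl.
- exact: DeriveDef (b1 p) erefl.
- exact: DeriveDef (a2 p) erefl.
- exact: DeriveDef (b2 p) erefl.
Qed.

Lemma cC_CX m F : cC m.+1 F -> cC m (CX F).
Proof. by move=> [[_ [_ _ a _]] [_ [_ _ b _]]]; exact: conj a b. Qed.

Lemma cC_CY m F : cC m.+1 F -> cC m (CY F).
Proof. by move=> [[_ [_ _ _ a]] [_ [_ _ _ b]]]; exact: conj a b. Qed.

Lemma cC_recS m F : ccont F -> cderiv F -> cC m (CX F) -> cC m (CY F) -> cC m.+1 F.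
Proof.
move=> [a b] d [x1 x2] [y1 y2]; split.
  apply: conj a (And4 _ _ x1 y1) => p; have [? ? ? ?] := d p; exact: ex_derive.
apply: conj b (And4 _ _ x2 y2) => p; have [? ? ? ?] := d p; exact: ex_derive.
Qed.

(** A bootstrap principle: a class of differentiable functions that is stable under both partial
    derivatives consists of smooth functions. *)
Lemma cC_class (S : (P -> C) -> Prop) :
  (forall F, S F -> [/\ ccont F, cderiv F, S (CX F) & S (CY F)]) ->
  forall m F, S F -> cC m F.
Proof.
move=> HS; elim=> [|m IH] F /HS[cF dF SX SY]; first by case: cF => a b;
  exact: conj (conj a I) (conj b I).
exact: cC_recS cF dF (IH _ SX) (IH _ SY).
Qed.

(** * Wirtinger operators *)

Definition del F p : C := 2^-1 * (CX F p - iC * CY F p).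
Definition dbar F p : C := 2^-1 * (CX F p + iC * CY F p).

Lemma CXE F p : CX F p = del F p + dbar F p.
Proof. by rewrite /del /dbar; field. Qed.

Lemma CYE F p : CY F p = iC * (del F p - dbar F p).
Proof.
rewrite /del /dbar (_ : iC * _ = - (iC * iC) * CY F p); first by rewrite iC2; ring.
by field.
Qed.

Lemma partials_del F Fx Fy : partials F Fx Fy ->
  del F = fun p => 2^-1 * (Fx p - iC * Fy p).
Proof. by move=> /partials_uniq[a b]; apply/funext => p; rewrite /del a b. Qed.

Lemma partials_dbar F Fx Fy : partials F Fx Fy ->
  dbar F = fun p => 2^-1 * (Fx p + iC * Fy p).
Proof. by move=> /partials_uniq[a b]; apply/funext => p; rewrite /dbar a b. Qed.

Lemma delD F G : cderiv F -> cderiv G ->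
  del (fun p => F p + G p) = fun p => del F p + del G p.
Proof. by move=> a b; rewrite (partials_del (partialsD a b)); apply/funext => p; rewrite /del;
  ring. Qed.

Lemma dbarD F G : cderiv F -> cderiv G ->
  dbar (fun p => F p + G p) = fun p => dbar F p + dbar G p.
Proof. by move=> a b; rewrite (partials_dbar (partialsD a b)); apply/funext => p; rewrite /dbar;
  ring. Qed.

Lemma delM F G : cderiv F -> cderiv G ->
  del (fun p => F p * G p) = fun p => del F p * G p + F p * del G p.
Proof. by move=> a b; rewrite (partials_del (partialsM a b)); apply/funext => p; rewrite /del;
  ring. Qed.

Lemma dbarM F G : cderiv F -> cderiv G ->
  dbar (fun p => F p * G p) = fun p => dbar F p * G p + F p * dbar G p.
Proof. by move=> a b; rewrite (partials_dbar (partialsM a b)); apply/funext => p; rewrite /dbar;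
  ring. Qed.

Lemma delZ c F : cderiv F -> del (fun p => c * F p) = fun p => c * del F p.
Proof. by move=> a; rewrite (partials_del (partialsZ c a)); apply/funext => p; rewrite /del;
  ring. Qed.

Lemma dbarZ c F : cderiv F -> dbar (fun p => c * F p) = fun p => c * dbar F p.
Proof. by move=> a; rewrite (partials_dbar (partialsZ c a)); apply/funext => p; rewrite /dbar;
  ring. Qed.

Lemma del_conjz : del conjz = fun=> 0.
Proof.
by rewrite (partials_del partials_conjz); apply/funext => p; rewrite mulrN iC2; ring.
Qed.

Lemma dbar_conjz : dbar conjz = fun=> 1.
Proof.
by rewrite (partials_dbar partials_conjz); apply/funext => p; rewrite mulrN iC2; field.
Qed.

Lemma cC_dbar m F : cC m.+1 F -> cC m (dbar F).
Proof.
move=> H; apply: cCZ; apply: cCD; first exact: cC_CX.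
by apply: cCZ; exact: cC_CY.
Qed.

End ComplexPartials.

(** * Circle means of entire functions *)

Section CircleMeans.
Variable R : realType.
Notation C := R[i].
Notation P := (R * R)%type.
Implicit Types (F G h : P -> C) (a p : P) (r s t : R) (c : C).

Definition cint (F : R -> C) : C :=
  pint (fun t => complex.Re (F t)) +i* pint (fun t => complex.Im (F t)).

Lemma is_derive_affine (b k x : R) : is_derive x (1 : R) (fun x => b + k * x) k.
Proof.
have H := is_deriveD (is_derive_cst b x (1 : R)) (is_deriveZ k (is_derive_id x (1 : R))).
by apply: is_derive_eq H _; rewrite add0r /GRing.scale /= mulr1.
Qed.

Lemma ReR r : complex.Re r%:C = r. Proof. by []. Qed.
Lemma ImR r : complex.Im r%:C = 0. Proof. by []. Qed.

Lemma cintD (F G : R -> C) : ccont F -> ccont G ->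
  cint (fun t => F t + G t) = cint F + cint G.
Proof.
move=> [a b] [c d]; apply: complexP; rewrite ReIm /= -pintD//; congr pint;
  by apply/funext => t; rewrite ReIm.
Qed.

Lemma cintZ c (F : R -> C) : ccont F -> cint (fun t => c * F t) = c * cint F.
Proof.
move=> [a b].
have cZ k (f : R -> R) : continuous f -> continuous (fun t => k * f t).
  by move=> cf t; apply: cvgM; [exact: cvg_cst|apply: cf].
apply: complexP; rewrite ReIm /= -!pintZ//.
  rewrite -pintB; [|exact: cZ|exact: cZ].
  by congr pint; apply/funext => t; rewrite ReIm.
rewrite -pintD; [|exact: cZ|exact: cZ].
by congr pint; apply/funext => t; rewrite ReIm.
Qed.

Lemma cint_cst c : cint (fun=> c) = (2 * pi)%:C * c.
Proof. by rewrite /cint !pint_cst; apply: complexP; rewrite ReIm /=; ring. Qed.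

Lemma ccont_cint (T : topologicalType) (F : T -> R -> C) :
  ccont (fun q : T * R => F q.1 q.2) -> ccont (fun x => cint (F x)).
Proof.
move=> [a b]; split.
  exact: (@pint_continuous R T (fun x t => complex.Re (F x t))).
exact: (@pint_continuous R T (fun x t => complex.Im (F x t))).
Qed.

Definition is_cderive (F : R -> C) t c : Prop :=
  is_derive t (1 : R) (fun t => complex.Re (F t)) (complex.Re c) /\
  is_derive t (1 : R) (fun t => complex.Im (F t)) (complex.Im c).

Lemma is_cderiveM (F G : R -> C) t c d : is_cderive F t c -> is_cderive G t d ->
  is_cderive (fun t => F t * G t) t (c * G t + F t * d).
Proof.
move=> [a1 a2] [b1 b2]; split.
  under eq_fun do rewrite ReM.
  apply: is_derive_eq (is_deriveB (is_deriveM a1 b1) (is_deriveM a2 b2)) _.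
  by rewrite !ReIm /GRing.scale /=; ring.
under eq_fun do rewrite ImM.
apply: is_derive_eq (is_deriveD (is_deriveM a1 b2) (is_deriveM a2 b1)) _.
by rewrite !ReIm /GRing.scale /=; ring.
Qed.

Lemma is_cderive_chain F (x y : R -> R) t (x' y' : R) :
  cC 1 F -> is_derive t (1 : R) x x' -> is_derive t (1 : R) y y' ->
  is_cderive (fun t => F (x t, y t)) t
    (x'%:C * CX F (x t, y t) + y'%:C * CY F (x t, y t)).
Proof.
move=> cF dx dy; have dF := cC_cderiv cF.
have [cx1 cx2] := cC_cont (cC_CX cF); have [cy1 cy2] := cC_cont (cC_CY cF).
have reE (c d : C) : complex.Re (x'%:C * c + y'%:C * d) = x' * complex.Re c + y' * complex.Re d.
  by rewrite ReD !ReM !ReR !ImR !mul0r !subr0.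
have imE (c d : C) : complex.Im (x'%:C * c + y'%:C * d) = x' * complex.Im c + y' * complex.Im d.
  by rewrite ImD !ImM !ReR !ImR !mul0r !addr0.
have d1 q : is_derive q (xdir R) (reF F) (reF (CX F) q) by have [] := dF q.
have d2 q : is_derive q (xdir R) (imF F) (imF (CX F) q) by have [] := dF q.
have d3 q : is_derive q (ydir R) (reF F) (reF (CY F) q) by have [] := dF q.
have d4 q : is_derive q (ydir R) (imF F) (imF (CY F) q) by have [] := dF q.
split.
  apply: (is_derive_eq (C1_chain d1 d3 cx1 cy1 dx dy)).
  exact: (esym (reE _ _)).
apply: (is_derive_eq (C1_chain d2 d4 cx2 cy2 dx dy)).
exact: (esym (imE _ _)).
Qed.

Lemma cint_periodic (F F' : R -> C) : (forall t, is_cderive F t (F' t)) ->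
  ccont F' -> F (2 * pi) = F 0 -> cint F' = 0.
Proof.
move=> d [a b] e; apply: complexP => /=.
  apply: (@pint_periodic _ (fun t => complex.Re (F t))) => //; last by rewrite e.
  by move=> t; have [] := d t.
apply: (@pint_periodic _ (fun t => complex.Im (F t))) => //; last by rewrite e.
by move=> t; have [] := d t.
Qed.

Lemma cint_derive (F F' : R -> R -> C) :
  (forall s t, is_cderive (fun s => F s t) s (F' s t)) ->
  (forall s, ccont (F s)) -> ccont (fun q : R * R => F' q.1 q.2) ->
  forall s, is_cderive (fun s => cint (F s)) s (cint (F' s)).
Proof.
move=> d cF [a b] s; split.
  apply: (@pint_derive _ (fun s t => complex.Re (F s t)) (fun s t => complex.Re (F' s t))) => //.
    by move=> s' t'; have [] := d s' t'.
  by move=> s'; have [] := cF s'.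
apply: (@pint_derive _ (fun s t => complex.Im (F s t)) (fun s t => complex.Im (F' s t))) => //.
  by move=> s' t'; have [] := d s' t'.
by move=> s'; have [] := cF s'.
Qed.

Lemma cint_partials (K Kx Ky : P -> R -> C) :
  (forall t, partials (fun p => K p t) (fun p => Kx p t) (fun p => Ky p t)) ->
  ccont (fun q : P * R => K q.1 q.2) ->
  ccont (fun q : P * R => Kx q.1 q.2) -> ccont (fun q : P * R => Ky q.1 q.2) ->
  partials (fun p => cint (K p)) (fun p => cint (Kx p)) (fun p => cint (Ky p)).
Proof.
move=> d cK cX cY p.
have sec1 : continuous (fun q : R * R => ((q.1, p.2), q.2) : P * R).
  apply: continuous_pair => [|q]; last exact: cvg_snd.
  by apply: continuous_pair => q; [exact: cvg_fst|exact: cvg_cst].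
have sec2 : continuous (fun q : R * R => ((p.1, q.1), q.2) : P * R).
  apply: continuous_pair => [|q]; last exact: cvg_snd.
  by apply: continuous_pair => q; [exact: cvg_cst|exact: cvg_fst].
have sec3 p' : continuous (fun t : R => (p', t) : P * R).
  by apply: continuous_pair => q; [exact: cvg_cst|exact: cvg_id].
have dx s : is_cderive (fun s => cint (K (s, p.2))) s (cint (Kx (s, p.2))).
  apply: (@cint_derive (fun s => K (s, p.2)) (fun s => Kx (s, p.2))).
  - by move=> s' t'; have [/is_derive_exE ? /is_derive_exE ? _ _] := d t' (s', p.2).
  - by move=> s'; apply: (ccont_comp (sec3 (s', p.2)) cK).
  - exact: (ccont_comp sec1 cX).
have dy s : is_cderive (fun s => cint (K (p.1, s))) s (cint (Ky (p.1, s))).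
  apply: (@cint_derive (fun s => K (p.1, s)) (fun s => Ky (p.1, s))).
  - by move=> s' t'; have [_ _ /is_derive_eyE ? /is_derive_eyE ?] := d t' (p.1, s').
  - by move=> s'; apply: (ccont_comp (sec3 (p.1, s')) cK).
  - exact: (ccont_comp sec2 cY).
have [x1 x2] := dx p.1; have [y1 y2] := dy p.2; move: x1 x2 y1 y2.
rewrite -surjective_pairing => x1 x2 y1 y2.
by split; [apply/is_derive_exE|apply/is_derive_exE|apply/is_derive_eyE|apply/is_derive_eyE].
Qed.

(** * Circles and their exponentials *)

Definition circ a r t : P := (a.1 + r * cos t, a.2 + r * sin t).
Definition eit t : C := cos t +i* sin t.
Definition emit (k : nat) t : C := cos (k%:R * t) -i* sin (k%:R * t).

Lemma emit0 t : emit 0 t = 1.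
Proof. by rewrite /emit mul0r cos0 sin0 oppr0. Qed.

Lemma eit_emit k t : eit t * emit k.+1 t = emit k t.
Proof.
rewrite /emit; have -> : k%:R * t = k.+1%:R * t - t by rewrite -addn1 natrD; ring.
by rewrite cosB sinB; apply: complexP; rewrite !ReIm /=; ring.
Qed.

Lemma ccont_eit : ccont eit.
Proof. by split=> t; [exact: continuous_cos|exact: continuous_sin]. Qed.

Lemma ccont_emit k : ccont (emit k).
Proof.
have cM : continuous (fun t : R => k%:R * t).
  by move=> t; apply: cvgM; [exact: cvg_cst|exact: cvg_id].
split=> t.
  by apply: (@continuous_comp _ _ _ (fun t => k%:R * t) (@cos R));
    [exact: cM|exact: continuous_cos].
apply: cvgN.
by apply: (@continuous_comp _ _ _ (fun t => k%:R * t) (@sin R)); [exact: cM|exact: continuous_sin].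
Qed.

Lemma emit_derive k t : is_cderive (emit k) t (- k%:R * iC R * emit k t).
Proof.
have dM := is_derive_affine 0 k%:R t; move: dM; under eq_fun do rewrite add0r; move=> dM.
have kC : (k%:R : C) = k%:R%:C by rewrite rmorph_nat.
split.
  have H := (is_derive1_comp (is_derive_cos (k%:R * t)) dM); apply: is_derive_eq H _.
  by rewrite kC !ReIm /=; ring.
have H := (is_deriveN (is_derive1_comp (is_derive_sin (k%:R * t)) dM)); apply: is_derive_eq H _.
by rewrite kC !ReIm /=; ring.
Qed.

Lemma emit_periodic k : emit k (2 * pi) = emit k 0.
Proof.
elim: k => [|k IH]; first by rewrite !emit0.
have E t : emit k.+1 t = emit k t * (cos t -i* sin t).
  rewrite /emit.
  have -> : k.+1%:R * t = k%:R * t + t by rewrite -addn1 natrD; ring.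
  by rewrite cosD sinD; apply: complexP; rewrite !ReIm /=; ring.
rewrite !E IH; congr (_ * _).
by rewrite mulr_natl cos2pi sin2pi cos0 sin0.
Qed.

Lemma circ_periodic a r : circ a r (2 * pi) = circ a r 0.
Proof. by rewrite /circ mulr_natl cos2pi sin2pi cos0 sin0. Qed.

Lemma circ_cont a r : continuous (circ a r).
Proof.
apply: continuous_pair => t; apply: cvgD; try exact: cvg_cst; apply: cvgM; try exact: cvg_cst.
  exact: continuous_cos.
exact: continuous_sin.
Qed.

Lemma circ_cont3 : continuous (fun q : (P * R) * R => circ q.1.1 q.1.2 q.2).
Proof.
have c1 : continuous (fun q : (P * R) * R => q.1.1).
  by move=> q; apply: (@cvg_comp _ _ _ fst fst); [exact: cvg_fst|exact: cvg_fst].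
have c2 : continuous (fun q : (P * R) * R => q.1.2).
  by move=> q; apply: (@cvg_comp _ _ _ fst snd); [exact: cvg_fst|exact: cvg_snd].
have c3 : continuous (fun q : (P * R) * R => q.2) by move=> q; exact: cvg_snd.
apply: continuous_pair => q; apply: cvgD.
- by apply: (@cvg_comp _ _ _ (fun q => q.1.1) fst); [exact: c1|exact: cvg_fst].
- apply: cvgM; first exact: c2.
  by apply: (@continuous_comp _ _ _ (fun q => q.2) (@cos R)); [exact: c3|exact: continuous_cos].
- by apply: (@cvg_comp _ _ _ (fun q => q.1.1) snd); [exact: c1|exact: cvg_snd].
- apply: cvgM; first exact: c2.
  by apply: (@continuous_comp _ _ _ (fun q => q.2) (@sin R)); [exact: c3|exact: continuous_sin].
Qed.

(** Entire functions under the weakest regularity; that the derivative is again of this kind is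
    [ent_CX]. *)
Definition ent h : Prop := cC 1 h /\ forall p, CY h p = iC R * CX h p.

(** Up to the factor 2 pi, the k-th Fourier coefficient of [F] on the circle. *)
Definition cmean (k : nat) F a r : C := cint (fun t => F (circ a r t) * emit k t).

Lemma ccont_circ F a r : ccont F -> ccont (fun t => F (circ a r t)).
Proof. by move=> cF; apply: ccont_comp cF; apply: circ_cont. Qed.

Lemma ccont_circM k F a r : ccont F -> ccont (fun t => F (circ a r t) * emit k t).
Proof. by move=> cF; apply: ccontM; [exact: ccont_circ|exact: ccont_emit]. Qed.

Lemma ccont_circ3 k F : ccont F ->
  ccont (fun q : (P * R) * R => F (circ q.1.1 q.1.2 q.2) * emit k q.2).
Proof.
move=> cF; apply: ccontM; first exact: ccont_comp circ_cont3 cF.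
by apply: ccont_comp (ccont_emit k) => q; exact: cvg_snd.
Qed.

Lemma ccont_circ_unit k F : ccont F ->
  ccont (fun q : P * R => F (circ q.1 1 q.2) * emit k q.2).
Proof.
move=> cF; have cs : continuous (fun q : P * R => ((q.1, 1), q.2) : (P * R) * R).
  apply: continuous_pair => [|q]; last exact: cvg_snd.
  by apply: continuous_pair => q; [exact: cvg_fst|exact: cvg_cst].
have [c1 c2] := ccont_circ3 k cF.
split=> q.
  exact: (@continuous_comp _ _ _ _ (fun q : (P * R) * R =>
    complex.Re (F (circ q.1.1 q.1.2 q.2) * emit k q.2)) q (cs q) (c1 _)).
exact: (@continuous_comp _ _ _ _ (fun q : (P * R) * R =>
  complex.Im (F (circ q.1.1 q.1.2 q.2) * emit k q.2)) q (cs q) (c2 _)).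
Qed.

Lemma cmean_cont k F : ccont F -> ccont (fun q : P * R => cmean k F q.1 q.2).
Proof.
move=> cF; apply: (@ccont_cint (P * R)%type (fun q t => F (circ q.1 q.2 t) * emit k t)).
exact: ccont_circ3.
Qed.

Lemma circ_derive_t h a r t : ent h ->
  is_cderive (fun t => h (circ a r t)) t (r%:C * iC R * eit t * CX h (circ a r t)).
Proof.
move=> [h1 hY].
have dc : is_derive t (1 : R) (fun t => a.1 + r * cos t) (- (r * sin t)).
  have H := (is_deriveD (is_derive_cst a.1 t _) (is_deriveZ r (is_derive_cos t)));
    apply: is_derive_eq H _.
  by rewrite /GRing.scale /=; ring.
have ds : is_derive t (1 : R) (fun t => a.2 + r * sin t) (r * cos t).
  have H := (is_deriveD (is_derive_cst a.2 t _) (is_deriveZ r (is_derive_sin t)));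
    apply: is_derive_eq H _.
  by rewrite /GRing.scale /=; ring.
have := is_cderive_chain h1 dc ds; rewrite hY.
rewrite (_ : _ + _ = r%:C * iC R * eit t * CX h (circ a r t))//.
rewrite mulrA -mulrDl; congr (_ * _).
by apply: complexP; rewrite !ReIm /=; ring.
Qed.

Lemma circ_derive_r h a r t : ent h ->
  is_cderive (fun r => h (circ a r t)) r (eit t * CX h (circ a r t)).
Proof.
move=> [h1 hY].
have dc : is_derive r (1 : R) (fun r => a.1 + r * cos t) (cos t).
  by under eq_fun do rewrite mulrC; exact: is_derive_affine.
have ds : is_derive r (1 : R) (fun r => a.2 + r * sin t) (sin t).
  by under eq_fun do rewrite mulrC; exact: is_derive_affine.
have := is_cderive_chain h1 dc ds; rewrite hY.
rewrite (_ : _ + _ = eit t * CX h (circ a r t))//.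
rewrite mulrA -mulrDl; congr (_ * _).
by apply: complexP; rewrite !ReIm /=; ring.
Qed.

(* Vanishing of the integral over a period of d/dt [h (circ a r t) e^(-i(k+1)t)]. *)
Lemma cmean_shift k h a r : ent h ->
  r%:C * cmean k (CX h) a r = k.+1%:R * cmean k.+1 h a r.
Proof.
move=> eh; have [h1 hY] := eh.
have ch := cC_cont h1; have cX := cC_cont (cC_CX h1).
have c1 := ccont_circM k a r cX; have c2 := ccont_circM k.+1 a r ch.
have : cint (fun t => (iC R * r%:C) * (CX h (circ a r t) * emit k t) +
     (- k.+1%:R * iC R) * (h (circ a r t) * emit k.+1 t)) = 0.
  apply: (@cint_periodic (fun t => h (circ a r t) * emit k.+1 t)).
  - move=> t.
    have := is_cderiveM (circ_derive_t a r t eh) (emit_derive k.+1 t).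
    by congr is_cderive; rewrite -(eit_emit k); ring.
  - by apply: ccontD; apply: ccontM => //; exact: ccont_cst.
  - by rewrite circ_periodic emit_periodic.
rewrite cintD; last 2 first.
- by apply: ccontM => //; exact: ccont_cst.
- by apply: ccontM => //; exact: ccont_cst.
rewrite !cintZ// -/(cmean _ _ _ _) -/(cmean _ _ _ _) => E.
have iN0 : iC R != 0.
  by apply/eqP => i0; have := iC2 R; rewrite i0 mul0r => /eqP; rewrite eq_sym oppr_eq0 oner_eq0.
by apply: (mulfI iN0); apply/eqP; rewrite -subr_eq0 -E; apply/eqP; ring.
Qed.

Lemma circ0 a t : circ a 0 t = a.
Proof. by rewrite /circ !mul0r !addr0 -surjective_pairing. Qed.

Lemma cmean0_center F a : cmean 0 F a 0 = (2 * pi)%:C * F a.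
Proof.
rewrite -cint_cst /cmean; congr cint; apply/funext => t.
by rewrite circ0 emit0 mulr1.
Qed.

Lemma is_cderive_cst_eq (F : R -> C) r s :
  (forall r, is_cderive F r 0) -> F r = F s.
Proof.
move=> d; apply: complexP.
  by apply: (@is_derive_0_is_cst _ (fun r => complex.Re (F r))) => x; have [] := d x.
by apply: (@is_derive_0_is_cst _ (fun r => complex.Im (F r))) => x; have [] := d x.
Qed.

(** Only [h] is differentiated under the integral, so C^1 is enough; the factor e^(it) from the
    radial derivative lowers the frequency by one. *)
Lemma cmean_derive k h a r : ent h ->
  is_cderive (fun r => cmean k.+1 h a r) r (cmean k (CX h) a r).
Proof.
move=> eh; have [h1 hY] := eh.
have ch := cC_cont h1; have cX := cC_cont (cC_CX h1).
apply: (@cint_derive (fun r t => h (circ a r t) * emit k.+1 t)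
   (fun r t => CX h (circ a r t) * emit k t)).
- move=> s t; have := is_cderiveM (circ_derive_r a s t eh)
    (conj (is_derive_cst _ s (1 : R))
      (is_derive_cst _ s (1 : R)) : is_cderive (fun=> emit k.+1 t) s 0).
  by congr is_cderive; rewrite -(eit_emit k); ring.
- by move=> s; exact: ccont_circM.
- apply: (@ccont_comp _ _ _ _ (fun q : R * R => ((a, q.1), q.2) : (P * R) * R)) (ccont_circ3 k cX).
  apply: continuous_pair => [|q]; last exact: cvg_snd.
  by apply: continuous_pair => q; [exact: cvg_cst|exact: cvg_fst].
Qed.

(** The mean value property. The angular derivative of [h] on the circle is i s times the radial one
    and integrates to zero over a period, so the mean does not vary with the radius. *)
Lemma cmean0_ent h a r : ent h -> cmean 0 h a r = (2 * pi)%:C * h a.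
Proof.
move=> eh; have [h1 hY] := eh; rewrite -cmean0_center.
have ch := cC_cont h1; have cX := cC_cont (cC_CX h1).
apply: is_cderive_cst_eq => s.
have cE (f : P -> C) : cmean 0 f a = fun r => cint (fun t => f (circ a r t)).
  by apply/funext => x; rewrite /cmean; congr cint; apply/funext => t; rewrite emit0 mulr1.
rewrite cE.
have cXe x : ccont (fun t => eit t * CX h (circ a x t)).
  by apply: ccontM; [exact: ccont_eit|exact: ccont_circ].
have -> : 0 = cint (fun t => eit t * CX h (circ a s t)).
  have : cint (fun t => (s%:C * iC R) * (eit t * CX h (circ a s t))) = 0.
    apply: (@cint_periodic (fun t => h (circ a s t))).
    - by move=> t; have := circ_derive_t a s t eh; rewrite !mulrA.
    - by apply: ccontM => //; exact: ccont_cst.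
    - by rewrite circ_periodic.
  rewrite cintZ// => /eqP; rewrite !mulf_eq0 => /orP[/orP[/eqP s0|]|/eqP ->//].
    (* At radius 0 the factor i s cannot be divided out; there the integrand is a constant multiple
       of e^(it), whose integral vanishes. *)
    have {}s0 : s = 0 by case: s0.
    rewrite (_ : (fun t => _) = fun t => CX h a * eit t); last first.
      by apply/funext => t; rewrite s0 circ0 mulrC.
    rewrite cintZ; last exact: ccont_eit.
    rewrite (_ : cint eit = 0) ?mulr0//.
    have dsin t : is_derive t (1 : R) (fun t => sin t) (cos t) by apply: is_derive_sin.
    have dcos t : is_derive t (1 : R) (fun t => - cos t) (sin t).
      by have H := is_deriveN (is_derive_cos t); apply: is_derive_eq H _; rewrite opprK.
    apply: complexP => /=.
      by apply: pint_periodic dsin _ _; [exact: continuous_cos|rewrite mulr_natl sin2pi sin0].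
    by apply: pint_periodic dcos _ _; [exact: continuous_sin|rewrite mulr_natl cos2pi cos0].
  move=> /eqP i0; have := iC2 R; rewrite i0 mul0r => /eqP.
  by rewrite eq_sym oppr_eq0 oner_eq0.
apply: (@cint_derive (fun r t => h (circ a r t)) (fun r t => eit t * CX h (circ a r t))).
- by move=> x t; exact: circ_derive_r.
- by move=> x; exact: ccont_circ.
- apply: (@ccontM _ _ (fun q : R * R => eit q.2) (fun q : R * R => CX h (circ a q.1 q.2))).
    by apply: ccont_comp ccont_eit => q; exact: cvg_snd.
  apply: (@ccont_comp _ _ _ (fun q => CX h (circ q.1.1 q.1.2 q.2)) (fun q : R * R =>
    ((a, q.1), q.2) : (P * R) * R)).
    apply: continuous_pair => [|q]; last exact: cvg_snd.
    by apply: continuous_pair => q; [exact: cvg_cst|exact: cvg_fst].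
  exact: ccont_comp circ_cont3 cX.
Qed.

(* With g r = cmean 0 (CX h) a r, the first mean f = cmean 1 h a satisfies f r = r g r and
   f' = g; hence exp (- x) f (exp x) is constant in x, i.e. g is constant on r > 0. *)
Lemma cmean0_CX h a : ent h -> cmean 0 (CX h) a 1 = (2 * pi)%:C * CX h a.
Proof.
move=> eh; have [h1 hY] := eh; have cX := cC_cont (cC_CX h1).
rewrite -cmean0_center.
have gE x : cmean 0 (CX h) a (expR x) = cmean 0 (CX h) a 1.
  have E y : (expR (- y))%:C * cmean 1 h a (expR y) = cmean 0 (CX h) a (expR y).
    have := cmean_shift 0 a (expR y) eh; rewrite mul1r => <-.
    by rewrite mulrA -rmorphM /= -expRD addNr expR0 mul1r.
  have <- : cmean 0 (CX h) a (expR 0) = cmean 0 (CX h) a 1 by rewrite expR0.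
  rewrite -(E x) -(E 0).
  apply: (@is_cderive_cst_eq (fun y => (expR (- y))%:C * cmean 1 h a (expR y))) => y.
  have de : is_derive y (1 : R) (fun y => expR (- y)) (- expR (- y)).
    have H := is_derive1_comp (is_derive_expR (- y)) (is_deriveN (is_derive_id y (1 : R))).
    by apply: is_derive_eq H _; rewrite mulrN1.
  have dg : is_cderive (fun y => cmean 1 h a (expR y)) y
      ((expR y)%:C * cmean 0 (CX h) a (expR y)).
    have [d1 d2] := cmean_derive 0 a (expR y) eh.
    split.
      have H := is_derive1_comp d1 (is_derive_expR y).
      by apply: is_derive_eq H _; rewrite !ReIm /=; ring.
    have H := is_derive1_comp d2 (is_derive_expR y).
    by apply: is_derive_eq H _; rewrite !ReIm /=; ring.
  have dE : is_cderive (fun y => (expR (- y))%:C) y (- expR (- y))%:C.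
    by split => //=; exact: is_derive_cst.
  have := is_cderiveM dE dg; congr is_cderive.
  have := cmean_shift 0 a (expR y) eh; rewrite mul1r => <-.
  by rewrite rmorphN /=; ring.
(* The radii [expR x] are positive; continuity in the radius carries the constant value to radius 0,
   the center. *)
have lim (f : R -> R) : continuous f -> (forall x, f (expR x) = f 1) -> f 1 = f 0.
  move=> cf ef.
  have f1 : f x @[x --> 0^'+] --> f 0 by apply: cvg_at_right_filter; exact: cf.
  have f2 : f x @[x --> 0^'+] --> f 1.
    apply: (@cvg_trans _ ((fun=> f 1) x @[x --> 0^'+])); last exact: cvg_cst.
    apply: near_eq_cvg; near=> x.
    by rewrite -(ef (ln x)) lnK// posrE; near: x; exact: nbhs_right_gt.
  exact: cvg_unique f2 f1.
have [c1 c2] := cmean_cont 0 cX.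
have sec : continuous (fun r : R => (a, r)).
  by apply: continuous_pair => q; [exact: cvg_cst|exact: cvg_id].
apply: complexP.
  apply: (lim (fun r => complex.Re (cmean 0 (CX h) a r))) => [|x]; last by rewrite gE.
  move=> q; apply: (@continuous_comp _ _ _ (fun r : R => (a, r)) (fun q : P * R =>
    complex.Re (cmean 0 (CX h) q.1 q.2))); [exact: sec|exact: c1].
apply: (lim (fun r => complex.Im (cmean 0 (CX h) a r))) => [|x]; last by rewrite gE.
move=> q; apply: (@continuous_comp _ _ _ (fun r : R => (a, r)) (fun q : P * R =>
  complex.Im (cmean 0 (CX h) q.1 q.2))); [exact: sec|exact: c2].
Unshelve. all: end_near. Qed.

Lemma ccont_cC0 F : ccont F -> cC 0 F.
Proof. by case=> a b; exact: conj (conj a I) (conj b I). Qed.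

Lemma ent_CX h : ent h -> ent (CX h).
Proof.
move=> eh; have [h1 hY] := eh; have cX := cC_cont (cC_CX h1).
have ch := cC_cont h1; have dh := cC_cderiv h1.
have p0 : (2 * pi)%:C != 0 :> C.
  by apply/eqP => -[] /eqP; rewrite gt_eqF// pi2_gt0.
(* The radius is fixed and the center moves, so the kernel e^(-it) is independent of [p]:
   derivatives in [p] fall on [h] alone, which is C^1. *)
pose K (f : P -> C) (p : P) t := f (circ p 1 t) * emit 1 t.
have KE : CX h = fun p => (2 * pi)%:C^-1 * cint (K h p).
  apply/funext => p; apply: (mulfI p0); rewrite mulVKf// -cmean0_CX//.
  by have := cmean_shift 0 p 1 eh; rewrite !mul1r.
have cK f : ccont f -> ccont (fun q : P * R => K f q.1 q.2).
  exact: ccont_circ_unit.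
have shift (t : R) f fx fy : partials f fx fy ->
    partials (fun p => f (circ p 1 t)) (fun p => fx (circ p 1 t)) (fun p => fy (circ p 1 t)).
  move=> H p;
    have [/is_derive_exE h1' /is_derive_exE h2' /is_derive_eyE h3' /is_derive_eyE h4'] :=
      H (circ p 1 t).
  have S (x k : R) : is_derive x (1 : R) (fun x => x + k) 1.
    have := is_derive_affine k 1 x; congr is_derive; apply/funext => y; by rewrite mul1r addrC.
  have T (f' : R -> R) (x k l : R) : is_derive (x + k) (1 : R) f' l -> is_derive x (1 : R)
    (fun x => f' (x + k)) l.
    by move=> d; have := @is_derive1_comp R f' (fun x => x + k) x l 1 d (S x k); rewrite mulr1.
  split; [apply/is_derive_exE|apply/is_derive_exE|apply/is_derive_eyE|apply/is_derive_eyE];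
    [exact: T h1'|exact: T h2'|exact: T h3'|exact: T h4'].
have pK : partials (fun p => cint (K h p)) (fun p => cint (K (CX h) p)) (fun p =>
  cint (K (CY h) p)).
  apply: cint_partials.
  - move=> t; have := partialsM (shift t _ _ _ dh) (partials_cst (emit 1 t)).
    by congr partials; apply/funext => p; rewrite /K mulr0 addr0.
  - exact: cK.
  - exact: cK.
  - by apply: cK; exact: cC_cont (cC_CY h1).
have pX := partialsZ (2 * pi)%:C^-1 pK.
rewrite -KE in pX.
have [XE YE] := partials_uniq pX.
have YX : CY (CX h) = fun p => iC R * CX (CX h) p.
  rewrite XE YE; apply/funext => p; rewrite mulrCA; congr (_ * _).
  rewrite -cintZ; last exact: ccont_circM.
  by congr cint; apply/funext => t; rewrite /K hY mulrA.
have cXX : ccont (CX (CX h)).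
  rewrite XE; apply: ccontM; first exact: ccont_cst.
  apply: (@ccont_cint P (fun p t => K (CX h) p t)); exact: cK.
split; last by move=> p; rewrite YX.
have c0 := ccont_cC0 cXX.
apply: (cC_recS cX (partials_cderiv pX) c0).
by rewrite YX; exact: cCZ.
Qed.

(** Cauchy's formula for the Taylor coefficients: the mean value property is the case k = 0, and
    [cmean_shift] trades one frequency for one derivative. *)
Lemma cmean_ent k h a r : ent h ->
  cmean k h a r = (2 * pi)%:C * (k`!%:R)^-1 * r%:C ^+ k * iter k (@CX R) h a.
Proof.
elim: k h => [|k IH] h eh; first by rewrite cmean0_ent// fact0 mulr1n invr1 !mulr1.
have k0 : (k.+1%:R : C) != 0 by rewrite pnatr_eq0.
apply: (mulfI k0); rewrite -cmean_shift// IH; last exact: ent_CX.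
have f0 : (k`!%:R : C) != 0 by rewrite pnatr_eq0 -lt0n fact_gt0.
rewrite -iterSr factS natrM exprS.
move: (k.+1%:R) (k`!%:R) k0 f0 => c d c0 d0; field.
by rewrite c0 d0.
Qed.

End CircleMeans.

(** * Polyanalytic functions and the operator fockD *)

Section Polyanalytic.
Variable R : realType.
Notation C := R[i].
Notation P := (R * R)%type.
Implicit Types (F G h : P -> C) (p : P) (c : C).

Lemma dbar_ent h p : ent h -> dbar h p = 0.
Proof. by move=> [_ hY]; rewrite /dbar hY mulrA iC2 mulN1r subrr mulr0. Qed.

Lemma del_ent h : ent h -> del h = CX h.
Proof.
move=> [_ hY]; apply/funext => p; rewrite /del hY mulrA iC2.
by rewrite (_ : _ - _ = 2 * CX h p) ?mulKf//; ring.
Qed.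

Lemma ent_dbar h : cC 1 h -> (forall p, dbar h p = 0) -> ent h.
Proof.
move=> h1 hd; split=> // p.
have := hd p; rewrite /dbar => /eqP; rewrite mulf_eq0 invr_eq0 pnatr_eq0 /= => /eqP E.
apply/eqP; rewrite -subr_eq0; apply/eqP.
rewrite (_ : CY h p - iC R * CX h p = - iC R * (CX h p + iC R * CY h p)); first by rewrite E mulr0.
rewrite (_ : - iC R * _ = - iC R * CX h p - (iC R * iC R) * CY h p); first by rewrite iC2; ring.
by ring.
Qed.

Lemma ent_del h : ent h -> ent (del h).
Proof. by move=> eh; rewrite del_ent//; exact: ent_CX. Qed.

Lemma entZ c h : ent h -> ent (fun p => c * h p).
Proof.
move=> eh; have [h1 hY] := eh; apply: ent_dbar; first exact: cCZ.
by move=> p; rewrite dbarZ ?dbar_ent ?mulr0//; exact: cC_cderiv h1.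
Qed.

Lemma entD g h : ent g -> ent h -> ent (fun p => g p + h p).
Proof.
move=> eg eh; have [g1 _] := eg; have [h1 _] := eh.
apply: ent_dbar; first exact: cCD.
by move=> p; rewrite dbarD ?dbar_ent ?addr0//; [exact: cC_cderiv g1|exact: cC_cderiv h1].
Qed.

(* Finite sums of conj(z)^k h with h entire. They are smooth, and del and dbar commute on them
   without an appeal to the symmetry of second derivatives. *)
Inductive nice : (P -> C) -> Prop :=
| nice_ent h : ent h -> nice h
| niceD F G : nice F -> nice G -> nice (fun p => F p + G p)
| nice_conjz F : nice F -> nice (fun p => conjz p * F p).

Lemma nice_cont F : nice F -> ccont F.
Proof.
elim=> [h [h1 _]|G H _ cG _ cH|G _ cG]; first exact: cC_cont h1.
  exact: ccontD.
by apply: ccontM => //; exact: ccont_conjz.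
Qed.

Lemma nice_cderiv F : nice F -> cderiv F.
Proof.
elim=> [h [h1 _]|G H _ dG _ dH|G _ dG]; first exact: cC_cderiv h1.
  exact: partials_cderiv (partialsD dG dH).
exact: partials_cderiv (partialsM (@partials_conjz R) dG).
Qed.

Lemma cderiv_conjz : cderiv (@conjz R).
Proof. exact: partials_cderiv (@partials_conjz R). Qed.

Lemma del_conjzM F : cderiv F -> del (fun p => conjz p * F p) = fun p => conjz p * del F p.
Proof.
move=> dF; rewrite delM//; last exact: cderiv_conjz.
by apply/funext => p; rewrite del_conjz mul0r add0r.
Qed.

Lemma dbar_conjzM F : cderiv F ->
  dbar (fun p => conjz p * F p) = fun p => F p + conjz p * dbar F p.
Proof.
move=> dF; rewrite dbarM//; last exact: cderiv_conjz.
by apply/funext => p; rewrite dbar_conjz mul1r.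
Qed.

Lemma nice_del F : nice F -> nice (del F).
Proof.
elim=> [h eh|G H nG IG nH IH|G nG IG]; first exact/nice_ent/ent_del.
  by rewrite (delD (nice_cderiv nG) (nice_cderiv nH)); exact: niceD.
by rewrite del_conjzM; [exact: nice_conjz|exact: nice_cderiv].
Qed.

Lemma ent0 : ent (fun _ : P => 0 : C).
Proof.
have d0 := partials_cst (0 : C); have [X0 Y0] := partials_uniq d0.
have c00 : cC 0 (fun _ : P => 0 : C) by apply: ccont_cC0; exact: ccont_cst.
split; last by move=> p; rewrite X0 Y0 mulr0.
by apply: (cC_recS (ccont_cst _ 0) (partials_cderiv d0)); rewrite ?X0 ?Y0.
Qed.

Lemma nice_dbar F : nice F -> nice (dbar F).
Proof.
elim=> [h eh|G H nG IG nH IH|G nG IG].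
- rewrite (_ : dbar h = fun=> 0); first exact: nice_ent ent0.
  by apply/funext => p; exact: dbar_ent.
- by rewrite (dbarD (nice_cderiv nG) (nice_cderiv nH)); exact: niceD.
- rewrite dbar_conjzM; last exact: nice_cderiv.
  by apply: niceD => //; exact: nice_conjz.
Qed.

Lemma niceZ c F : nice F -> nice (fun p => c * F p).
Proof.
elim=> [h eh|G H nG IG nH IH|G nG IG]; first exact/nice_ent/entZ.
  by under eq_fun do rewrite mulrDr; exact: niceD.
by under eq_fun do rewrite mulrCA; exact: nice_conjz.
Qed.

(** [CX] and [CY] are combinations of del and dbar, under which [nice] is stable, so the bootstrap
    [cC_class] applies. *)
Lemma nice_cC m F : nice F -> cC m F.
Proof.
apply: cC_class => G nG; have nd := nice_del nG; have nb := nice_dbar nG.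
have -> : CX G = fun p => del G p + dbar G p by apply/funext => p; exact: CXE.
have -> : CY G = fun p => iC R * (del G p + (-1) * dbar G p).
  by apply/funext => p; rewrite CYE mulN1r.
split; [exact: nice_cont|exact: nice_cderiv|exact: niceD|].
by apply: niceZ; apply: niceD => //; exact: niceZ.
Qed.

Lemma nice_comm F : nice F -> del (dbar F) = dbar (del F).
Proof.
elim=> [h eh|G H nG IG nH IH|G nG IG].
- rewrite (_ : dbar h = fun=> 0); last by apply/funext => p; exact: dbar_ent.
  rewrite del_ent; last exact: ent0.
  have [-> _] := partials_uniq (partials_cst (0 : C)).
  by apply/funext => p; rewrite dbar_ent//; exact: ent_del.
- rewrite (dbarD (nice_cderiv nG) (nice_cderiv nH)) (delD (nice_cderiv nG) (nice_cderiv nH)).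
  rewrite (delD (nice_cderiv (nice_dbar nG)) (nice_cderiv (nice_dbar nH))).
  by rewrite (dbarD (nice_cderiv (nice_del nG)) (nice_cderiv (nice_del nH))) IG IH.
- have dG := nice_cderiv nG; have dbG := nice_cderiv (nice_dbar nG).
  have ddG := nice_cderiv (nice_del nG).
  rewrite (dbar_conjzM dG) (delD dG (nice_cderiv (nice_conjz (nice_dbar nG)))).
  by rewrite (del_conjzM dbG) (del_conjzM dG) (dbar_conjzM ddG) IG.
Qed.

(** The conjugate of [del] by the Gaussian weight, see [del_gw]. With [dbar] it forms, up to scale,
    a pair of creation and annihilation operators. *)
Definition fockD F p : C := del F p + (- (2 * pi))%:C * (conjz p * F p).

Lemma nice_fockD F : nice F -> nice (fockD F).
Proof.
move=> nF; apply: niceD; first exact: nice_del.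
by apply: niceZ; exact: nice_conjz.
Qed.

Lemma fockD_add F G : cderiv F -> cderiv G ->
  fockD (fun p => F p + G p) = fun p => fockD F p + fockD G p.
Proof. by move=> dF dG; apply/funext => p; rewrite /fockD (delD dF dG); ring. Qed.

Lemma fockDZ c F : cderiv F -> fockD (fun p => c * F p) = fun p => c * fockD F p.
Proof. by move=> dF; apply/funext => p; rewrite /fockD (delZ c dF); ring. Qed.

Lemma nice_iter_fockD j F : nice F -> nice (iter j fockD F).
Proof. by move=> nF; elim: j => //= j; exact: nice_fockD. Qed.

Lemma iter_fockD_add j F G : nice F -> nice G ->
  iter j fockD (fun p => F p + G p) = fun p => iter j fockD F p + iter j fockD G p.
Proof.
move=> nF nG; elim: j => //= j ->.
by rewrite (fockD_add (nice_cderiv (nice_iter_fockD j nF)) (nice_cderiv (nice_iter_fockD j nG))).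
Qed.

Lemma iter_fockDZ j c F : nice F ->
  iter j fockD (fun p => c * F p) = fun p => c * iter j fockD F p.
Proof.
move=> nF; elim: j => //= j ->.
by rewrite (fockDZ c (nice_cderiv (nice_iter_fockD j nF))).
Qed.

Lemma dbar_fockD F : nice F ->
  dbar (fockD F) = fun p => fockD (dbar F) p + (- (2 * pi))%:C * F p.
Proof.
move=> nF; have dF := nice_cderiv nF.
have dc := nice_cderiv (nice_conjz nF).
rewrite /fockD dbarD;
  [|exact: nice_cderiv (nice_del nF)|exact: nice_cderiv (niceZ _ (nice_conjz nF))].
rewrite (dbarZ _ dc) (dbar_conjzM dF) (nice_comm nF).
by apply/funext => p; ring.
Qed.

(** Moving dbar to the right past each of the j + 1 factors leaves one copy of -2 pi, and dbar h = 0
    at the end. *)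
Lemma dbar_iter_fockD j h : ent h ->
  dbar (iter j.+1 fockD h) = fun p => (- (2 * pi) *+ j.+1)%:C * iter j fockD h p.
Proof.
move=> eh; elim: j => [|j IH].
  rewrite dbar_fockD; last exact: nice_ent.
  rewrite (_ : dbar h = fun=> 0); last by apply/funext => p; exact: dbar_ent.
  apply/funext => p; rewrite /fockD del_ent; last exact: ent0.
  have [-> _] := partials_uniq (partials_cst (0 : C)).
  by rewrite !mulr0 !add0r.
have nj := nice_iter_fockD j.+1 (nice_ent eh).
rewrite [iter j.+2 _ _]iterS (dbar_fockD nj) IH.
rewrite (fockDZ _ (nice_cderiv (nice_iter_fockD j (nice_ent eh)))).
apply/funext => p; rewrite -[fockD (iter j _ _)]/(iter j.+1 fockD h) [in RHS]mulrS rmorphD /=.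
by ring.
Qed.

Lemma cC_iter_dbar k m F : cC (k + m) F -> cC m (iter k (@dbar R) F).
Proof.
elim: k m F => [|k IH] m F; first by [].
by rewrite iterSr addSn => H; apply: IH; exact: cC_dbar.
Qed.

Lemma iter_dbarD k F G : cC k F -> cC k G ->
  iter k (@dbar R) (fun p => F p + G p) = fun p => iter k (@dbar R) F p + iter k (@dbar R) G p.
Proof.
elim: k F G => [|k IH] F G cF cG; first by [].
rewrite !iterSr dbarD; [|exact: cC_cderiv cF|exact: cC_cderiv cG].
by apply: IH; exact: cC_dbar.
Qed.

Lemma iter_dbarZ k c F : cC k F ->
  iter k (@dbar R) (fun p => c * F p) = fun p => c * iter k (@dbar R) F p.
Proof.
elim: k F => [|k IH] F cF; first by [].
rewrite !iterSr dbarZ; last exact: cC_cderiv cF.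
by apply: IH; exact: cC_dbar.
Qed.

Definition dcoef (n : nat) : R := (- (2 * pi)) ^+ n * n`!%:R.

Lemma dcoef_neq0 n : dcoef n != 0.
Proof.
apply: mulf_neq0; last by rewrite pnatr_eq0 -lt0n fact_gt0.
by rewrite expf_neq0// oppr_eq0 gt_eqF// pi2_gt0.
Qed.

Lemma dcoefC_neq0 n : (dcoef n)%:C != 0 :> C.
Proof. by have := dcoef_neq0 n; apply: contra => /eqP[/eqP]. Qed.

Lemma iter_dbar_diag n h : ent h ->
  iter n (@dbar R) (iter n fockD h) = fun p => (dcoef n)%:C * h p.
Proof.
move=> eh; elim: n => [|n IH].
  by apply/funext => p; rewrite /= /dcoef expr0 fact0 mul1r mul1r.
rewrite iterSr (dbar_iter_fockD n eh) (iter_dbarZ _ (nice_cC n (nice_iter_fockD n (nice_ent eh)))).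
rewrite IH; apply/funext => p; rewrite mulrA -rmorphM; congr (_%:C * _).
by rewrite /dcoef factS natrM exprS -mulr_natr; ring.
Qed.

Lemma iter_dbar0 k : iter k (@dbar R) (fun=> 0) = fun=> 0.
Proof.
by elim: k => //= k ->; apply/funext => p; apply: dbar_ent; exact: ent0.
Qed.

(** dbar^j already reduces D^j h to a multiple of [h], which one more dbar kills. *)
Lemma iter_dbar_gt j n h : ent h -> (j < n)%N ->
  iter n (@dbar R) (iter j fockD h) = fun=> 0.
Proof.
move=> eh jn; rewrite -(subnK jn) iterD [iter j.+1 _ _]iterS (iter_dbar_diag _ eh).
rewrite (_ : dbar _ = fun=> 0) ?iter_dbar0//.
by apply/funext => p; apply: dbar_ent; exact: entZ.
Qed.

(** The even-odd condition on the two components of a slice function, written for a + i b. *)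
Definition csym F : Prop := forall p, F (p.1, - p.2) = conjc (F p).

(** [F] is a fixed point of the reflection [s], which acts on the partial derivatives with a sign in
    y; uniqueness of derivatives concludes. *)
Lemma csym_partials F Fx Fy : partials F Fx Fy -> csym F ->
  csym Fx /\ forall p, Fy (p.1, - p.2) = - conjc (Fy p).
Proof.
move=> dF sF.
pose s (G : P -> C) p := conjc (G (p.1, - p.2)).
have conjK (z : C) : conjc (conjc z) = z by case: z => a b /=; rewrite opprK.
have dS : partials (s F) (s Fx) (fun p => - s Fy p).
  move=> p; have [/is_derive_exE a /is_derive_exE b /is_derive_eyE c /is_derive_eyE d] :=
    dF (p.1, - p.2).
  have reS (G : P -> C) q : reF (s G) q = reF G (q.1, - q.2) by rewrite /reF /s; case: (G _).
  have imS (G : P -> C) q : imF (s G) q = - imF G (q.1, - q.2) by rewrite /imF /s; case: (G _).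
  have dN := is_deriveN (is_derive_id p.2 (1 : R)).
  have e1 : (fun x => reF (s F) (x, p.2)) = fun x => reF F (x, - p.2).
    by apply/funext => x; rewrite reS.
  have e2 : (fun x => imF (s F) (x, p.2)) = fun x => - imF F (x, - p.2).
    by apply/funext => x; rewrite imS.
  have e3 : (fun y => reF (s F) (p.1, y)) = fun y => reF F (p.1, - y).
    by apply/funext => y; rewrite reS.
  have e4 : (fun y => imF (s F) (p.1, y)) = fun y => - imF F (p.1, - y).
    by apply/funext => y; rewrite imS.
  split.
  - by apply/is_derive_exE; rewrite e1 reS.
  - by apply/is_derive_exE; rewrite e2 imS; exact: is_deriveN.
  - apply/is_derive_eyE; rewrite e3 /reF ReN -/(reF _ _) reS.
    have H := is_derive1_comp c dN; apply: is_derive_eq H _; by rewrite mulrN1.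
  - apply/is_derive_eyE; rewrite e4 /imF ImN -/(imF _ _) imS.
    have H := is_deriveN (is_derive1_comp d dN); apply: is_derive_eq H _; by rewrite mulrN1.
have sE : s F = F by apply/funext => p; rewrite /s sF conjK.
rewrite sE in dS; have [X1 Y1] := partials_uniq dS; have [X2 Y2] := partials_uniq dF.
split=> p.
  have -> : Fx p = s Fx p by rewrite -{1}X2 X1.
  exact: (esym (conjK _)).
have -> : Fy p = - s Fy p by rewrite -{1}Y2 Y1.
by rewrite raddfN opprK; exact: (esym (conjK _)).
Qed.

Lemma csymD F G : csym F -> csym G -> csym (fun p => F p + G p).
Proof. by move=> a b p; rewrite a b rmorphD. Qed.

Lemma csymZ (k : R) F : csym F -> csym (fun p => k%:C * F p).
Proof. by move=> a p; rewrite a; case: (F p) => x y; apply: complexP => /=; ring. Qed.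

Lemma csym_conjz : csym (@conjz R).
Proof. by move=> p. Qed.

Lemma csymM F G : csym F -> csym G -> csym (fun p => F p * G p).
Proof. by move=> a b p; rewrite a b rmorphM. Qed.

Lemma csym_deldbar F : cderiv F -> csym F -> csym (del F) /\ csym (dbar F).
Proof.
move=> dF sF; have [sX sY] := csym_partials dF sF.
have iE (z : C) : iC R * - conjc z = conjc (iC R * z).
  by case: z => a b; apply: complexP => /=; ring.
have hE (z : C) : 2^-1 * conjc z = conjc (2^-1 * z).
  by rewrite rmorphM fmorphV rmorph_nat.
by split=> p; rewrite /del /dbar sX sY iE -?rmorphB -?rmorphD hE.
Qed.

Lemma csym_fockD F : cderiv F -> csym F -> csym (fockD F).
Proof.
move=> dF sF; apply: csymD; first by have [] := csym_deldbar dF sF.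
by apply: csymZ; apply: csymM => //; exact: csym_conjz.
Qed.

Lemma csym_iter_fockD j F : nice F -> csym F -> csym (iter j fockD F).
Proof.
move=> nF sF; elim: j => //= j IH; apply: csym_fockD => //.
exact/nice_cderiv/nice_iter_fockD.
Qed.

Lemma csym_iter_dbar j F : cC j F -> csym F -> csym (iter j (@dbar R) F).
Proof.
elim: j F => [|j IH] F cF sF; first by [].
rewrite iterSr; apply: IH; first exact: cC_dbar.
by have [] := csym_deldbar (cC_cderiv cF) sF.
Qed.

Lemma poly_decomp n F : cC n F -> csym F -> iter n (@dbar R) F = (fun=> 0) ->
  exists H : nat -> P -> C, [/\ forall j, ent (H j), forall j, csym (H j) &
    F = fun p => \sum_(j < n) iter j fockD (H j) p].
Proof.
elim: n F => [|n IH] F cF sF F0.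
  exists (fun _ _ => 0); split; first by move=> _; exact: ent0.
    by move=> _ p; rewrite conjc0.
  by move: F0; rewrite /= => ->; apply/funext => p; rewrite big_ord0.
(* Of the n + 1 available derivatives, n are spent on dbar^n; the last one gives the C^1 regularity
   demanded by [ent]. *)
have c1 : cC 1 (iter n (@dbar R) F) by apply: cC_iter_dbar; rewrite addn1.
have eh : ent (iter n (@dbar R) F).
  by apply: ent_dbar => // p; move: F0; rewrite iterS => ->.
have cnF : cC n F by exact: cCS.
have sh : csym (iter n (@dbar R) F) by exact: csym_iter_dbar.
(* This constant is real, so multiplication by it preserves [csym]. *)
pose k := (dcoef n)^-1.
have kd : (dcoef n)%:C * k%:C = 1 :> C.
  by apply: complexP; rewrite ReIm /= ?mulr0 ?mul0r ?subr0 ?addr0// mulfV// dcoef_neq0.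
pose Hn := fun p => k%:C * iter n (@dbar R) F p.
have eHn : ent Hn by exact: entZ.
have sHn : csym Hn by exact: csymZ.
have nDn := nice_iter_fockD n (nice_ent eHn).
pose F' := fun p => F p + (-1) * iter n fockD Hn p.
have nDn' := niceZ (-1) nDn.
have cF' : cC n F' by apply: cCD => //; exact: nice_cC nDn'.
have sF' : csym F'.
  apply: csymD => //; have := @csymZ (-1) _ (csym_iter_fockD n (nice_ent eHn) sHn).
  by rewrite rmorphN1.
have F'0 : iter n (@dbar R) F' = fun=> 0.
  rewrite (iter_dbarD cnF (nice_cC n nDn')) (iter_dbarZ _ (nice_cC n nDn)).
  rewrite (iter_dbar_diag n eHn); apply/funext => p.
  by rewrite /Hn [_%:C * (k%:C * _)]mulrA kd mul1r mulN1r subrr.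
have [H [eH sH E]] := IH F' cF' sF' F'0.
(* Every index from n on receives [Hn]: the sum reads it at n only, and all members of the family
   stay entire and symmetric. *)
exists (fun j => if (j < n)%N then H j else Hn); split; [by move=> j; case: ifP|by move=> j;
  case: ifP|].
apply/funext => p; rewrite big_ord_recr /= ltnn.
rewrite (eq_bigr (fun j : 'I_n => iter j fockD (H j) p)); last by move=> j _; rewrite ltn_ord.
by have := congr1 (fun f => f p) E; rewrite /F' => <-; ring.
Qed.

Lemma iter_dbar_sum k n (G : nat -> P -> C) : (forall j, nice (G j)) ->
  iter k (@dbar R) (fun p => \sum_(j < n) G j p) =
  fun p => \sum_(j < n) iter k (@dbar R) (G j) p.
Proof.
(* Niceness of the partial sum is carried along because splitting dbar^k over the last term requires
   its smoothness. *)
move=> nG; suff [] : nice (fun p => \sum_(j < n) G j p) /\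
    iter k (@dbar R) (fun p => \sum_(j < n) G j p) =
    fun p => \sum_(j < n) iter k (@dbar R) (G j) p by [].
elim: n => [|n [IH1 IH2]].
  split; last first.
    rewrite (_ : (fun p => \sum_(j < 0) G j p) = fun=> 0).
      by rewrite iter_dbar0; apply/funext => p; rewrite big_ord0.
    by apply/funext => p; rewrite big_ord0.
  by under eq_fun do rewrite big_ord0; exact: nice_ent ent0.
have E : (fun p => \sum_(j < n.+1) G j p) = fun p => \sum_(j < n) G j p + G n p.
  by apply/funext => p; rewrite big_ord_recr.
rewrite E; split; first exact: niceD.
rewrite (iter_dbarD (nice_cC k IH1) (nice_cC k (nG n))).
by rewrite IH2; apply/funext => p; rewrite big_ord_recr.
Qed.

Lemma nice_sum n (G : nat -> P -> C) : (forall j, nice (G j)) ->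
  nice (fun p => \sum_(j < n) G j p).
Proof.
move=> nG; elim: n => [|n IH].
  by under eq_fun do rewrite big_ord0; exact: nice_ent ent0.
by under eq_fun do rewrite big_ord_recr /=; exact: niceD.
Qed.

(** dbar^(n-1) kills all terms of a sum of n except the last, which becomes a nonzero multiple of
    its entire function. *)
Lemma poly_sum_eq0 n (H : nat -> P -> C) : (forall j, ent (H j)) ->
  (forall p, \sum_(j < n) iter j fockD (H j) p = 0) ->
  forall j, (j < n)%N -> iter j fockD (H j) = fun=> 0.
Proof.
move=> eH; elim: n => [//|n IH] S0.
have Hn : H n = fun=> 0.
  have := @iter_dbar_sum n n.+1 (fun j => iter j fockD (H j)) (fun j =>
    nice_iter_fockD j (nice_ent (eH j))).
  rewrite (_ : (fun p => _) = fun=> 0); last by apply/funext => p; exact: S0.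
  rewrite iter_dbar0 => E; apply/funext => p.
  have := congr1 (fun f => f p) E; rewrite big_ord_recr /= big1 ?add0r; last first.
    by move=> j _; rewrite iter_dbar_gt.
  rewrite (iter_dbar_diag _ (eH n)) => /esym/eqP;
    rewrite mulf_eq0 (negPf (dcoefC_neq0 n)) /= => /eqP ->//.
have Dn : iter n fockD (H n) = fun=> 0.
  have := @iter_fockDZ n 0 (H n) (nice_ent (eH n)).
  rewrite (_ : (fun p => 0 * H n p) = H n); last by apply/funext => p; rewrite Hn mul0r.
  by move=> ->; apply/funext => p; rewrite mul0r.
move=> j; rewrite ltnS leq_eqVlt => /predU1P[->//|jn].
by apply: IH => // p; have := S0 p; rewrite big_ord_recr /= Dn addr0.
Qed.

End Polyanalytic.

(** * Square-integrable functions for the Gaussian weight *)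

Section PlaneMeasure.
Variable R : realType.
Notation mu := (@lebesgue_measure R).
Notation mu2 := (mu \x mu)%E.
Notation P := (measurableTypeR R * measurableTypeR R)%type.

(** An open set of the plane is the countable union of the rational open rectangles that it
    contains. *)
Lemma measurable_open2 (U : set (R * R)) : open U -> measurable (U : set P).
Proof.
move=> oU.
pose B (q : (rat * rat) * (rat * rat)) : set P :=
  `]ratr q.1.1, ratr q.1.2[%classic `*` `]ratr q.2.1, ratr q.2.2[%classic.
pose F q : set P := if `[< B q `<=` U >] then B q else set0.
have -> : U = \bigcup_q F q.
  apply/seteqP; split=> [[x y] Uxy|p [q _]]; last first.
    by rewrite /F; case: asboolP => // BU Bp; apply: BU.
  have /nbhs_ballP[e /= e0 eU] : nbhs (x, y) U by move: oU; rewrite openE; exact.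
  have rx (z : R) : exists q : rat * rat, [/\ z - e < ratr q.1, ratr q.1 < z, z < ratr q.2 & ratr q.2 < z + e].
    have /rat_in_itvoo[q1] : z - e < z by rewrite ltrBlDr ltrDl.
    rewrite in_itv /= => /andP[a b].
    have /rat_in_itvoo[q2] : z < z + e by rewrite ltrDl.
    by rewrite in_itv /= => /andP[c d]; exists (q1, q2).
  have [q [q1 q2 q3 q4]] := rx x; have [r [r1 r2 r3 r4]] := rx y.
  exists (q, r) => //; rewrite /F; case: asboolP => [_|].
    by split; rewrite /= in_itv /= ?q2 ?r2.
  case=> -[x' y'] [/=]; rewrite !in_itv /= => /andP[a b] /andP[c d].
  apply: eU; split; rewrite /= /ball /= ltr_distlC; apply/andP; split.
  - exact: lt_trans a.
  - exact: lt_trans q4.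
  - exact: lt_trans c.
  - exact: lt_trans r4.
apply: countable_bigcupT_measurable; first exact: countableP.
move=> q; rewrite /F; case: ifP => // _.
by apply: measurableX; exact: measurable_itv.
Qed.

Lemma continuous_measurable2 (u : R * R -> R) : continuous u ->
  measurable_fun [set: P] (u : P -> R).
Proof.
move=> /continuousP cu; apply: (measurability _ (RGenOpens.measurableE R)).
move=> _ [_ [a [b ->] <-]]; rewrite setTI; apply: measurable_open2.
exact/cu/interval_open.
Qed.

(** The boolean selects a translation or a reflection. The image measure agrees with Lebesgue
    measure on half-open intervals, hence everywhere. *)
Lemma lebesgue_affine (phi : R -> R) (e : bool) (c : R) :
  (forall x, phi x = (-1) ^+ e * x + c) ->
  forall f : R -> \bar R, measurable_fun setT f -> (forall x, 0 <= f x)%E ->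
  (\int[mu]_x f (phi x) = \int[mu]_x f x)%E.
Proof.
move=> phiE f mf f0.
have cphi : continuous phi.
  move=> x; rewrite (_ : phi = fun x => (-1) ^+ e * x + c); last exact/funext.
  apply: cvgD; last exact: cvg_cst.
  by apply: cvgM; [exact: cvg_cst|exact: cvg_id].
have mphi : measurable_fun [set: measurableTypeR R] (phi : measurableTypeR R -> measurableTypeR R).
  exact: continuous_measurable_fun.
have E : forall A : set (measurableTypeR R), measurable A -> mu A = pushforward mu phi A.
  apply: (@lebesgue_measure_unique R
    (measure_function_pushforward__canonical__measure_function_Measure mu mphi)).
  move=> _ [[a b] /= ab <-]; rewrite /= /pushforward.
  (* A reflection turns []a, b]] into an interval that is half-open on the other side, of the same
     length. *)
  case: e phiE => phiE.
    rewrite (_ : _ @^-1` _ = `[c - b, c - a[%classic).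
      rewrite !lebesgue_measure_itv /= !lte_fin ltrD2l ltrN2.
      by case: ifP => // _; rewrite -!EFinB; congr (_%:E); ring.
    apply/seteqP; split=> x /=; rewrite !in_itv /= phiE expr1 mulN1r => /andP[h1 h2]; apply/andP;
      split; lra.
  rewrite (_ : _ @^-1` _ = `]a - c, b - c]%classic).
    rewrite !lebesgue_measure_itv /= !lte_fin ltrD2r.
    by case: ifP => // _; rewrite -!EFinB; congr (_%:E); ring.
  apply/seteqP; split=> x /=; rewrite !in_itv /= phiE expr0 mul1r => /andP[h1 h2]; apply/andP;
    split; lra.
have := @ge0_integral_pushforward _ _ _ _ R _ mphi mu setT f measurableT mf (fun y _ => f0 y).
rewrite preimage_setT => <-.
apply: eq_measure_integral => A mA _; exact/esym/E.
Qed.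

Lemma plane_affine (phi psi : R -> R) (e1 e2 : bool) (c1 c2 : R) (w : P -> \bar R) :
  (forall x, phi x = (-1) ^+ e1 * x + c1) -> (forall x, psi x = (-1) ^+ e2 * x + c2) ->
  measurable_fun [set: P] w -> (forall p, 0 <= w p)%E ->
  (\int[mu2]_p w (phi p.1, psi p.2) = \int[mu2]_p w p)%E.
Proof.
move=> phiE psiE mw w0.
have maff (f : R -> R) (e : bool) c : (forall x, f x = (-1) ^+ e * x + c) ->
    measurable_fun [set: measurableTypeR R] (f : measurableTypeR R -> measurableTypeR R).
  move=> fE; apply: continuous_measurable_fun => x.
  rewrite (_ : f = fun x => (-1) ^+ e * x + c); last exact/funext.
  apply: cvgD; last exact: cvg_cst.
  by apply: cvgM; [exact: cvg_cst|exact: cvg_id].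
have m12 : measurable_fun [set: P] (fun p : P => (phi p.1, psi p.2) : P).
  apply: measurable_fun_pair.
    exact: measurableT_comp (maff _ _ _ phiE) measurable_fst.
  exact: measurableT_comp (maff _ _ _ psiE) measurable_snd.
rewrite (fubini_tonelli1 (fun p : P => w (phi p.1, psi p.2))) //;
  last exact: measurableT_comp mw m12.
rewrite (fubini_tonelli1 w)// /fubini_F /=.
under eq_integral => x _.
  rewrite (@lebesgue_affine psi e2 c2 psiE (fun y => w (phi x, y)))//; last first.
    by apply: measurableT_comp mw _; exact: measurable_pair1.
  over.
apply: (@lebesgue_affine phi e1 c1 phiE (fun x => \int[mu]_y w (x, y))%E).
  exact: measurable_fun_fubini_tonelli_F.
by move=> x; exact: integral_ge0.
Qed.

(** * The Gaussian weight and its weighted L^2 functions *)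

Definition gw (p : R * R) : R := expR (- (2 * pi * (p.1 ^+ 2 + p.2 ^+ 2))).

Lemma gw_gt0 p : 0 < gw p. Proof. exact: expR_gt0. Qed.

Lemma continuous_sqr2 : continuous (fun p : R * R => p.1 ^+ 2 + p.2 ^+ 2 : R).
Proof.
move=> p; apply: cvgD; (under eq_fun do rewrite expr2); rewrite expr2; apply: cvgM;
  (exact: cvg_fst || exact: cvg_snd).
Qed.

Lemma gw_cont : continuous gw.
Proof.
move=> p; apply: (@continuous_comp _ _ _ (fun p : R * R =>
  - (2 * pi * (p.1 ^+ 2 + p.2 ^+ 2)) : R) (@expR R)).
  apply: cvgN; apply: cvgM; first exact: cvg_cst.
  exact: continuous_sqr2.
exact: continuous_expR.
Qed.

Lemma measurable_gw : measurable_fun [set: P] (gw : P -> R).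
Proof. exact: continuous_measurable2 gw_cont. Qed.

Definition L2 (u : R * R -> R) : Prop :=
  measurable_fun [set: P] (u : P -> R) /\
  (\int[mu2]_p (u p ^+ 2 * gw p)%:E < +oo)%E.

Lemma measurable_sqr_gw (u : R * R -> R) : measurable_fun [set: P] (u : P -> R) ->
  measurable_fun [set: P] (fun p : P => (u p ^+ 2 * gw p)%:E).
Proof.
move=> mu_; apply/measurable_EFinP; apply: measurable_funM; last exact: measurable_gw.
exact: measurable_funX.
Qed.

Lemma sqr_gw_ge0 (u : R * R -> R) p : 0 <= u p ^+ 2 * gw p.
Proof. by rewrite mulr_ge0 ?sqr_ge0// ltW// gw_gt0. Qed.

Lemma L2_bound (u : R * R -> R) (w : P -> \bar R) : measurable_fun [set: P] (u : P -> R) ->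
  measurable_fun [set: P] w -> (forall p, (u p ^+ 2 * gw p)%:E <= w p)%E ->
  (\int[mu2]_p w p < +oo)%E -> L2 u.
Proof.
move=> mu_ mw uw w_fin; split=> //; apply: le_lt_trans w_fin.
apply: ge0_le_integral => //.
- by move=> p _; rewrite lee_fin sqr_gw_ge0.
- exact: measurable_sqr_gw.
Qed.

Lemma L2D (u v : R * R -> R) : L2 u -> L2 v -> L2 (fun p => u p + v p).
Proof.
move=> [mu_ iu] [mv iv].
(* The bound is (u + v)^2 <= 2 u^2 + 2 v^2. *)
apply: (@L2_bound _ (fun p => 2%:E * (u p ^+ 2 * gw p)%:E + 2%:E * (v p ^+ 2 * gw p)%:E)%E).
- exact: measurable_funD.
- by apply: emeasurable_funD; apply: measurable_funeM; exact: measurable_sqr_gw.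
- move=> p; rewrite -!EFinM -EFinD lee_fin !mulrA -mulrDl ler_pM2r ?gw_gt0//.
  have := sqr_ge0 (u p - v p); rewrite sqrrB sqrrD; lra.
rewrite ge0_integralD//.
- rewrite !ge0_integralZl//; try exact: measurable_sqr_gw; try (by move=> p _;
  rewrite lee_fin sqr_gw_ge0); try by rewrite lee_fin.
  by apply: lte_add_pinfty; apply: lte_mul_pinfty => //; rewrite lee_fin.
- by move=> p _; rewrite -EFinM lee_fin mulr_ge0// sqr_gw_ge0.
- by apply: measurable_funeM; exact: measurable_sqr_gw.
- by move=> p _; rewrite -EFinM lee_fin mulr_ge0// sqr_gw_ge0.
- by apply: measurable_funeM; exact: measurable_sqr_gw.
Qed.

Lemma L2Z (k : R) (u : R * R -> R) : L2 u -> L2 (fun p => k * u p).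
Proof.
move=> [mu_ iu].
apply: (@L2_bound _ (fun p => (k ^+ 2)%:E * (u p ^+ 2 * gw p)%:E)%E).
- by apply: measurable_funM => //; exact: measurable_cst.
- by apply: measurable_funeM; exact: measurable_sqr_gw.
- by move=> p;
  rewrite -EFinM lee_fin (_ : (k * u p) ^+ 2 * gw p = k ^+ 2 * (u p ^+ 2 * gw p)) ?lexx//; ring.
rewrite ge0_integralZl//; last 3 first.
- exact: measurable_sqr_gw.
- by move=> p _; rewrite lee_fin sqr_gw_ge0.
- by rewrite lee_fin sqr_ge0.
by apply: lte_mul_pinfty => //; rewrite lee_fin sqr_ge0.
Qed.

(** Passing to (x, -y) on the slice of I amounts to passing to the unit -I; this is how a single
    slice controls both components. *)
Lemma L2_refl (u : R * R -> R) : L2 u -> L2 (fun p => u (p.1, - p.2)).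
Proof.
move=> [mu_ iu]; split.
  apply: (measurableT_comp mu_); apply: measurable_fun_pair; first exact: measurable_fst.
  by apply: measurableT_comp; [exact: oppr_measurable|exact: measurable_snd].
apply: le_lt_trans iu.
rewrite -(@plane_affine id (fun y => - y) false true 0 0 (fun p => (u p ^+ 2 * gw p)%:E)).
- rewrite le_eqVlt; apply/orP; left; apply/eqP; apply: eq_integral => p _.
  by rewrite /gw /= sqrrN.
- by move=> x; rewrite expr0 mul1r addr0.
- by move=> x; rewrite expr1 mulN1r addr0.
- exact: measurable_sqr_gw.
- by move=> p; rewrite lee_fin sqr_gw_ge0.
Qed.

(** Integrating over the center first, each angle contributes the full integral of [W] by
    translation invariance, and the angles have total mass 2 pi. *)
Lemma circle_tonelli (W : R * R -> R) (r : R) : continuous W -> (forall p, 0 <= W p) ->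
  (\int[mu2]_p (W p)%:E < +oo)%E ->
  measurable_fun [set: P] (fun a : P => (pint (fun t => W (circ a r t)))%:E) /\
  (\int[mu2]_a (pint (fun t => W (circ a r t)))%:E < +oo)%E.
Proof.
move=> cW W0 iW.
have mW := continuous_measurable2 cW.
have mWE : measurable_fun [set: P] (fun p : P => (W p)%:E) by exact/measurable_EFinP.
(* The indicator of the period extends the angular integral to the whole line, where Tonelli
   applies. *)
pose f (q : P * measurableTypeR R) : \bar R :=
  (W (circ q.1 r q.2) * \1_(`[0, 2 * pi] : set (measurableTypeR R)) q.2)%:E.
have mcos : measurable_fun [set: measurableTypeR R]
  (@cos R : measurableTypeR R -> measurableTypeR R).
  by apply: continuous_measurable_fun; exact: continuous_cos.
have msin : measurable_fun [set: measurableTypeR R]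
  (@sin R : measurableTypeR R -> measurableTypeR R).
  by apply: continuous_measurable_fun; exact: continuous_sin.
have m11 : measurable_fun [set: P * measurableTypeR R] (fun q : P * measurableTypeR R => q.1.1).
  exact: measurableT_comp measurable_fst measurable_fst.
have m12 : measurable_fun [set: P * measurableTypeR R] (fun q : P * measurableTypeR R => q.1.2).
  exact: measurableT_comp measurable_snd measurable_fst.
have mcirc : measurable_fun [set: P * measurableTypeR R]
    (fun q : P * measurableTypeR R => circ q.1 r q.2 : P).
  apply: measurable_fun_pair.
    apply: measurable_funD => //; apply: measurable_funM; first exact: measurable_cst.
    exact: measurableT_comp mcos measurable_snd.
  apply: measurable_funD => //; apply: measurable_funM; first exact: measurable_cst.
  exact: measurableT_comp msin measurable_snd.
have mf : measurable_fun [set: P * measurableTypeR R] f.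
  apply/measurable_EFinP; apply: measurable_funM.
    exact: measurableT_comp mW mcirc.
  by apply: measurableT_comp measurable_snd; exact: measurable_indic.
have f0 q : (0 <= f q)%E by rewrite lee_fin mulr_ge0.
have fE a : (\int[mu]_t f (a, t))%E = (pint (fun t => W (circ a r t)))%:E.
  have cWa : continuous (fun t => W (circ a r t)).
    by move=> t; apply: (@continuous_comp _ _ _ (circ a r) W); [exact: circ_cont|exact: cW].
  rewrite /pint /Rintegral fineK; last first.
    exact: integrable_fin_num (pint_integrable cWa).
  rewrite [RHS]integral_mkcond; apply: eq_integral => t _.
  by rewrite /f /patch /= indicE; case: ifP => _; rewrite ?mulr1 ?mulr0.
split.
  have := measurable_fun_fubini_tonelli_F (m2 := mu) f mf f0.
  by rewrite (_ : fubini_F _ f = fun a => (pint (fun t => W (circ a r t)))%:E)//;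
    apply/funext => a; exact: fE.
rewrite (eq_integral (fun a : P => \int[mu]_t f (a, t))%E); last by move=> a _; rewrite fE.
pose T := measurableTypeR R.
have sec (g : P * T -> P * T) : measurable_fun [set: P * T] g ->
    measurable_fun [set: P * T] (fun q => f (g q)).
  by move=> mg; exact: measurableT_comp mf mg.
have mH : measurable_fun [set: P] (fun a => \int[mu]_t f (a, t))%E.
  exact: (measurable_fun_fubini_tonelli_F (m2 := mu) f mf f0).
have mK : measurable_fun [set: P] (fun q => \int[mu]_y f ((q.1, y), q.2))%E.
  apply: (measurable_fun_fubini_tonelli_F (m2 := mu) (fun q : P * T =>
    f ((q.1.1, q.2), q.1.2))) => //.
  apply: sec; apply: measurable_fun_pair => //.
  by apply: measurable_fun_pair => //; exact: measurable_snd.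
(* The angle is moved past one coordinate of the center at a time, so that each exchange concerns
   two integrals over the line. *)
have swap : (\int[mu2]_a \int[mu]_t f (a, t) = \int[mu]_t \int[mu2]_a f (a, t))%E.
  rewrite (fubini_tonelli1 (fun a => \int[mu]_t f (a, t))%E)//; last first.
    by move=> a; exact: integral_ge0.
  transitivity (\int[mu]_x \int[mu]_t \int[mu]_y f ((x, y), t))%E.
    apply: eq_integral => x _; rewrite /fubini_F.
    apply: (@fubini_tonelli _ _ T T R mu mu (fun q : T * T => f ((x, q.1), q.2))) => //.
    apply: (measurableT_comp mf); apply: measurable_fun_pair; last exact: measurable_snd.
    by apply: measurable_fun_pair; [exact: measurable_cst|exact: measurable_fst].
  rewrite (@fubini_tonelli _ _ T T R mu mu (fun q : T * T => \int[mu]_y f ((q.1, y), q.2))%E)//;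
    last first.
    by move=> q; exact: integral_ge0.
  apply: eq_integral => t _.
  rewrite (fubini_tonelli1 (fun a : P => f (a, t)))//.
  apply: (measurableT_comp mf); apply: measurable_fun_pair; last exact: measurable_cst.
  exact: measurable_id.
rewrite swap.
have iE t : (\int[mu2]_a (W (circ a r t))%:E = \int[mu2]_p (W p)%:E)%E.
  apply: (@plane_affine (fun x => x + r * cos t) (fun y => y + r * sin t) false false
    (r * cos t) (r * sin t) (fun p => (W p)%:E)) => //.
  - by move=> x; rewrite expr0 mul1r.
  - by move=> x; rewrite expr0 mul1r.
have K0 : (0 <= \int[mu2]_p (W p)%:E)%E by apply: integral_ge0 => p _; rewrite lee_fin.
apply: (@le_lt_trans _ _ (\int[mu]_(t in `[0%R, (2 * pi)%R]) (cst (\int[mu2]_p (W p)%:E) t))%E).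
  rewrite [leRHS]integral_mkcond; apply: ge0_le_integral => //.
  - by move=> t _; exact: integral_ge0.
  - have -> : (fun t => \int[mu2]_a f (a, t))%E = fun t => (\int[mu]_x \int[mu]_y f ((x, y), t))%E.
      apply/funext => t; rewrite (fubini_tonelli1 (fun a : P => f (a, t)))//.
      apply: (measurableT_comp mf); apply: measurable_fun_pair; last exact: measurable_cst.
      exact: measurable_id.
    apply: (measurable_fun_fubini_tonelli_G (m1 := mu) (fun q : T * T =>
      \int[mu]_y f ((q.1, y), q.2))%E) => //.
    by move=> q; exact: integral_ge0.
  - by apply/(measurable_restrictT _ _).1 => //; exact: measurable_cst.
  move=> t _; rewrite /patch /f /= indicE; case: ifP => _.
    by under eq_integral do rewrite mulr1; rewrite iE.
  by under eq_integral do rewrite mulr0; rewrite integral0.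
rewrite integral_cst//= lebesgue_measure_itv/= lte_fin pi2_gt0.
by apply: lte_mul_pinfty => //; rewrite ?ge0_fin_numE// -EFinB ltry.
Qed.

End PlaneMeasure.

(** * Square-integrability of the true polyanalytic components *)

Section PolyElimination.
Variable R : realType.
Notation C := R[i].
Notation P := (R * R)%type.
Implicit Types (F G : P -> C) (p a : P) (t : R).

Section Subspace.
Variable V : (P -> C) -> Prop.
Hypothesis VD : forall F G, V F -> V G -> V (fun p => F p + G p).
Hypothesis VZ : forall (k : R) F, V F -> V (fun p => k%:C * F p).

(* Replacing S(t) by S(2t) - 2^n S(t) kills the term of degree n. *)
Lemma poly_coef_subspace n (G : nat -> P -> C) :
  (forall t, 0 < t -> V (fun p => \sum_(k < n) (t ^+ k)%:C * G k p)) ->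
  forall k, (k < n)%N -> V (G k).
Proof.
elim: n G => [//|n IH] G HS.
have low k : (k < n)%N -> V (G k).
  (* This is the factor that S(2t) - 2^n S(t) puts on the term of degree k; it can be divided out
     since k < n. *)
  move=> kn; have c0 : (2 : R) ^+ k - 2 ^+ n != 0.
    by rewrite subr_eq0 lt_eqF// ltr_eXn2l// ltr1n.
  have := @IH (fun k p => (2 ^+ k - 2 ^+ n)%:C * G k p) _ k kn.
  move=> /(_ _)/(VZ (2 ^+ k - 2 ^+ n)^-1) H.
  have -> : G k = fun p => ((2 ^+ k - 2 ^+ n)^-1)%:C * ((2 ^+ k - 2 ^+ n)%:C * G k p).
    apply/funext => p; rewrite mulrA -rmorphM /= mulVf// mul1r//.
  apply: H => t t0.
  have := VD (HS (2 * t) _) (VZ (- 2 ^+ n) (HS t t0)); rewrite mulr_gt0// => /(_ isT).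
  congr V; apply/funext => p; rewrite !big_ord_recr /= mulrDr addrACA mulrA -rmorphM /=.
  rewrite -mulrDl -rmorphD /= exprMn mulNr subrr mul0r addr0 mulr_sumr -big_split /=.
  apply: eq_bigr => j _; rewrite exprMn !mulrA -!rmorphM /= -mulrDl -rmorphD /=.
  by congr (_%:C * _); ring.
move=> k; rewrite ltnS leq_eqVlt => /predU1P[->|]; last exact: low.
(* The remaining top coefficient comes from S(1) by subtracting the lower ones singly; [m] counts
   those already removed. *)
have Vsum m : (m <= n)%N -> V (fun p => G n p + \sum_(k < n | (m <= k)%N) (1 ^+ k)%:C * G k p).
  elim: m => [|m IHm] mn.
    by have := HS 1 ltr01; congr V; apply/funext => p;
      rewrite big_ord_recr /= expr1n mul1r addrC; congr (_ + _).
  have := VD (IHm (ltnW mn)) (VZ (-1) (low m mn)); congr V; apply/funext => p.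
  rewrite (bigD1 (Ordinal mn))//= expr1n mul1r rmorphN mulN1r.
  rewrite [X in _ + _ + X = _](_ : _ = - G m p)// [G m p + _]addrC addrA addrK; congr (_ + _).
  by apply: eq_bigl => j; rewrite -val_eqE /= andbC eq_sym -ltn_neqAle.
have := Vsum n (leqnn n); congr V; apply/funext => p; rewrite big1 ?addr0// => j.
by rewrite leqNgt ltn_ord.
Qed.

(** Only the last polynomial of the family reaches the top degree, so that coefficient of the sum is
    a nonzero multiple of the last function; removing it shortens the sum. *)
Lemma poly_triangular_subspace n (q : nat -> {poly R}) (g : nat -> P -> C) :
  (forall j, size (q j) = j.+1) ->
  (forall t, 0 < t -> V (fun p => \sum_(j < n) (q j).[t]%:C * g j p)) ->
  forall j, (j < n)%N -> V (g j).
Proof.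
move=> sq; elim: n => [//|n IH] HS.
have Vn : V (g n).
  have c0 : (q n)`_n != 0.
    by have := lead_coef_eq0 (q n); rewrite lead_coefE sq /= => ->; rewrite -size_poly_eq0 sq.
  have -> : g n = fun p => (((q n)`_n)^-1)%:C * \sum_(j < n.+1) ((q j)`_n)%:C * g j p.
    apply/funext => p; rewrite big_ord_recr /= big1 ?add0r => [|j _].
      by rewrite mulrA -rmorphM /= mulVf// mul1r.
    by rewrite nth_default ?rmorph0 ?mul0r// sq.
  apply: VZ.
  apply: (@poly_coef_subspace n.+1 (fun k p =>
    \sum_(j < n.+1) ((q j)`_k)%:C * g j p) _ n (ltnSn n)).
  move=> t t0; have := HS t t0; congr V; apply/funext => p.
  under [RHS]eq_bigr do rewrite mulr_sumr.
  rewrite exchange_big /=; apply: eq_bigr => j _.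
  rewrite (@horner_coef_wide _ n.+1) ?sq ?ltn_ord// rmorph_sum /= mulr_suml.
  by apply: eq_bigr => k _; rewrite mulrA -rmorphM /= [t ^+ k * _]mulrC.
move=> j; rewrite ltnS leq_eqVlt => /predU1P[->//|]; apply: IH => t t0.
have := VD (HS t t0) (VZ (- (q n).[t]) Vn); congr V; apply/funext => p.
by rewrite big_ord_recr /= rmorphN mulNr addrK.
Qed.

End Subspace.
End PolyElimination.

(** * Circle means twisted by an exponential *)

Section TwistedMeans.
Variable R : realType.
Notation C := R[i].
Notation P := (R * R)%type.
Implicit Types (F G h : P -> C) (p a : P) (r t : R).

(* Multiplication by exp (- 2 pi conj(a) (z - a)) turns fockD into its translate centered at a. *)
Definition etw a p : C :=
  (expR (- (2 * pi) * (a.1 * (p.1 - a.1) + a.2 * (p.2 - a.2))))%:C *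
  eit (- (2 * pi) * (a.1 * (p.2 - a.2) - a.2 * (p.1 - a.1))).

(** The logarithmic derivative of [etw a]. *)
Definition ctw a : C := (- (2 * pi))%:C * conjz a.

Lemma etw_center a : etw a a = 1.
Proof. by rewrite /etw !subrr !mulr0 addr0 mulr0 expR0 mul1r subrr mulr0 /eit cos0 sin0. Qed.

Lemma partials_etw a :
  partials (etw a) (fun p => ctw a * etw a p) (fun p => iC R * (ctw a * etw a p)).
Proof.
have K (A B A' B' x : R) : is_cderive (fun x => (expR (A + B * x))%:C * eit (A' + B' * x)) x
    ((B +i* B') * ((expR (A + B * x))%:C * eit (A' + B' * x))).
  have d1 := @is_derive1_comp R _ (fun x =>
    A + B * x) _ _ _ (is_derive_expR (A + B * x)) (is_derive_affine A B x).
  have d2 := @is_derive1_comp R _ (fun x =>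
    A' + B' * x) _ _ _ (is_derive_cos (A' + B' * x)) (is_derive_affine A' B' x).
  have d3 := @is_derive1_comp R _ (fun x =>
    A' + B' * x) _ _ _ (is_derive_sin (A' + B' * x)) (is_derive_affine A' B' x).
  have e1 : is_cderive (fun x => (expR (A + B * x))%:C) x (expR (A + B * x) * B)%:C.
    by split=> //; exact: is_derive_cst.
  have e2 : is_cderive (fun x => eit (A' + B' * x)) x
      (- sin (A' + B' * x) * B' +i* (cos (A' + B' * x) * B')) by split.
  have := is_cderiveM e1 e2; congr is_cderive.
  by apply: complexP; rewrite !ReIm /=; ring.
move=> p.
(* With the other coordinate fixed, the exponent is affine; the arguments of [K] are its constant
   terms and slopes, in x and then in y. *)
have [x1 x2] := K (- (2 * pi) * (a.2 * (p.2 - a.2) - a.1 * a.1)) (- (2 * pi) * a.1)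
  (- (2 * pi) * (a.1 * (p.2 - a.2) + a.2 * a.1)) (2 * pi * a.2) p.1.
have [y1 y2] := K (- (2 * pi) * (a.1 * (p.1 - a.1) - a.2 * a.2)) (- (2 * pi) * a.2)
  (- (2 * pi) * (- a.1 * a.2 - a.2 * (p.1 - a.1))) (- (2 * pi) * a.1) p.2.
have ex1 x : (expR (- (2 * pi) * (a.2 * (p.2 - a.2) - a.1 * a.1) + - (2 * pi) * a.1 * x))%:C *
    eit (- (2 * pi) * (a.1 * (p.2 - a.2) + a.2 * a.1) + 2 * pi * a.2 * x) = etw a (x, p.2).
  by rewrite /etw /=; congr (_%:C * _); congr (_ _); ring.
have ey1 y : (expR (- (2 * pi) * (a.1 * (p.1 - a.1) - a.2 * a.2) + - (2 * pi) * a.2 * y))%:C *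
    eit (- (2 * pi) * (- a.1 * a.2 - a.2 * (p.1 - a.1)) + - (2 * pi) * a.1 * y) = etw a (p.1, y).
  by rewrite /etw /=; congr (_%:C * _); congr (_ _); ring.
have cx : (- (2 * pi) * a.1 +i* (2 * pi * a.2)) = ctw a.
  by apply: complexP; rewrite !ReIm /=; ring.
have cy : (- (2 * pi) * a.2 +i* (- (2 * pi) * a.1)) = iC R * ctw a.
  by apply: complexP; rewrite !ReIm /=; ring.
rewrite !ex1 cx -surjective_pairing in x1 x2; rewrite !ey1 cy -surjective_pairing -mulrA in y1 y2.
split; [apply/is_derive_exE|apply/is_derive_exE|apply/is_derive_eyE|apply/is_derive_eyE].
- by have := x1; congr is_derive; apply/funext => x; rewrite ex1.
- by have := x2; congr is_derive; apply/funext => x; rewrite ex1.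
- by have := y1; congr is_derive; apply/funext => y; rewrite ey1.
- by have := y2; congr is_derive; apply/funext => y; rewrite ey1.
Qed.

Lemma ccont_etw a : ccont (etw a).
Proof.
have lin (k l : R) (f g : P -> R) : continuous f -> continuous g ->
    continuous (fun p => - (2 * pi) * (k * (f p - a.1) + l * (g p - a.2)) : R).
  move=> cf cg p; apply: cvgM; first exact: cvg_cst.
  apply: cvgD; apply: cvgM; try exact: cvg_cst; apply: cvgB; try exact: cvg_cst;
    [exact: cf|exact: cg].
have c1 : continuous (fun p : P => - (2 * pi) * (a.1 * (p.1 - a.1) + a.2 * (p.2 - a.2)) : R).
  by apply: lin => p; [exact: cvg_fst|exact: cvg_snd].
have c2 : continuous (fun p : P => - (2 * pi) * (a.1 * (p.2 - a.2) - a.2 * (p.1 - a.1)) : R).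
  rewrite (_ : (fun p => _) = fun p : P => - (2 * pi) * (- a.2 * (p.1 - a.1) + a.1 * (p.2 - a.2))).
    by apply: lin => p; [exact: cvg_fst|exact: cvg_snd].
  by apply/funext => p; ring.
apply: ccontM; last exact: ccont_comp c2 (@ccont_eit R).
split => p; last exact: cvg_cst.
exact: (@continuous_comp _ _ _ _ (@expR R) p (c1 p) (@continuous_expR R _)).
Qed.

Lemma ent_etw a : ent (etw a).
Proof.
have d := partials_etw a; have [X Y] := partials_uniq d.
split; last by move=> p; rewrite X Y.
apply: (cC_recS (ccont_etw a) (partials_cderiv d)).
  by rewrite X; apply: cCZ; apply: ccont_cC0; exact: ccont_etw.
by rewrite Y; apply: cCZ; apply: cCZ; apply: ccont_cC0; exact: ccont_etw.
Qed.

Lemma entM g h : ent g -> ent h -> ent (fun p => g p * h p).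
Proof.
move=> [g1 gY] [h1 hY]; have dg := cC_cderiv g1; have dh := cC_cderiv h1.
have d := partialsM dg dh; have [X Y] := partials_uniq d.
have cg := cC_cont g1; have ch := cC_cont h1.
have cgX := cC_cont (cC_CX g1); have chX := cC_cont (cC_CX h1).
have cX : ccont (CX (fun p => g p * h p)) by rewrite X; apply: ccontD; exact: ccontM.
have YX : CY (fun p => g p * h p) = fun p => iC R * CX (fun p => g p * h p) p.
  by rewrite Y X; apply/funext => p; rewrite gY hY; ring.
split; last by move=> p; rewrite YX.
apply: (cC_recS (ccontM cg ch) (partials_cderiv d) (ccont_cC0 cX)).
by rewrite YX; apply: cCZ; exact: ccont_cC0.
Qed.

Definition fockDa a F p : C := del F p + (- (2 * pi))%:C * ((conjz p - conjz a) * F p).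

Lemma fockDaE a F : fockDa a F = fun p => del F p +
  ((- (2 * pi))%:C * (conjz p * F p) + ((2 * pi)%:C * conjz a) * F p).
Proof. by apply/funext => p; rewrite /fockDa rmorphN; ring. Qed.

Lemma nice_fockDa a F : nice F -> nice (fockDa a F).
Proof.
move=> nF; rewrite fockDaE; apply: niceD; first exact: nice_del.
by apply: niceD; [apply: niceZ; exact: nice_conjz|exact: niceZ].
Qed.

Lemma nice_iter_fockDa a j F : nice F -> nice (iter j (fockDa a) F).
Proof. by move=> nF; elim: j => //= j; exact: nice_fockDa. Qed.

(** del annihilates conj(z) - conj(a), so multiplication by it commutes with del. *)
Lemma del_fockDa a F : nice F -> del (fockDa a F) = fockDa a (del F).
Proof.
move=> nF; have dF := nice_cderiv nF; have nc := nice_conjz nF.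
rewrite !fockDaE (delD (nice_cderiv (nice_del nF)) (nice_cderiv (niceD (niceZ _ nc) (niceZ _ nF)))).
rewrite (delD (nice_cderiv (niceZ _ nc)) (nice_cderiv (niceZ _ nF))).
by rewrite (delZ _ (nice_cderiv nc)) (delZ _ dF) (del_conjzM dF).
Qed.

Lemma del_iter_fockDa a j F : nice F -> del (iter j (fockDa a) F) = iter j (fockDa a) (del F).
Proof.
move=> nF; elim: j => //= j IH.
by rewrite (del_fockDa a (nice_iter_fockDa a j nF)) IH.
Qed.

(** By the product rule, del applied to the exponential supplies exactly the term that replaces
    conj(z) by conj(z) - conj(a). *)
Lemma fockD_etw a j h : ent h ->
  (fun p => iter j (@fockD R) h p * etw a p) = iter j (fockDa a) (fun p => h p * etw a p).
Proof.
move=> eh; elim: j => //= j <-.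
have nF := nice_iter_fockD j (nice_ent eh); have eE := ent_etw a.
rewrite /fockDa (delM (nice_cderiv nF) (nice_cderiv (nice_ent eE))) (del_ent eE).
have [-> _] := partials_uniq (partials_etw a).
by apply/funext => p; rewrite /fockD /ctw; ring.
Qed.

(** Associated Laguerre polynomials up to scaling: [lagp j m] at x equals 2 pi j! / (j + m)! times
    L_j^(m) (2 pi x). *)
Fixpoint lagp (j m : nat) : {poly R} :=
  if j is j'.+1 then lagp j' m + (- (2 * pi)) *: ('X * lagp j' m.+1)
  else (2 * pi / m`!%:R)%:P.

(** The two terms of the recursion differ in degree, so nothing cancels. The exact degree is what
    the elimination rests on. *)
Lemma size_lagp j m : size (lagp j m) = j.+1.
Proof.
have p0 := pi2_gt0 R.
elim: j m => [|j IH] m /=.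
  by rewrite size_polyC mulf_neq0// ?gt_eqF// invr_gt0 ltr0n fact_gt0.
have s : size (- (2 * pi) *: ('X * lagp j m.+1)) = j.+2.
  rewrite size_scale ?oppr_eq0 ?gt_eqF// mulrC size_mulX ?IH//.
  by rewrite -size_poly_eq0 IH.
by rewrite addrC size_polyDl ?s// IH.
Qed.

Lemma cmeanD m F G a r : ccont F -> ccont G ->
  cmean m (fun p => F p + G p) a r = cmean m F a r + cmean m G a r.
Proof.
move=> cF cG; rewrite /cmean -cintD; [|exact: ccont_circM|exact: ccont_circM].
by congr cint; apply/funext => t; rewrite mulrDl.
Qed.

Lemma cmeanZ m (c : C) F a r : ccont F ->
  cmean m (fun p => c * F p) a r = c * cmean m F a r.
Proof.
move=> cF; rewrite /cmean -cintZ; last exact: ccont_circM.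
by congr cint; apply/funext => t; rewrite mulrA.
Qed.

(** On the circle conj(z) - conj(a) is r e^(-it), which raises the frequency by one. *)
Lemma cmean_conjz m F a r : ccont F ->
  cmean m (fun p => (conjz p - conjz a) * F p) a r = r%:C * cmean m.+1 F a r.
Proof.
move=> cF; rewrite /cmean -cintZ; last exact: ccont_circM.
congr cint; apply/funext => t; rewrite -(eit_emit m t).
have -> : conjz (circ a r t) - conjz a = r%:C * (cos t -i* sin t).
  by apply: complexP; rewrite !ReIm /=; ring.
have u : (cos t -i* sin t) * eit t = 1.
  by apply: complexP; rewrite !ReIm /=; have := cos2Dsin2 t; rewrite !expr2; lra.
rewrite (_ : _ * _ = r%:C * (((cos t -i* sin t) * eit t) * (F (circ a r t) * emit m.+1 t)));
  last by ring.
by rewrite u mul1r.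
Qed.

(** The induction needs all frequencies at once: the del part of the operator differentiates [h],
    the other part passes from m to m + 1 with an extra factor r. Since r r^(m+1) = r^2 r^m, the
    polynomial is evaluated at r^2. *)
Lemma cmean_fockDa a r j m h : ent h ->
  cmean m (iter j (fockDa a) h) a r =
  ((lagp j m).[r ^+ 2])%:C * r%:C ^+ m * iter (j + m) (@CX R) h a.
Proof.
elim: j m h => [|j IH] m h eh.
  rewrite cmean_ent//= hornerC add0n.
  have -> : (2 * pi / m`!%:R)%:C =
    (2 * pi)%:C * (m`!%:R)^-1 :> C by rewrite rmorphM fmorphV rmorph_nat.
  by [].
have nF := nice_iter_fockDa a j (nice_ent eh).
have cdF := nice_cont (nice_del nF); have cF := nice_cont nF.
have ccF : ccont (fun p => (conjz p - conjz a) * iter j (fockDa a) h p).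
  by apply: ccontM => //; apply: ccontD; [exact: ccont_conjz|exact: ccont_cst].
rewrite iterS /fockDa cmeanD; [|exact: cdF|by apply: ccontM => //; exact: ccont_cst].
rewrite (cmeanZ _ _ _ _ ccF) (cmean_conjz _ _ _ cF).
rewrite (del_iter_fockDa a j (nice_ent eh)) (del_ent eh) (IH _ _ (ent_CX eh)) (IH _ _ eh).
rewrite -iterSr addnS /= hornerD hornerZ hornerM hornerX.
rewrite rmorphD (rmorphM _ (- _)) (rmorphM _ (r ^+ 2)) rmorphXn /= [r%:C ^+ m.+1]exprS.
set L := (lagp j m).[_]; set L' := (lagp j m.+1).[_]; rewrite expr2.
by ring.
Qed.

(** The factor conj(z) - conj(a) vanishes at the center; hence the derivative found in the mean is a
    value of the iterated operator itself. *)
Lemma iter_fockDa_center a j h : ent h -> iter j (fockDa a) h a = iter j (@CX R) h a.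
Proof.
elim: j h => [//|j IH] h eh.
rewrite iterS /fockDa subrr mul0r mulr0 addr0 (del_iter_fockDa a j (nice_ent eh)).
by rewrite (del_ent eh) (IH _ (ent_CX eh)) -iterSr.
Qed.

Definition tmean F r a : C := cmean 0 (fun p => F p * etw a p) a r.

(** D^j h is an eigenfunction of the twisted mean, with an eigenvalue that depends on j and r
    only. *)
Lemma tmean_iter_fockD j h r a : ent h ->
  tmean (iter j (@fockD R) h) r a = ((lagp j 0).[r ^+ 2])%:C * iter j (@fockD R) h a.
Proof.
move=> eh; have eE := entM eh (ent_etw a).
rewrite /tmean (fockD_etw a j eh) (cmean_fockDa a r j 0 eE) expr0 mulr1 addn0.
by rewrite -(iter_fockDa_center a j eE) -(fockD_etw a j eh) etw_center mulr1.
Qed.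

Lemma tmean_sum n (G : nat -> P -> C) r a : (forall j, nice (G j)) ->
  tmean (fun p => \sum_(j < n) G j p) r a = \sum_(j < n) tmean (G j) r a.
Proof.
move=> nG; elim: n => [|n IH].
  rewrite big_ord0 /tmean /cmean (_ : (fun t => _) = fun=> 0) ?cint_cst ?mulr0//.
  by apply/funext => t; rewrite big_ord0 !mul0r.
rewrite big_ord_recr /= -IH /tmean -cmeanD.
- by congr (cmean 0 _ a r); apply/funext => p; rewrite big_ord_recr /= mulrDl.
- by apply: ccontM; [exact: nice_cont (nice_sum n nG)|exact: ccont_etw].
- by apply: ccontM; [exact: nice_cont (nG n)|exact: ccont_etw].
Qed.

(** With |z - a| = r, the exponents satisfy -4 pi Re(conj(a) (z - a)) - 2 pi |a|^2 = 2 pi r^2 - 2 pi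
    |z|^2. The twist thus moves the weight from the center to the circle. *)
Lemma etw_gw a r t :
  (complex.Re (etw a (circ a r t)) ^+ 2 + complex.Im (etw a (circ a r t)) ^+ 2) * gw a =
  expR (2 * pi * r ^+ 2) * gw (circ a r t).
Proof.
have -> : complex.Re (etw a (circ a r t)) ^+ 2 + complex.Im (etw a (circ a r t)) ^+ 2 =
    expR (- (2 * pi) * (a.1 * (r * cos t) + a.2 * (r * sin t))) ^+ 2.
  rewrite /etw !ReIm /=.
  have -> : a.1 + r * cos t - a.1 = r * cos t by ring.
  have -> : a.2 + r * sin t - a.2 = r * sin t by ring.
  set e := expR _; set s := - (2 * pi) * (_ - _).
  rewrite !mul0r subr0 addr0 !exprMn -mulrDr cos2Dsin2 mulr1//.
rewrite -expRM_natl /gw -!expRD; congr expR; rewrite /circ /=.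
have := cos2Dsin2 t; set c := cos t; set s := sin t; move=> cs.
have -> : 2 * pi * r ^+ 2 = 2 * pi * r ^+ 2 * (c ^+ 2 + s ^+ 2) by rewrite cs mulr1.
by ring.
Qed.

Definition cL2 F : Prop := L2 (reF F) /\ L2 (imF F).

Lemma cL2D F G : cL2 F -> cL2 G -> cL2 (fun p => F p + G p).
Proof. by move=> [a b] [c d]; rewrite /cL2 reFD imFD; split; exact: L2D. Qed.

Lemma cL2Z (k : R) F : cL2 F -> cL2 (fun p => k%:C * F p).
Proof.
move=> [a b]; have A := L2Z k a; have B := L2Z k b.
rewrite /cL2 (_ : reF _ = fun p => k * reF F p); last first.
  by apply/funext => p; rewrite /reF ReM /= mul0r subr0.
by rewrite (_ : imF _ = fun p => k * imF F p)//; apply/funext => p; rewrite /imF ImM /= mul0r addr0.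
Qed.

Lemma tmean_L2 F r : ccont F -> cL2 F -> ccont (tmean F r) -> cL2 (tmean F r).
Proof.
move=> cF [[mre ire] [mim iim]] [cre cim].
pose W p := (reF F p ^+ 2 + imF F p ^+ 2) * gw p.
have [cF1 cF2] := cF.
have cW : continuous W.
  move=> p; apply: cvgM; last exact: gw_cont.
  by apply: cvgD; (under eq_fun do rewrite expr2); rewrite expr2; apply: cvgM;
    (exact: cF1 || exact: cF2).
have W0 p : 0 <= W p by rewrite mulr_ge0 ?addr_ge0 ?sqr_ge0// ltW// gw_gt0.
have iW : (\int[(@lebesgue_measure R \x @lebesgue_measure R)%E]_p (W p)%:E < +oo)%E.
  have -> : (\int[(@lebesgue_measure R \x @lebesgue_measure R)%E]_p (W p)%:E =
      \int[(@lebesgue_measure R \x @lebesgue_measure R)%E]_p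
        ((reF F p ^+ 2 * gw p)%:E + (imF F p ^+ 2 * gw p)%:E))%E.
    by apply: eq_integral => p _; rewrite -EFinD -mulrDl.
  rewrite ge0_integralD//; first exact: lte_add_pinfty.
  - by move=> p _; rewrite lee_fin sqr_gw_ge0.
  - exact: measurable_sqr_gw.
  - by move=> p _; rewrite lee_fin sqr_gw_ge0.
  - exact: measurable_sqr_gw.
have [mC iC'] := circle_tonelli r cW W0 iW.
(* The factor 2 pi comes from Cauchy-Schwarz over the period, the exponential from [etw_gw]. *)
pose K := 2 * pi * expR (2 * pi * r ^+ 2).
have K0 : 0 <= K by rewrite mulr_ge0 ?expR_ge0 ?ltW ?pi2_gt0.
have bound a (f : R -> R) : continuous f ->
    (forall t, f t ^+ 2 <= (reF F (circ a r t) ^+ 2 + imF F (circ a r t) ^+ 2) *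
      (complex.Re (etw a (circ a r t)) ^+ 2 + complex.Im (etw a (circ a r t)) ^+ 2)) ->
    pint f ^+ 2 * gw a <= K * pint (fun t => W (circ a r t)).
  move=> cf fb.
  have cWc : continuous (fun t => W (circ a r t)).
    by move=> t; apply: (@continuous_comp _ _ _ (circ a r) W); [exact: circ_cont|exact: cW].
  apply: (@le_trans _ _ (2 * pi * pint (fun t => f t ^+ 2) * gw a)).
    by rewrite ler_pM2r ?gw_gt0// sqr_pint_le.
  rewrite /K -[leLHS]mulrA -[leRHS]mulrA ler_pM2l ?pi2_gt0// [leLHS]mulrC.
  have cf2 : continuous (fun t => f t ^+ 2).
    by move=> t; under eq_fun do rewrite expr2; apply: cvgM; exact: cf.
  rewrite -(pintZ (gw a) cf2) -(pintZ _ cWc); apply: le_pint => [t|t|t].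
  - by apply: cvgM; [exact: cvg_cst|exact: cf2].
  - by apply: cvgM; [exact: cvg_cst|exact: cWc].
  - rewrite /W [leRHS]mulrCA -(etw_gw a r t) [leRHS]mulrA [leLHS]mulrC ler_pM2r ?gw_gt0//.
have cc a : ccont (fun t => F (circ a r t) * etw a (circ a r t) * emit 0 t).
  exact: (@ccont_circM R 0 (fun p => F p * etw a p) a r (ccontM cF (ccont_etw a))).
(* The real part of a product is bounded by the product of the moduli; the gap is the square of the
   imaginary part. *)
have sqb (x y z w : R) : (x * z - y * w) ^+ 2 <= (x ^+ 2 + y ^+ 2) * (z ^+ 2 + w ^+ 2).
  by have := sqr_ge0 (x * w + y * z); rewrite -subr_ge0 => h;
    rewrite -subr_ge0 (_ : _ - _ = (x * w + y * z) ^+ 2 - 0)//; ring.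
have sqb' (x y z w : R) : (x * w + y * z) ^+ 2 <= (x ^+ 2 + y ^+ 2) * (z ^+ 2 + w ^+ 2).
  by have := sqr_ge0 (x * z - y * w); rewrite -subr_ge0 => h;
    rewrite -subr_ge0 (_ : _ - _ = (x * z - y * w) ^+ 2 - 0)//; ring.
split.
- apply: (@L2_bound R _ (fun a => K%:E * (pint (fun t => W (circ a r t)))%:E)%E).
  + exact: continuous_measurable2.
  + exact: measurable_funeM.
  + move=> a; rewrite -EFinM lee_fin; apply: bound; first by have [] := cc a.
    by move=> t; rewrite emit0 mulr1 ReM; exact: sqb.
  + rewrite ge0_integralZl//; first exact: lte_mul_pinfty.
    by move=> a _; rewrite lee_fin; apply: Rintegral_ge0.
- apply: (@L2_bound R _ (fun a => K%:E * (pint (fun t => W (circ a r t)))%:E)%E).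
  + exact: continuous_measurable2.
  + exact: measurable_funeM.
  + move=> a; rewrite -EFinM lee_fin; apply: bound; first by have [] := cc a.
    by move=> t; rewrite emit0 mulr1 ImM; exact: sqb'.
  + rewrite ge0_integralZl//; first exact: lte_mul_pinfty.
    by move=> a _; rewrite lee_fin; apply: Rintegral_ge0.
Qed.

Lemma comp_L2 n (H : nat -> P -> C) : (forall j, ent (H j)) ->
  cL2 (fun p => \sum_(j < n) iter j (@fockD R) (H j) p) ->
  forall j, (j < n)%N -> cL2 (iter j (@fockD R) (H j)).
Proof.
move=> eH L; have nG j := nice_iter_fockD j (nice_ent (eH j)).
apply: (poly_triangular_subspace cL2D cL2Z (q := fun j => lagp j 0)).
  by move=> j; exact: size_lagp.
move=> t t0.
(* The radius is the square root of t, so that the eigenvalues become polynomials in t. *)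
have E : tmean (fun p => \sum_(j < n) iter j (@fockD R) (H j) p) (Num.sqrt t) =
    fun p => \sum_(j < n) ((lagp j 0).[t])%:C * iter j (@fockD R) (H j) p.
  apply/funext => p; rewrite (tmean_sum n (Num.sqrt t) p nG); apply: eq_bigr => j _.
  by rewrite tmean_iter_fockD// sqr_sqrtr// ltW.
rewrite -E; apply: tmean_L2 => //; first exact: nice_cont (nice_sum n nG).
rewrite E; apply: nice_cont;
  apply: (nice_sum n (G := fun j p => ((lagp j 0).[t])%:C * iter j (@fockD R) (H j) p)).
by move=> j; exact: niceZ.
Qed.

End TwistedMeans.

(** * Stem functions *)

Section StemFunctions.
Variable R : realType.
Notation C := R[i].
Notation P := (R * R)%type.
Notation H4 := (quat R).
Implicit Types (p : P) (J q : H4) (F G : 'I_4 -> P -> C).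

Definition qe (d : 'I_4) : H4 := delta_mx ord0 d.

Lemma quat_sum q : q = \sum_d q ord0 d *: qe d.
Proof. exact: row_sum_delta. Qed.

Lemma quat_coordP (q q' : H4) : (forall c, q ord0 c = q' ord0 c) -> q = q'.
Proof. by move=> h; apply/rowP. Qed.

Lemma quat_coordD (q q' : H4) c : (q + q') ord0 c = q ord0 c + q' ord0 c.
Proof. by rewrite mxE. Qed.

Lemma quat_coordZ k (q : H4) c : (k *: q) ord0 c = k * q ord0 c.
Proof. by rewrite mxE. Qed.

Lemma quat_coord_sum (I : Type) (r : seq I) (f : I -> H4) c :
  (\sum_(i <- r) f i) ord0 c = \sum_(i <- r) f i ord0 c.
Proof.
elim: r => [|i r IH]; first by rewrite !big_nil mxE.
by rewrite !big_cons quat_coordD IH.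
Qed.

Lemma coord_mull J q c : (J * q) ord0 c = \sum_d (J * qe d) ord0 c * q ord0 d.
Proof.
rewrite {1}(quat_sum q) mulr_sumr quat_coord_sum; apply: eq_bigr => d _.
by rewrite -scalerAr quat_coordZ mulrC.
Qed.

Lemma coord_mulr J q c : (q * J) ord0 c = \sum_d (qe d * J) ord0 c * q ord0 d.
Proof.
rewrite {1}(quat_sum q) mulr_suml quat_coord_sum; apply: eq_bigr => d _.
by rewrite -scalerAl quat_coordZ mulrC.
Qed.

Definition reS F p : H4 := \row_c complex.Re (F c p).
Definition imS F p : H4 := \row_c complex.Im (F c p).
(** [F] takes values in the complexification of H, by coordinates. The complex scalar i becomes left
    multiplication by [J] ([stem_i]), and a right factor becomes a real matrix on the index
    ([stem_mulr]). *)
Definition stem J F p : H4 := reS F p + J * imS F p.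

Lemma reSE F p c : reS F p ord0 c = complex.Re (F c p). Proof. by rewrite mxE. Qed.
Lemma imSE F p c : imS F p ord0 c = complex.Im (F c p). Proof. by rewrite mxE. Qed.

Lemma stem_coord J F p c :
  stem J F p ord0 c = complex.Re (F c p) + \sum_d (J * qe d) ord0 c * complex.Im (F d p).
Proof.
rewrite quat_coordD reSE coord_mull; congr (_ + _).
by apply: eq_bigr => d _; rewrite imSE.
Qed.

Lemma stemD J F G p : stem J (fun c p => F c p + G c p) p = stem J F p + stem J G p.
Proof.
have -> : stem J F p + stem J G p = (reS F p + reS G p) + J * (imS F p + imS G p).
  by rewrite mulrDr /stem addrACA.
rewrite /stem; congr (_ + _ * _); apply: quat_coordP => c;
  by rewrite quat_coordD ?reSE ?imSE ReIm.
Qed.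

Lemma stemZ J (k : R) F p : stem J (fun c p => k%:C * F c p) p = k *: stem J F p.
Proof.
rewrite /stem scalerDr scalerAr; congr (_ + _ * _); apply: quat_coordP => c;
  by rewrite quat_coordZ ?reSE ?imSE ReIm /= mul0r ?subr0 ?addr0.
Qed.

Lemma imag_unitM J : imag_units J -> J * J = -1.
Proof. by rewrite /imag_units /= expr2. Qed.

Lemma stem_i J F p : imag_units J -> stem J (fun c p => iC R * F c p) p = J * stem J F p.
Proof.
move=> /imag_unitM JJ; rewrite /stem mulrDr mulrA JJ mulN1r addrC; congr (_ * _ + _).
  by apply: quat_coordP => c; rewrite reSE imSE ReIm /= mul0r mul1r add0r.
apply: quat_coordP => c; rewrite reSE ReIm /= mul0r mul1r sub0r.
by rewrite mxE imSE.
Qed.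

Lemma stem_sum J n (F : nat -> 'I_4 -> P -> C) p :
  stem J (fun c p => \sum_(j < n) F j c p) p = \sum_(j < n) stem J (F j) p.
Proof.
elim: n => [|n IH].
  rewrite big_ord0 (_ : (fun c p => _) = fun c p => (0 : R)%:C * (fun=> fun=> 0) c p).
    by rewrite stemZ scale0r.
  by apply/funext => c; apply/funext => x; rewrite big_ord0 mulr0.
rewrite big_ord_recr /= -IH -stemD; congr (stem _ _ _).
by apply/funext => c; apply/funext => x; rewrite big_ord_recr.
Qed.

Lemma stem_mulr J F p q :
  stem J (fun c p => \sum_d ((qe d * q) ord0 c)%:C * F d p) p = stem J F p * q.
Proof.
have ReS (f : 'I_4 -> C) : complex.Re (\sum_d f d) = \sum_d complex.Re (f d).
  by apply: (big_morph _ (@ReD R)).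
have ImS (f : 'I_4 -> C) : complex.Im (\sum_d f d) = \sum_d complex.Im (f d).
  by apply: (big_morph _ (@ImD R)).
rewrite /stem mulrDl -mulrA; congr (_ + _ * _); apply: quat_coordP => c.
  rewrite reSE ReS coord_mulr; apply: eq_bigr => d _.
  by rewrite reSE ReIm /= mul0r subr0.
rewrite imSE ImS coord_mulr; apply: eq_bigr => d _.
by rewrite imSE ReIm /= mul0r addr0.
Qed.

Lemma imag_unitN J : imag_units J -> imag_units (- J).
Proof. by rewrite /imag_units /= sqrrN. Qed.

(** The units J and -J give a + J b and a - J b: their sum isolates a, and J is invertible. *)
Lemma stem_inj J F p : imag_units J -> stem J F p = 0 -> stem (- J) F p = 0 ->
  forall c, F c p = 0.
Proof.
move=> uJ s1 s2.
have re0 : reS F p = 0.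
  have : 2%:R *: reS F p = 0.
    have -> : 2%:R *: reS F p = stem J F p + stem (- J) F p.
      by rewrite /stem mulNr addrACA subrr addr0 scaler_nat mulr2n.
    by rewrite s1 s2 addr0.
  by move/eqP; rewrite scaler_eq0 pnatr_eq0 /= => /eqP.
have im0 : imS F p = 0.
  move: s1; rewrite /stem re0 add0r => /(congr1 (fun x => J * x)).
  by rewrite mulrA (imag_unitM uJ) mulN1r mulr0 => /eqP; rewrite oppr_eq0 => /eqP.
move=> c; apply: complexP; first by rewrite -reSE re0 mxE.
by rewrite -imSE im0 mxE.
Qed.

Lemma stem_is_derive J F Fx Fy p : (forall c, partials (F c) (Fx c) (Fy c)) ->
  is_derive p (xdir R) (stem J F) (stem J Fx p) /\
  is_derive p (ydir R) (stem J F) (stem J Fy p).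
Proof.
move=> dF.
have mxd (v : P) (f : P -> H4) (l : H4) :
    (forall c, is_derive p v (fun x => f x ord0 c) (l ord0 c)) -> is_derive p v f l.
  move=> d.
  have df : derivable (f : P -> 'rV[R]_4) p v.
    by apply/derivable_mxP => i j; rewrite ord1; apply: ex_derive.
  constructor; first exact: df.
  apply: quat_coordP => c; have := derive_mx df => ->.
  by rewrite mxE; apply: derive_val.
have sumd (v : P) (k : 'I_4 -> R) (u : 'I_4 -> P -> R) (u' : 'I_4 -> R) (w : P -> R) (w' : R) :
    is_derive p v w w' -> (forall d, is_derive p v (u d) (u' d)) ->
    is_derive p v (fun x => w x + \sum_d k d * u d x) (w' + \sum_d k d * u' d).
  move=> dw du.
  have ds : is_derive p v (\sum_d (fun x => k d *: u d x)) (\sum_d k d *: u' d).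
    by apply: is_derive_sum => d; exact: is_deriveZ.
  have := is_deriveD dw ds; congr is_derive.
  by apply/funext => x /=; rewrite !fctE fct_sumE.
split; apply: mxd => c; rewrite stem_coord.
  rewrite (_ : (fun x => _) = fun x => reF (F c) x + \sum_d (J * qe d) ord0 c * imF (F d) x).
    apply: sumd; first by have [] := dF c p.
    by move=> d; have [] := dF d p.
  by apply/funext => x; rewrite stem_coord.
rewrite (_ : (fun x => _) = fun x => reF (F c) x + \sum_d (J * qe d) ord0 c * imF (F d) x).
  apply: sumd; first by have [] := dF c p.
  by move=> d; have [] := dF d p.
by apply/funext => x; rewrite stem_coord.
Qed.

Lemma cauchy_riemann_stem J F : imag_units J -> (forall c, cderiv (F c)) ->
  cauchy_riemann J (stem J F) = stem J (fun c p => 2%:C * dbar (F c) p).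
Proof.
move=> uJ dF; apply/funext => p.
have [[_ X] [_ Y]] := stem_is_derive J p dF.
rewrite /cauchy_riemann /pdx /pdy -/(xdir R) -/(ydir R) X Y -stem_i// -stemD.
congr (stem _ _ _); apply/funext => c; apply/funext => x.
by rewrite /dbar (_ : (2 : R)%:C = 2) ?rmorph_nat// mulrA mulfV ?mul1r// pnatr_eq0.
Qed.

Lemma slice_d_stem J F : imag_units J -> (forall c, cderiv (F c)) ->
  slice_d J (stem J F) = stem J (fun c => del (F c)).
Proof.
move=> uJ dF; apply/funext => p.
have [[_ X] [_ Y]] := stem_is_derive J p dF.
rewrite /slice_d /pdx /pdy -/(xdir R) -/(ydir R) X Y -stem_i// -scaleN1r -stemZ -stemD -stemZ.
congr (stem _ _ _); apply/funext => c; apply/funext => x.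
by rewrite /del rmorphN1 mulN1r fmorphV rmorph_nat.
Qed.

Lemma iter_cauchy_riemann_stem J F m : imag_units J -> (forall c, cC m (F c)) ->
  iter m (cauchy_riemann J) (stem J F) =
  stem J (fun c p => (2 ^+ m)%:C * iter m (@dbar R) (F c) p).
Proof.
move=> uJ; elim: m F => [|m IH] F cF.
  by congr (stem _); apply/funext => c; apply/funext => p; rewrite expr0 mul1r.
rewrite iterSr cauchy_riemann_stem => [|//|c]; last exact: cC_cderiv (cF c).
rewrite IH => [|c]; last by apply: cCZ; apply: cC_dbar; exact: cF.
congr (stem _); apply/funext => c.
rewrite (iter_dbarZ _ (cC_dbar (cF c))) -iterSr; apply/funext => p.
by rewrite mulrA -rmorphM exprSr.
Qed.

(** The successive derivatives are supplied as a sequence, so that the weight can stay inside: here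
    the k-th term will be the weight times D^k h. *)
Lemma iter_slice_d_stem J (F : nat -> 'I_4 -> P -> C) m : imag_units J ->
  (forall j c, cderiv (F j c)) -> (forall j c, del (F j c) = F j.+1 c) ->
  iter m (slice_d J) (stem J (F 0%N)) = stem J (F m).
Proof.
move=> uJ dF dFE; elim: m => [//|m IH]; rewrite iterS IH slice_d_stem//.
by congr (stem _); apply/funext => c; rewrite dFE.
Qed.

Lemma continuous_coord (f : P -> H4) :
  continuous f <-> forall c, continuous (fun p => f p ord0 c).
Proof.
split=> [cf c p|cf p].
  exact: (@continuous_comp _ _ _ f (fun q : H4 =>
    q ord0 c) p (cf p) (@coord_continuous R 1 4 ord0 c _)).
apply/cvgrPdist_le => e e0; near=> x.
rewrite [leLHS]/Num.Def.normr/= mx_normrE (bigmax_le _ (ltW e0))//= => -[i j] _.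
rewrite !mxE /= ord1; move: j; near: x; apply: filter_forall => j.
by have /cvgrPdist_le/(_ _ e0) := cf j p.
Unshelve. all: end_near. Qed.

Lemma class_C_coord m (f : P -> H4) :
  class_C m f <-> forall c, Cr m (fun p => f p ord0 c).
Proof.
elim: m f => [|m IH] f.
  by split=> [[/continuous_coord cf _] c|cf]; split=> //; apply/continuous_coord => c;
    have [] := cf c.
have E (v : P) : (forall p, derivable f p v) ->
    (fun c p => 'D_v f p ord0 c) = fun c p => 'D_v (fun p => f p ord0 c) p.
  move=> d; apply/funext => c; apply/funext => p.
  by have := derive_mx (d p : derivable (f : P -> 'rV[R]_4) p v) => ->; rewrite mxE.
split.
  move=> [/continuous_coord cf [dx dy /IH cx /IH cy]] c; split; first exact: cf.
  have Ex := congr1 (fun g => g c) (E _ dx); have Ey := congr1 (fun g => g c) (E _ dy).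
  have dmx p v : derivable f p v -> derivable (fun p => f p ord0 c) p v.
    by move=> d; have /derivable_mxP := (d : derivable (f : P -> 'rV[R]_4) p v); exact.
  split; [by move=> p; apply: dmx|by move=> p; apply: dmx| |].
    by rewrite -Ex; exact: cx.
  by rewrite -Ey; exact: cy.
move=> cf.
have dx p : derivable f p (xdir R).
  by apply/(@derivable_mxP R P 1 4 f) => i j; rewrite ord1; have [_ [d _ _ _]] := cf j; exact: d.
have dy p : derivable f p (ydir R).
  by apply/(@derivable_mxP R P 1 4 f) => i j; rewrite ord1; have [_ [_ d _ _]] := cf j; exact: d.
split; first by apply/continuous_coord => c; have [] := cf c.
split; [exact: dx|exact: dy|apply/IH => c|apply/IH => c].
  by have [_ [_ _ H _]] := cf c; have Ex := congr1 (fun g => g c) (E _ dx); rewrite Ex; exact: H.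
by have [_ [_ _ _ H]] := cf c; have Ey := congr1 (fun g => g c) (E _ dy); rewrite Ey; exact: H.
Qed.

End StemFunctions.

(** * Slice functions as stem functions *)

Section SliceRepresentation.
Variable R : realType.
Notation C := R[i].
Notation P := (R * R)%type.
Notation H4 := (quat R).
Implicit Types (p : P) (I J q : H4) (F G : 'I_4 -> P -> C) (f : H4 -> H4).

Lemma qre1 : qre (1 : H4) = 1. Proof. exact: qre_mk. Qed.
Lemma qi1 : qi (1 : H4) = 0. Proof. exact: qi_mk. Qed.
Lemma qj1 : qj (1 : H4) = 0. Proof. exact: qj_mk. Qed.
Lemma qk1 : qk (1 : H4) = 0. Proof. exact: qk_mk. Qed.

Lemma imag_unitsP J : imag_units J <->
  qre J = 0 /\ qi J ^+ 2 + qj J ^+ 2 + qk J ^+ 2 = 1.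
Proof.
rewrite /imag_units /= expr2.
have M : J * J = mkquat (qre J * qre J - qi J * qi J - qj J * qj J - qk J * qk J)
  (qre J * qi J + qi J * qre J + qj J * qk J - qk J * qj J)
  (qre J * qj J - qi J * qk J + qj J * qre J + qk J * qi J)
  (qre J * qk J + qi J * qj J - qj J * qi J + qk J * qre J) by [].
have N : (-1 : H4) = mkquat (-1) 0 0 0.
  apply: quatP; rewrite !q_mk -scaleN1r !(qreZ, qiZ, qjZ, qkZ) qre1 qi1 qj1 qk1.
  by split; ring.
split; last first.
  move=> [r0 n1]; rewrite M N r0; apply: quatP; rewrite !q_mk; split; try by ring.
  by rewrite -n1; ring.
rewrite M N => E.
have e0 := congr1 (@qre R) E; have e1 := congr1 (@qi R) E.
have e2 := congr1 (@qj R) E; have e3 := congr1 (@qk R) E.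
move: e0 e1 e2 e3; rewrite !q_mk; set a := qre J; set b := qi J; set c := qj J; set d := qk J.
move=> e0 e1 e2 e3; suff a0 : a = 0 by split=> //; move: e0; rewrite a0; nra.
(* A nonzero real part would force b = c = d = 0 through the imaginary coordinates, and then a^2 =
   -1. *)
have [//|an] := eqVneq a 0.
have z x : a * x + x * a = 0 -> x = 0.
  move=> h; have : a * x = 0 by lra.
  by move/eqP; rewrite mulf_eq0 (negPf an) => /eqP.
have b0 : b = 0 by apply: z; lra.
have c0 : c = 0 by apply: z; lra.
have d0 : d = 0 by apply: z; lra.
by move: e0; rewrite b0 c0 d0; nra.
Qed.

Lemma qabs_slice_pt J p : imag_units J -> qabs (slice_pt J p) ^+ 2 = p.1 ^+ 2 + p.2 ^+ 2.
Proof.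
move=> /imag_unitsP[r0 n1]; rewrite /qabs sqr_sqrtr ?addr_ge0 ?sqr_ge0//.
rewrite /slice_pt !q_D !q_Z qre1 qi1 qj1 qk1 r0 !mulr0 mulr1 !add0r addr0 !exprMn.
by rewrite -[p.2 ^+ 2]mulr1 -[in RHS]n1; ring.
Qed.

Lemma gauss_slice_pt J p : imag_units J -> gauss (slice_pt J p) = gw p.
Proof. by move=> uJ; rewrite /gauss qabs_slice_pt. Qed.

Definition imv q : H4 := mkquat 0 (qi q) (qj q) (qk q).
Definition imr q : R := Num.sqrt (qi q ^+ 2 + qj q ^+ 2 + qk q ^+ 2).

Lemma quat_imv q : q = (qre q)%:A + imv q.
Proof.
apply: quatP; rewrite !q_D !q_Z !q_mk; split; by ring.
Qed.

Lemma imr_eq0 q : imr q = 0 -> imv q = 0.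
Proof.
move=> /eqP; rewrite sqrtr_eq0 => h.
have [b c d] : [/\ qi q ^+ 2 = 0, qj q ^+ 2 = 0 & qk q ^+ 2 = 0].
  by have := sqr_ge0 (qi q); have := sqr_ge0 (qj q); have := sqr_ge0 (qk q); split; lra.
have z x : x ^+ 2 = 0 -> x = 0 :> R by move=> /eqP; rewrite sqrf_eq0 => /eqP.
apply: quatP; rewrite !q_mk (z _ b) (z _ c) (z _ d) -[0 : H4](scale0r 0) !(qreZ, qiZ, qjZ, qkZ).
by rewrite !mul0r.
Qed.

Lemma slice_pt_surj I q : imag_units I ->
  exists J p, [/\ imag_units J, q = slice_pt J p & p = (qre q, imr q)].
Proof.
move=> uI; have [r0|r0] := eqVneq (imr q) 0.
  (* A real point lies on every slice; the given unit is chosen. *)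
  exists I, (qre q, imr q); split=> //.
  by rewrite {1}(quat_imv q) (imr_eq0 r0) /slice_pt /= r0 scale0r.
exists ((imr q)^-1 *: imv q), (qre q, imr q); split=> //.
  apply/imag_unitsP; rewrite !q_Z !q_mk mulr0; split=> //.
  rewrite !exprMn -!mulrDr.
  have -> : qi q ^+ 2 + qj q ^+ 2 + qk q ^+ 2 = imr q ^+ 2.
    by rewrite sqr_sqrtr ?addr_ge0 ?sqr_ge0//.
  by rewrite -exprMn mulVf// expr1n.
by rewrite /slice_pt /= scalerA mulfV// scale1r -quat_imv.
Qed.

Lemma slice_ext I f g : imag_units I ->
  (forall J p, imag_units J -> f (slice_pt J p) = g (slice_pt J p)) -> f = g.
Proof.
move=> uI fg; apply/funext => q.
by have [J [p [uJ -> _]]] := slice_pt_surj q uI; exact: fg.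
Qed.

(** At a real point the inverse of 0 is 0, so the formula has no unit there and returns the real
    component alone. *)
Definition of_stem F q : H4 := stem ((imr q)^-1 *: imv q) F (qre q, imr q).

(** The normalized unit is J or -J according to the sign of y; [csym] makes both readings agree. *)
Lemma of_stemE F J p : (forall c, csym (F c)) -> imag_units J ->
  of_stem F (slice_pt J p) = stem J F p.
Proof.
move=> sF uJ; have /imag_unitsP[r0 n1] := uJ.
have re : qre (slice_pt J p) = p.1.
  by rewrite /slice_pt q_D !q_Z qre1 r0 mulr0 mulr1 addr0.
have im : imv (slice_pt J p) = p.2 *: J.
  by apply: quatP; rewrite /slice_pt !q_mk !q_D !q_Z !q_mk r0 !mulr0 ?add0r; split;
    rewrite ?add0r ?mulr0 ?add0r.
have ir : imr (slice_pt J p) = `|p.2|.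
  rewrite /imr /slice_pt !q_D !q_Z qi1 qj1 qk1 !mulr0 !add0r !exprMn -!mulrDr n1 mulr1.
  exact: sqrtr_sqr.
rewrite /of_stem re im ir.
have s0 c : complex.Im (F c (p.1, 0)) = 0.
  by have := sF c (p.1, 0); rewrite /= oppr0; case: (F c _) => x y [] /=; lra.
have [y0|y0|y0] := ltgtP p.2 0.
- rewrite ltr0_norm// scalerA invrN mulNr mulVf ?lt_eqF// scaleN1r.
  have sR : reS F (p.1, - p.2) = reS F p.
    by apply: quat_coordP => c; rewrite !reSE sF; case: (F c p).
  have sI : imS F (p.1, - p.2) = - imS F p.
    by apply: quat_coordP => c; rewrite [RHS]mxE !imSE sF; case: (F c p).
  by rewrite /stem sR sI mulrNN.
- rewrite gtr0_norm// scalerA mulVf ?gt_eqF// scale1r.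
  by rewrite /stem -surjective_pairing.
(* On the real axis an odd component vanishes, so the value there does not depend on the unit. *)
- have i0 : imS F (p.1, 0) = 0 by apply: quat_coordP => c; rewrite imSE s0 mxE.
  have -> : p = (p.1, 0) by rewrite -y0 -surjective_pairing.
  by rewrite /= normr0 /stem i0 !mulr0.
Qed.

Lemma slice_polyanalyticP I m f : imag_units I -> slice_polyanalytic m f <->
  exists F, [/\ forall J p, imag_units J -> f (slice_pt J p) = stem J F p,
    forall c, csym (F c), forall c, cC m (F c) &
    forall c, iter m (@dbar R) (F c) = fun=> 0].
Proof.
move=> uI; split.
  move=> [[a [b [[fE aE bE] /class_C_coord ca /class_C_coord cb]]] f0].
  pose F c p : C := a p ord0 c +i* b p ord0 c.
  have rF : reS F = a by apply/funext => p; apply: quat_coordP => c; rewrite reSE.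
  have iF : imS F = b by apply/funext => p; apply: quat_coordP => c; rewrite imSE.
  have fS J p : imag_units J -> f (slice_pt J p) = stem J F p.
    by move=> uJ; rewrite fE// /stem rF iF.
  have cF c : cC m (F c) by split; [exact: ca|exact: cb].
  exists F; split=> //.
    by move=> c [x y]; rewrite /F /= aE bE mxE.
  move=> c; apply/funext => p.
  (* The equation on a single slice mixes the components; the slices of I and -I together give the
     vanishing of each one. *)
  have S0 J : imag_units J -> stem J (fun c => iter m (@dbar R) (F c)) p = 0.
    move=> uJ; have := f0 J p uJ.
    have -> : slice_restr f J = stem J F by apply/funext => x; exact: fS.
    rewrite (iter_cauchy_riemann_stem uJ cF) stemZ scalerA mulVf ?scale1r//.
  exact: (stem_inj uI (S0 I uI) (S0 _ (imag_unitN uI)) c).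
move=> [F [fS sF cF F0]]; split.
  exists (reS F), (imS F); split; last 2 first.
  - apply/class_C_coord => c.
    rewrite (_ : (fun p => _) = reF (F c)); last by apply/funext => p; rewrite reSE.
    by have [] := cF c.
  - apply/class_C_coord => c.
    rewrite (_ : (fun p => _) = imF (F c)); last by apply/funext => p; rewrite imSE.
    by have [] := cF c.
  split=> // x y; apply: quat_coordP => c.
    by rewrite !reSE (sF c (x, y)); case: (F c _).
  by rewrite [RHS]mxE !imSE (sF c (x, y)); case: (F c _).
move=> J p uJ.
have -> : slice_restr f J = stem J F by apply/funext => x; exact: fS.
rewrite (iter_cauchy_riemann_stem uJ cF) stemZ scalerA mulVf ?scale1r; last first.
  by rewrite expf_neq0// pnatr_eq0.
rewrite (_ : (fun c => _) = fun c p => (0 : R)%:C * F c p); first by rewrite stemZ scale0r.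
by apply/funext => c; apply/funext => x; rewrite F0 mul0r.
Qed.

Lemma slice_regularP I f : imag_units I -> slice_regular f <->
  exists F, [/\ forall J p, imag_units J -> f (slice_pt J p) = stem J F p,
    forall c, csym (F c) & forall c, ent (F c)].
Proof.
move=> uI; split=> [/(slice_polyanalyticP 1 f uI)|] [F].
  move=> [fS sF cF F0]; exists F; split=> // c; apply: ent_dbar => // p.
  by have := congr1 (fun g => g p) (F0 c).
move=> [fS sF eF]; apply/(slice_polyanalyticP 1 f uI); exists F; split=> // c.
  by have [] := eF c.
by apply/funext => p; exact: dbar_ent.
Qed.

Lemma qabs_sqr q : qabs q ^+ 2 = \sum_c q ord0 c ^+ 2.
Proof.
rewrite /qabs sqr_sqrtr ?addr_ge0 ?sqr_ge0//.
rewrite !big_ord_recr big_ord0 /= add0r /qre /qi /qj /qk.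
by do ![congr (_ + _)]; congr (_ ^+ 2); congr (q _ _); apply/val_inj; rewrite /= inordK.
Qed.

Notation mu2 := (@lebesgue_measure R \x @lebesgue_measure R)%E.

(** The right-hand side does not mention [I], which gives the independence of the chosen slice. *)
Lemma fock_integrableP I f F : imag_units I ->
  (forall J p, imag_units J -> f (slice_pt J p) = stem J F p) ->
  (forall c, csym (F c)) -> (forall c, ccont (F c)) ->
  fock_integrable I f <-> forall c, cL2 (F c).
Proof.
move=> uI fS sF cF.
pose S c p := stem I F p ord0 c.
have cS c : continuous (S c).
  have -> : S c = fun p => reF (F c) p + \sum_d (I * qe R d) ord0 c * imF (F d) p.
    by apply/funext => p; rewrite /S stem_coord.
  have cs (r : seq 'I_4) : continuous (fun p => \sum_(d <- r) (I * qe R d) ord0 c * imF (F d) p).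
    elim: r => [|d r IH]; first by under eq_fun do rewrite big_nil; move=> p; exact: cvg_cst.
    under eq_fun do rewrite big_cons; move=> p; apply: cvgD; last exact: IH.
    by apply: cvgM; [exact: cvg_cst|have [_ h] := cF d; exact: h].
  by move=> p; apply: cvgD; [have [h _] := cF c; exact: h|exact: cs].
have mS c := continuous_measurable2 (cS c).
have E : (\int[mu2]_p (qabs (f (slice_pt I p)) ^+ 2 * gauss (slice_pt I p))%:E =
    \int[mu2]_p \sum_c (S c p ^+ 2 * gw p)%:E)%E.
  apply: eq_integral => p _; rewrite sumEFin; congr (_%:E).
  by rewrite fS// gauss_slice_pt// qabs_sqr mulr_suml.
have SE : fock_integrable I f <-> forall c, L2 (S c).
  rewrite /fock_integrable E; split.
    move=> h c; apply: (@L2_bound R _ (fun p => \sum_c (S c p ^+ 2 * gw p)%:E)%E) => //.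
    - by apply: emeasurable_sum => d; exact: measurable_sqr_gw.
    - move=> p; rewrite sumEFin lee_fin (bigD1 c)//= lerDl sumr_ge0// => d _.
      exact: sqr_gw_ge0.
  move=> h; rewrite ge0_integral_sum//.
  - by apply: lte_sum_pinfty => c _; have [] := h c.
  - by move=> c; exact: measurable_sqr_gw.
  - by move=> c p _; rewrite lee_fin sqr_gw_ge0.
have sumL2 (k : 'I_4 -> R) (u : 'I_4 -> P -> R) (r : seq 'I_4) : (forall d, L2 (u d)) ->
    L2 (fun p => \sum_(d <- r) k d * u d p).
  move=> hu; elim: r => [|d r IH].
    have := L2Z 0 (hu ord0); congr L2; apply/funext => p; by rewrite big_nil mul0r.
  have := L2D (L2Z (k d) (hu d)) IH; congr L2; apply/funext => p; by rewrite big_cons.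
apply: (iff_trans SE); split=> h c; last first.
  have := L2D (proj1 (h c)) (sumL2 (fun d => (I * qe R d) ord0 c) _ (index_enum 'I_4) (fun d =>
    proj2 (h d))).
  by congr L2; apply/funext => p; rewrite /S stem_coord.
(* Half the sum of a + I b and its reflection is a; [im2] recovers b from half the difference,
   multiplied by -I. *)
have re2 d p : complex.Re (F d p) = 2^-1 * S d p + 2^-1 * S d (p.1, - p.2).
  rewrite /S !stem_coord sF.
  rewrite [X in _ = _ + 2^-1 * (_ + X)](_ : _ =
    - \sum_d0 (I * qe R d0) ord0 d * complex.Im (F d0 p)).
    by case: (F d p) => x y /=; field.
  rewrite -sumrN; apply: eq_bigr => e _; rewrite sF; case: (F e p) => x y /=; ring.
have im2 p : imS F p = - (I * (2^-1 *: (stem I F p - stem I F (p.1, - p.2)))).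
  have -> : stem I F (p.1, - p.2) = reS F p - I * imS F p.
    rewrite /stem -mulrN; congr (_ + _ * _); apply: quat_coordP => d;
      rewrite ?[RHS]mxE ?reSE ?imSE sF;
      by case: (F d p).
  rewrite /stem opprB addrC addrA subrK scalerDr -scalerDl (_ : 2^-1 + 2^-1 = 1 :> R);
    last by field.
  rewrite scale1r.
  by rewrite mulrA (imag_unitM uI) mulN1r opprK.
split.
  have := L2D (L2Z 2^-1 (h c)) (L2Z 2^-1 (L2_refl (h c))).
  by congr L2; apply/funext => p; rewrite /reF re2.
have := sumL2 (fun d => (I * qe R d) ord0 c) _ (index_enum 'I_4)
  (fun d => L2Z (- 2^-1) (L2D (h d) (L2Z (-1) (L2_refl (h d))))).
congr L2; apply/funext => p.
rewrite /imF -imSE im2 mxE coord_mull -sumrN; apply: eq_bigr => d _.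
by rewrite quat_coordZ quat_coordD [(- _ : H4) _ _]mxE /S; ring.
Qed.

End SliceRepresentation.

(** * The direct sum decomposition *)

Section FockSpaces.
Variable R : realType.
Notation C := R[i].
Notation P := (R * R)%type.
Notation H4 := (quat R).
Implicit Types (p : P) (I J q : H4) (F G : 'I_4 -> P -> C) (f g : H4 -> H4) (h : P -> C).

(** With every space in this form, the subspace axioms reduce to the stability of [W] under sums and
    real multiples. *)
Definition stem_space (W : (P -> C) -> Prop) : set (H4 -> H4) :=
  [set f | exists F, (forall c, W (F c)) /\
     forall J p, imag_units J -> f (slice_pt J p) = stem J F p].

Lemma stem_space_right (W : (P -> C) -> Prop) : W (fun=> 0) ->
  (forall h k, W h -> W k -> W (fun p => h p + k p)) ->
  (forall (k : R) h, W h -> W (fun p => k%:C * h p)) ->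
  right_subspace (stem_space W).
Proof.
move=> W0 WD WZ; split.
- exists (fun _ _ => 0); split=> // J p uJ.
  rewrite (_ : (fun _ _ => 0) = fun c p => (0 : R)%:C * (fun _ _ => 0) c p) ?stemZ ?scale0r//.
  by apply/funext => c; apply/funext => x; rewrite mulr0.
- move=> f g [F [WF fF]] [G [WG gG]]; exists (fun c p => F c p + G c p); split.
    by move=> c; exact: WD.
  by move=> J p uJ; rewrite stemD -fF// -gG.
- move=> f q [F [WF fF]].
  exists (fun c p => \sum_d ((qe R d * q) ord0 c)%:C * F d p); split.
    move=> c; elim: (index_enum _) => [|d r IH]; first by under eq_fun do rewrite big_nil.
    by under eq_fun do rewrite big_cons; apply: WD => //; exact: WZ.
  by move=> J p uJ; rewrite stem_mulr -fF.
Qed.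

Definition poly_fock (n : nat) h : Prop :=
  [/\ csym h, cC n h, iter n (@dbar R) h = (fun=> 0) & cL2 h].

(** The normalizing constant of the true polyanalytic space is absorbed into [K], being real and
    nonzero. *)
Definition true_fock (j : nat) h : Prop :=
  (exists K, [/\ ent K, csym K & h = iter j (@fockD R) K]) /\ cL2 h.

Lemma cL2_0 : cL2 (fun _ : P => 0 : C).
Proof.
have L0 : L2 (fun _ : P => 0 : R).
  split; first exact: measurable_cst.
  by under eq_integral do rewrite expr0n mul0r; rewrite integral0.
by split.
Qed.

Lemma csym0 : csym (fun _ : P => 0 : C).
Proof. by move=> p; rewrite conjc0. Qed.

Lemma poly_fock0 n : poly_fock n (fun=> 0).
Proof.
split; [exact: csym0|exact: nice_cC (nice_ent (@ent0 R))|exact: iter_dbar0|exact: cL2_0].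
Qed.

Lemma poly_fockD n h k : poly_fock n h -> poly_fock n k -> poly_fock n (fun p => h p + k p).
Proof.
move=> [a1 a2 a3 a4] [b1 b2 b3 b4]; split; [exact: csymD|exact: cCD| |exact: cL2D].
by rewrite (iter_dbarD a2 b2) a3 b3; apply/funext => p; rewrite addr0.
Qed.

Lemma poly_fockZ n (k : R) h : poly_fock n h -> poly_fock n (fun p => k%:C * h p).
Proof.
move=> [a1 a2 a3 a4]; split; [exact: csymZ|exact: cCZ| |exact: cL2Z].
by rewrite (iter_dbarZ _ a2) a3; apply/funext => p; rewrite mulr0.
Qed.

Lemma true_fock0 j : true_fock j (fun=> 0).
Proof.
split; last exact: cL2_0; exists (fun=> 0); split; [exact: ent0|exact: csym0|].
have := iter_fockDZ j 0 (nice_ent (@ent0 R)).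
rewrite (_ : (fun p => 0 * 0) = fun=> 0) => [->|]; last by apply/funext => p; rewrite mul0r.
by apply/funext => p; rewrite mul0r.
Qed.

Lemma true_fockD j h k : true_fock j h -> true_fock j k -> true_fock j (fun p => h p + k p).
Proof.
move=> [[H [eH sH ->]] Lh] [[K [eK sK ->]] Lk]; split; last exact: cL2D.
exists (fun p => H p + K p); split; [exact: entD|exact: csymD|].
by rewrite (iter_fockD_add j (nice_ent eH) (nice_ent eK)).
Qed.

Lemma true_fockZ j (k : R) h : true_fock j h -> true_fock j (fun p => k%:C * h p).
Proof.
move=> [[H [eH sH ->]] Lh]; split; last exact: cL2Z.
exists (fun p => k%:C * H p); split; [exact: entZ|exact: csymZ|].
by rewrite (iter_fockDZ j _ (nice_ent eH)).
Qed.

Lemma true_fock_poly j n h : (j < n)%N -> true_fock j h -> poly_fock n h.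
Proof.
move=> jn [[H [eH sH hE]] Lh]; split; last exact: Lh; rewrite hE.
- exact: csym_iter_fockD (nice_ent eH) sH.
- exact: nice_cC (nice_iter_fockD j (nice_ent eH)).
- exact: iter_dbar_gt.
Qed.

Lemma fock_spaceE n I : imag_units I -> fock_space n I = stem_space (poly_fock n).
Proof.
move=> uI; apply/seteqP; split=> f.
  move=> [/(slice_polyanalyticP n f uI) [F [fF sF cF F0]] L].
  exists F; split; last exact: fF.
  move=> c; split; [exact: sF|exact: cF|exact: F0|].
  by move: c; apply/(fock_integrableP uI fF sF (fun c => cC_cont (cF c))).
move=> [F [WF fF]].
have sF c : csym (F c) by have [] := WF c.
have cF c : cC n (F c) by have [] := WF c.
split.
  apply/(slice_polyanalyticP n f uI); exists F; split; [exact: fF|exact: sF|exact: cF|].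
  by move=> c; have [] := WF c.
apply/(fock_integrableP uI fF sF (fun c => cC_cont (cF c))) => c.
by have [] := WF c.
Qed.

Definition true_coef (j : nat) : R := (-1) ^+ j * Num.sqrt (1 / ((2 * pi) ^+ j * j`!%:R)).

Lemma true_coef_neq0 j : true_coef j != 0.
Proof.
rewrite mulf_neq0 ?expf_neq0 ?oppr_eq0 ?oner_eq0// gt_eqF// sqrtr_gt0 divr_gt0//.
by rewrite mulr_gt0 ?ltr0n ?fact_gt0 ?exprn_gt0 ?pi2_gt0.
Qed.

Lemma partials_real (u ux uy : P -> R) : (forall p, is_derive p (xdir R) u (ux p)) ->
  (forall p, is_derive p (ydir R) u (uy p)) ->
  partials (fun p => (u p)%:C) (fun p => (ux p)%:C) (fun p => (uy p)%:C).
Proof.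
move=> dx dy p; split.
- exact: (dx p).
- exact: (is_derive_cst (0 : R) p (xdir R)).
- exact: (dy p).
- exact: (is_derive_cst (0 : R) p (ydir R)).
Qed.

Lemma partials_gw : partials (fun p => (gw p)%:C)
  (fun p => (- (4 * pi * p.1) * gw p)%:C) (fun p => (- (4 * pi * p.2) * gw p)%:C).
Proof.
have d (k x : R) : is_derive x (1 : R) (fun x => expR (- (2 * pi * (x ^+ 2 + k))))
    (- (4 * pi * x) * expR (- (2 * pi * (x ^+ 2 + k)))).
  have dx := is_derive_id x (1 : R).
  have d2 := is_deriveN (is_deriveZ (2 * pi) (is_deriveD (is_deriveM dx dx)
    (is_derive_cst k x (1 : R)))).
  have H := @is_derive1_comp R _ (fun x =>
    - (2 * pi * (x * x + k))) _ _ _ (is_derive_expR (- (2 * pi * (x * x + k)))) d2.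
  rewrite (_ : (fun x => _) = expR \o (fun x => - (2 * pi * (x * x + k)))); last first.
    by apply/funext => z; rewrite /= expr2.
  by apply: is_derive_eq H _; rewrite /GRing.scale /= addr0 expr2; ring.
apply: (@partials_real (@gw R) (fun p => - (4 * pi * p.1) * gw p)
    (fun p => - (4 * pi * p.2) * gw p)) => p.
  exact: (proj2 (is_derive_exE (@gw R) p _) (d (p.2 ^+ 2) p.1)).
have gE (x y : R) : gw (x, y) = expR (- (2 * pi * (y ^+ 2 + x ^+ 2))).
  by rewrite /gw addrC.
have H := d (p.1 ^+ 2) p.2.
rewrite -gE -surjective_pairing in H.
have fE : (fun y => expR (- (2 * pi * (y ^+ 2 + p.1 ^+ 2)))) = fun y => gw (p.1, y).
  by apply/funext => y; rewrite gE.
rewrite fE in H; exact: (proj2 (is_derive_eyE (@gw R) p _) H).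
Qed.

Lemma del_gw h : cderiv h -> del (fun p => (gw p)%:C * h p) = fun p => (gw p)%:C * fockD h p.
Proof.
move=> dh; rewrite (delM (partials_cderiv partials_gw) dh) (partials_del partials_gw).
apply/funext => p; rewrite /fockD.
have -> : 2^-1 * ((- (4 * pi * p.1) * gw p)%:C - iC R * (- (4 * pi * p.2) * gw p)%:C) =
    (gw p)%:C * ((- (2 * pi))%:C * conjz p).
  have -> : (2^-1 : C) = (2^-1 : R)%:C by rewrite fmorphV rmorph_nat.
  by move: (gw p) => g; apply: complexP; rewrite !ReIm /=; field.
by ring.
Qed.

Lemma iter_slice_d_gauss j J F : imag_units J -> (forall c, ent (F c)) ->
  iter j (slice_d J) (stem J (fun c p => (gw p)%:C * F c p)) =
  stem J (fun c p => (gw p)%:C * iter j (@fockD R) (F c) p).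
Proof.
move=> uJ eF; have nF k c := nice_iter_fockD k (nice_ent (eF c)).
apply: (iter_slice_d_stem (F := fun k c p => (gw p)%:C * iter k (@fockD R) (F c) p)) => // k c.
  exact: partials_cderiv (partialsM partials_gw (nice_cderiv (nF k c))).
by rewrite (del_gw (nice_cderiv (nF k c))).
Qed.

Lemma stemZ_fun J (k : P -> R) F p : stem J (fun c p => (k p)%:C * F c p) p = k p *: stem J F p.
Proof. by rewrite -stemZ /stem; congr (_ + _ * _); apply: quat_coordP => c;
  rewrite ?reSE ?imSE. Qed.

(** Each slice derivative passes through the weight as D; the remaining weight cancels against the
    outer exponential. *)
Lemma true_fock_formula j J p (Hq : H4 -> H4) F : imag_units J -> (forall c, ent (F c)) ->
  (forall J p, imag_units J -> Hq (slice_pt J p) = stem J F p) ->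
  (((-1) ^+ j * Num.sqrt (1 / ((2 * pi) ^+ j * j`!%:R)))
     * expR (2 * pi * qabs (slice_pt J p) ^+ 2))
    *: slice_deriv j (fun q => gauss q *: Hq q) J p =
  stem J (fun c => iter j (@fockD R) (fun p => (true_coef j)%:C * F c p)) p.
Proof.
move=> uJ eF HF; rewrite /slice_deriv.
have -> : slice_restr (fun q => gauss q *: Hq q) J = stem J (fun c p => (gw p)%:C * F c p).
  by apply/funext => x; rewrite /slice_restr gauss_slice_pt// HF// stemZ_fun.
rewrite iter_slice_d_gauss// stemZ_fun scalerA -mulrA qabs_slice_pt//.
rewrite (_ : expR _ * gw p = 1) ?mulr1; last by rewrite /gw -expRD addrN expR0.
rewrite -/(true_coef j) -stemZ; congr (stem _ _ _); apply/funext => c.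
by rewrite (iter_fockDZ j _ (nice_ent (eF c))).
Qed.

Lemma true_fock_spaceE j I : imag_units I -> true_fock_space j I = stem_space (true_fock j).
Proof.
move=> uI; apply/seteqP; split=> f.
  move=> [L [Hq /(slice_regularP Hq uI) [F [HF sF eF]] fH]].
  have eK c : ent (fun p => (true_coef j)%:C * F c p) by exact: entZ.
  have sK c : csym (fun p => (true_coef j)%:C * F c p) by exact: csymZ.
  have fS J p : imag_units J -> f (slice_pt J p) =
      stem J (fun c => iter j (@fockD R) (fun p => (true_coef j)%:C * F c p)) p.
    by move=> uJ; rewrite fH// (true_fock_formula j p uJ eF HF).
  exists (fun c => iter j (@fockD R) (fun p => (true_coef j)%:C * F c p)); split; last exact: fS.
  move=> c; split; first by exists (fun p => (true_coef j)%:C * F c p); split;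
    [exact: eK|exact: sK|].
  move: c; apply/(fock_integrableP uI fS) => // c.
    exact: csym_iter_fockD (nice_ent (eK c)) (sK c).
  exact: nice_cont (nice_iter_fockD j (nice_ent (eK c))).
move=> [F [WF fF]].
have [K hK] := choice (fun c => proj1 (WF c)).
have nF c : nice (F c).
  by have [e _ ->] := hK c; exact: nice_iter_fockD (nice_ent e).
have sF c : csym (F c).
  by have [e s ->] := hK c; exact: csym_iter_fockD (nice_ent e) s.
split.
  apply/(fock_integrableP uI fF sF (fun c => nice_cont (nF c))) => c.
  by have [] := WF c.
(* Dividing by [true_coef j] undoes the normalization in the formula to be matched. *)
pose K' c p : C := ((true_coef j)^-1)%:C * K c p.
have eK' c : ent (K' c) by apply: entZ; have [] := hK c.
have sK' c : csym (K' c) by apply: csymZ; have [] := hK c.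
exists (of_stem K').
  by apply/(slice_regularP _ uI); exists K'; split=> // J p uJ; exact: of_stemE.
move=> J p uJ; rewrite (true_fock_formula j p uJ eK') => [|{}J {}p {}uJ]; last exact: of_stemE.
rewrite fF//; congr (stem _ _ _); apply/funext => c; have [_ _ ->] := hK c.
congr (iter _ _ _); apply/funext => x; rewrite /K' mulrA -rmorphM /= mulfV ?mul1r//.
exact: true_coef_neq0.
Qed.

Lemma true_fock_poly_space j n f : (j < n)%N ->
  stem_space (true_fock j) f -> stem_space (poly_fock n) f.
Proof.
move=> jn [F [WF fF]]; exists F; split; last exact: fF.
by move=> c; exact: true_fock_poly jn (WF c).
Qed.

Lemma poly_fock_decomp n h : poly_fock n h -> exists G : nat -> P -> C,
  (forall j, (j < n)%N -> true_fock j (G j)) /\ h = fun p => \sum_(j < n) G j p.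
Proof.
move=> [sh ch h0 Lh]; have [H [eH sH hE]] := poly_decomp ch sh h0.
exists (fun j => iter j (@fockD R) (H j)); split; last exact: hE.
move=> j jn; split; first by exists (H j).
by apply: (comp_L2 eH _ jn); rewrite -hE.
Qed.

Lemma true_fock_sum_inj n (G K : nat -> P -> C) :
  (forall j, (j < n)%N -> true_fock j (G j)) ->
  (forall j, (j < n)%N -> true_fock j (K j)) ->
  (forall p, \sum_(j < n) G j p = \sum_(j < n) K j p) ->
  forall j, (j < n)%N -> G j = K j.
Proof.
move=> WG WK GK.
(* The differences again belong to the true spaces; beyond the range the value 0 completes a
   sequence of entire functions. *)
have W j : exists H, ent H /\ ((j < n)%N ->
    (fun p => G j p + (-1 : R)%:C * K j p) = iter j (@fockD R) H).
  have [jn|] := boolP (j < n)%N; last by exists (fun=> 0); split=> //; exact: ent0.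
  have [[H [eH _ HE]] _] := true_fockD (WG j jn) (true_fockZ (-1) (WK j jn)).
  by exists H.
have [H hH] := choice W.
have eH j : ent (H j) by have [] := hH j.
have S0 p : \sum_(j < n) iter j (@fockD R) (H j) p = 0.
  transitivity (\sum_(j < n) (G j p + (-1 : R)%:C * K j p)).
    by apply: eq_bigr => j _; have [_ E] := hH j; rewrite -(E (ltn_ord j)).
  by rewrite big_split /= -mulr_sumr GK rmorphN1 mulN1r subrr.
move=> j jn; have [_ E] := hH j; apply/funext => p.
have := congr1 (fun k : P -> C => k p) (etrans (E jn) (poly_sum_eq0 eH S0 jn)).
by rewrite /= rmorphN1 mulN1r => /eqP; rewrite subr_eq0 => /eqP.
Qed.

(** Passes from ordinals to natural indices, the form in which the scalar uniqueness result is
    stated. *)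
Lemma stem_space_family n (W : nat -> (P -> C) -> Prop) (g : 'I_n -> H4 -> H4) :
  (forall j : 'I_n, stem_space (W j) (g j)) -> exists F : nat -> 'I_4 -> P -> C,
  (forall (j : 'I_n) c, W j (F j c)) /\
  forall (j : 'I_n) J p, imag_units J -> g j (slice_pt J p) = stem J (F j) p.
Proof.
move=> Wg.
have Wn (j : nat) : exists F : 'I_4 -> P -> C, forall jn : (j < n)%N, (forall c, W j (F c)) /\
     forall J p, imag_units J -> g (Ordinal jn) (slice_pt J p) = stem J F p.
  have [jn|nj] := pselect (is_true (j < n)%N); last by exists (fun _ _ => 0) => jn.
  have [F hF] := Wg (Ordinal jn); exists F => jn'.
  by rewrite (bool_irrelevance jn' jn).
have [F hF] := choice Wn; exists F; split=> [[j jn] c|[j jn] J p uJ].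
  by have [a _] := hF j jn; exact: a.
by have [_ b] := hF j jn; exact: b.
Qed.

Lemma sum_slice n (g : 'I_n -> H4 -> H4) q : (\sum_(j < n) g j) q = \sum_(j < n) g j q.
Proof. by rewrite fct_sumE. Qed.

End FockSpaces.

Theorem theorem3p4 (R : realType) (n : nat) (I : quat R) (hI : imag_units I) :
  is_direct_sum (fock_space n.+1 I)
    (fun j : 'I_n.+1 => true_fock_space (nat_of_ord j) I).
Proof.
have tE : (fun j : 'I_n.+1 => true_fock_space (nat_of_ord j) I) =
    fun j : 'I_n.+1 => stem_space (true_fock (R := R) j).
  by apply/funext => j; rewrite true_fock_spaceE.
rewrite tE (fock_spaceE n.+1 hI).
have rV : right_subspace (stem_space (poly_fock (R := R) n.+1)).
  by apply: stem_space_right; [exact: poly_fock0|exact: poly_fockD|exact: poly_fockZ].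
split; first exact: rV.
- move=> j; apply: stem_space_right; [exact: true_fock0|exact: true_fockD|exact: true_fockZ].
- apply/seteqP; split=> [f [F [WF fF]]|_ [g Wg <-]].
    (* Each of the four coordinates is decomposed on its own; the pieces of equal index j are then
       reassembled into a function on H. *)
    have [G hG] := choice (fun c => poly_fock_decomp (WF c)).
    have sG c j : (j < n.+1)%N -> csym (G c j).
      move=> jn; have [WG _] := hG c; have [[H [eH sH ->]] _] := WG j jn.
      exact: csym_iter_fockD (nice_ent eH) sH.
    exists (fun j => of_stem (fun c => G c j)).
      move=> j; exists (fun c => G c j); split.
        by move=> c; have [WG _] := hG c; exact: WG.
      by move=> J p uJ; apply: of_stemE => // c; exact: sG.
    apply: (slice_ext hI) => J p uJ; rewrite sum_slice fF//.
    rewrite (eq_bigr (fun j : 'I_n.+1 => stem J (fun c => G c j) p)); last first.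
      by move=> j _; apply: of_stemE => // c; exact: sG.
    rewrite -(stem_sum J n.+1 (fun j c => G c j) p); congr (stem _ _ _).
    by apply/funext => c; have [_ ->] := hG c.
  have [V0 VD _] := rV.
  elim/big_ind: _ => [|f f' Vf Vf'|j _]; [exact: V0|exact: VD|].
  exact: true_fock_poly_space (ltn_ord j) (Wg j).
- move=> g g' Wg Wg' E.
  have [F [WF gF]] := stem_space_family (W := fun j => true_fock (R := R) j) Wg.
  have [F' [WF' gF']] := stem_space_family (W := fun j => true_fock (R := R) j) Wg'.
  have FF j c : (j < n.+1)%N -> F j c = F' j c.
    apply: (true_fock_sum_inj (n := n.+1) (G := fun j => F j c) (K := fun j => F' j c)).
    + by move=> i ii; exact: (WF (Ordinal ii)).
    + by move=> i ii; exact: (WF' (Ordinal ii)).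
    move=> p.
    (* Equality of the sums holds on every slice; using both I and -I transfers it to the complex
       coordinates. *)
    have S J : imag_units J ->
        stem J (fun c p => \sum_(j < n.+1) F j c p + (-1 : R)%:C * \sum_(j < n.+1) F' j c p) p = 0.
      move=> uJ; rewrite stemD stemZ !stem_sum scaleN1r.
      rewrite -(eq_bigr _ (fun j _ => gF j J p uJ)) -(eq_bigr _ (fun j _ => gF' j J p uJ)).
      by rewrite -!sum_slice E subrr.
    have := stem_inj hI (S I hI) (S _ (imag_unitN hI)) c.
    by rewrite rmorphN1 mulN1r => /eqP; rewrite subr_eq0 => /eqP.
  move=> j; apply: (slice_ext hI) => J p uJ; rewrite gF// gF'//; congr (stem _ _ _).
  by apply/funext => c; apply: FF.
Qed.
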